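(* Let $0<p<\infty$, $0<q<\infty$ and let $\mu$ be a positive Borel measure on the open unit disc $\mathbb{D}$. Then the following statements are equivalent. (1) The inclusion mapping $i:\mathcal{D}^{p}_{p-1}\rightarrow T_{p,q}(\mu)$ is bounded. (2) $\mu$ is a $(q+1)$-Carleson measure. (3) The inclusion mapping $i: A^{p}_{q-1}\rightarrow L^{p}(\mu)$ is bounded.
   Context: $\mathbb{D}$ is the open unit disc of $\mathbb{C}$, $\partial\mathbb{D}$ the unit circle, $H(\mathbb{D})$ the space of analytic functions on $\mathbb{D}$, and $dA(z)=\frac1\pi\,dx\,dy$ the normalized area measure. Dirichlet type space: $\mathcal{D}^{p}_{p-1}$ is the set of $f\in H(\mathbb{D})$ with $$\|f\|_{\mathcal{D}^{p}_{p-1}}=\Big(|f(0)|^{p}+\int_{\mathbb{D}}|f'(z)|^{p}(1-|z|^{2})^{p-1}dA(z)\Big)^{1/p}<\infty.$$ Weighted Bergman space: for $\alpha>-1$, $A^p_\alpha$ is the set of $f\in H(\mathbb{D})$ with $\|f\|_{A^p_\alpha}^p=\int_{\mathbb{D}}|f(z)|^p(1-|z|^2)^{\alpha}dA(z)<\infty$. For an arc $I\subset\partial\mathbb{D}$, $|I|=\frac{1}{2\pi}\int_I|d\zeta|$ is its normalized length and $S(I)=\{r\zeta\in\mathbb{D}: 1-|I|\le r<1,\ \zeta\in I\}$ is the Carleson square. For $0<s<\infty$, a positive Borel measure $\mu$ on $\mathbb{D}$ is an $s$-Carleson measure if $\sup_{I\subset\partial\mathbb{D}}\mu(S(I))/|I|^{s}<\infty$,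 the supremum being over all arcs. Tent space: $f$ belongs to $T_{p,q}(\mu)$ if $$\|f\|_{T_{p,q}}^{p}=\sup_{I\subset\partial\mathbb{D}}\frac{1}{|I|^{q}}\int_{S(I)}|f(z)|^{p}d\mu(z)<\infty.$$ For exponents less than 1 these are quasi-norms; boundedness of an inclusion $X\to Y$ means $\|f\|_Y\le C\|f\|_X$ for all $f\in X$, with $C$ independent of $f$. *)

(* Defs.v *)
From mathcomp Require Import all_boot all_order all_algebra.
From mathcomp Require Import all_classical all_reals all_analysis.
From mathcomp Require Import complex.

Set Implicit Arguments.
Unset Strict Implicit.
Unset Printing Implicit Defensive.

Import Order.TTheory GRing.Theory Num.Theory numFieldNormedType.Exports.

Local Open Scope classical_set_scope.
Local Open Scope ring_scope.
Local Open Scope complex_scope.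

(* R[i] bundled as a numFieldType: numFieldNormedType equips it with the norm
   topology and makes it a normed space over itself, so that derivable and
   derive1 at functions C R -> C R denote complex differentiation. *)
Definition C (R : realType) : numFieldType := R[i].

(* Measures live on R * R, identified with the complex plane; its product
   sigma-algebra is the Borel sigma-algebra of the plane. *)
Definition cplx (R : realType) (w : R * R) : C R := w.1 +i* w.2.

Definition cabs (R : realType) (z : C R) : R := Normc.normc z.

Definition disc (R : realType) : set (R * R) := [set w | cabs (cplx w) < 1].

(* Functions on the disc are represented by total functions; only their values
   on the disc matter in everything below. *)
Definition analytic_disc (R : realType) (f : C R -> C R) : Prop :=
  forall z : C R, cabs z < 1 -> derivable f z 1.

Definition bounded_inclusion (R : realType) (X : set (C R -> C R))
    (normX normY : (C R -> C R) -> \bar R) : Prop :=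
  exists K : R, forall f, X f -> (normY f <= K%:E * normX f)%E.

(* Integral over the disc against dA = dx dy / pi *)
Definition area_integral (R : realType) (g : R * R -> \bar R) : \bar R :=
  ((pi^-1)%:E *
   \int[@lebesgue_measure R \x @lebesgue_measure R]_(w in @disc R) g w)%E.

Definition dirichlet_norm (R : realType) (p : R) (f : C R -> C R) : \bar R :=
  (((cabs (f 0) `^ p)%:E +
    area_integral (fun w => (cabs (derive1 f (cplx w)) `^ p *
                    (1 - cabs (cplx w) ^+ 2) `^ (p - 1))%:E)) `^ p^-1)%E.

Definition dirichlet (R : realType) (p : R) : set (C R -> C R) :=
  [set f | analytic_disc f /\ (dirichlet_norm p f < +oo)%E].

Definition bergman_norm (R : realType) (p alpha : R) (f : C R -> C R) :
    \bar R :=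
  (area_integral (fun w => (cabs (f (cplx w)) `^ p *
                    (1 - cabs (cplx w) ^+ 2) `^ alpha)%:E) `^ p^-1)%E.

Definition bergman (R : realType) (p alpha : R) : set (C R -> C R) :=
  [set f | analytic_disc f /\ (bergman_norm p alpha f < +oo)%E].

(* The arcs of the unit circle of positive length, with or without their
   endpoints; an arc is given by a range of arguments. *)
Record circle_arc (R : realType) := CircleArc {
  arc_left : bool ;
  arc_right : bool ;
  arc_start : R ;
  arc_end : R ;
  arc_proper : arc_start < arc_end <= arc_start + 2 * pi }.

Definition arc_set (R : realType) (I : circle_arc R) : set (C R) :=
  [set cos t +i* sin t | t in
    [set` Interval (BSide (arc_left I) (arc_start I))
                   (BSide (arc_right I) (arc_end I))]].

Definition arc_length (R : realType) (I : circle_arc R) : R :=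
  (arc_end I - arc_start I) / (2 * pi).

Definition carleson_square (R : realType) (I : circle_arc R) : set (R * R) :=
  [set w | exists (r : R) (zeta : C R),
    [/\ 1 - arc_length I <= r < 1, arc_set I zeta & cplx w = r%:C * zeta]].

Definition carleson_measure (R : realType) (s : R)
    (mu : {measure set (R * R) -> \bar R}) : Prop :=
  (ereal_sup (range (fun I : circle_arc R =>
     ((arc_length I `^ s)^-1)%:E * mu (carleson_square I))) < +oo)%E.

Definition tent_norm (R : realType) (p q : R)
    (mu : {measure set (R * R) -> \bar R}) (f : C R -> C R) : \bar R :=
  (ereal_sup (range (fun I : circle_arc R =>
     ((arc_length I `^ q)^-1)%:E *
     \int[mu]_(w in carleson_square I) (cabs (f (cplx w)) `^ p)%:E)) `^ p^-1)%E.

(* The measure mu is carried by the disc: f is extended by 0 outside. *)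
Definition Lp_norm (R : realType) (p : R)
    (mu : {measure set (R * R) -> \bar R}) (f : C R -> C R) : \bar R :=
  ('N[mu]_(p%:E)[(fun w => (cabs (f (cplx w)))%:E) \_ (@disc R)])%E.

(* Main.v *)
(* Everything rests on a sub-mean-value inequality.  Writing the boundary integral
   of (E(w) - l)/w over a small square as a line integral of a closed form, and
   using Goursat's bisection on the punctured square, gives s |l| <= C int |E| over
   the boundary of the square of size s, both for E = f, l = f(c) and for E = f',
   l = f'(c); integrating in s yields a^2 |l|^p <= C int |E|^p over a square of
   size a around c (for p < 1 by maximising d^(2/p) |E|, d the distance to the
   boundary).

   Carleson => Bergman: insert this bound into the mu-integral of |f|^p and use
   Tonelli with mu{z : |z - w| <= C(1 - |w|)} <= C (1 - |w|)^(q+1).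

   Carleson => tent: let A(z) be the integral of |f'(w)|^p (1 - |w|)^(p-1) against
   the kernel (1 - |w|)^(e-1) (1 - |z|)^(-e) over the cone |w - z| <= 3(1 - |w|),
   with 0 < e < min(q, 1).  The mean value inequality along the radius [0, z] bounds
   |f'(x z)|^p by C (1 - x|z|)^(-p-e) (1 - |z|)^e A(z), and integrating the p-th root
   in x gives |f(z)|^p <= C (|f(0)|^p + A(z)).  By Tonelli the mu-integral of A over
   S(I) is at most C |I|^q times the Dirichlet integral.

   Conversely test on (h / (1 - (1 - h) e^(-it) z))^N with h = |I|, e^(it) an
   endpoint of I and N p > q + 1.  This function is bounded below on S(I); its norms are
   estimated by dyadic annuli around e^(it), because area itself is a 2-Carleson
   measure. *)
Require Import Defs.
From HB Require Import structures.
From mathcomp Require Import all_boot all_order all_algebra.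
From mathcomp Require Import all_classical all_reals all_analysis.
From mathcomp Require Import measurable_realfun.
From mathcomp Require Import complex ring lra.

Set Implicit Arguments.
Unset Strict Implicit.
Unset Printing Implicit Defensive.

Import Order.TTheory GRing.Theory Num.Theory numFieldNormedType.Exports.

Local Open Scope classical_set_scope.
Local Open Scope ring_scope.
Local Open Scope complex_scope.

(** * Line integrals along the boundary of a rectangle *)

(** Only pointwise complex differentiability is given, so neither Cauchy's formula nor
    differentiability of f' is at hand. The residue is replaced by a sign: multiplying by the
    conjugate of l turns the principal part into |l|^2/w, and the imaginary part of its boundary
    integral is at least 4|l|^2 by a pointwise bound on opposite sides. For E = f' the quotient (f'
    - l)/w is not known to be closed; it is split into the exact part ((f - f(c))/w)' and the
    remainder (f - f(c) - l w)/w^2, which is differentiable off the centre and o(1/|w|) there.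
    Integrating the exact part needs f' continuous, and this comes from the same inequality applied
    to difference quotients.

    On the measure side all p are treated alike, by pointwise kernel bounds and Tonelli. With e = 0
    the radial bound would be |f'(xz)| <= C (1 - x|z|)^(-1) A(z)^(1/p), whose integral in x grows
    logarithmically as |z| -> 1. A positive e removes the logarithm; its cost, the integral of (1 -
    |z|)^(-e) against mu near the boundary, is controlled because e < q. *)

Lemma le_of_eq d (T : porderType d) (x y : T) : x = y -> (x <= y)%O.
Proof. by move->. Qed.

Section segment_integral.
Context {R : realType}.
Implicit Types (f g : R -> R) (a b m : R).

Definition segint g a b : R := \int[lebesgue_measure]_(x in `[a, b]) g x.

Lemma continuous_integrable g a b : {in `[a, b], continuous g} ->
  (@lebesgue_measure R).-integrable `[a, b] (EFin \o g).
Proof.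
move=> cg; apply: continuous_compact_integrable; first exact: segment_compact.
by apply: continuous_in_subspaceT => x /set_mem xab; exact: cg.
Qed.

Lemma segint_split g a m b : a <= m -> m <= b -> {in `[a, b], continuous g} ->
  segint g a b = segint g a m + segint g m b.
Proof.
move=> am mb cg; have ig := continuous_integrable cg.
have := @Rintegral_itvB _ g (BLeft a) (BRight b) m ig.
rewrite !bnd_simp => /(_ am mb) /(canRL (subrK _)).
rewrite /segint => ->; rewrite addrC; congr (_ + _).
rewrite Rintegral_itv_obnd_cbnd//; apply: integrableS ig => //.
by apply: subset_itvr; rewrite bnd_simp.
Qed.

Lemma segintD f g a b : {in `[a, b], continuous f} ->
  {in `[a, b], continuous g} ->
  segint (fun x => f x + g x) a b = segint f a b + segint g a b.
Proof.
by move=> cf cg; rewrite /segint RintegralD//; exact: continuous_integrable.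
Qed.

Lemma le_segint f g a b : {in `[a, b], continuous f} ->
  {in `[a, b], continuous g} -> {in `[a, b], forall x, f x <= g x} ->
  segint f a b <= segint g a b.
Proof.
move=> cf cg fg; apply: le_Rintegral => //; try exact: continuous_integrable.
Qed.

Lemma segint_cst k a b : a <= b -> segint (fun=> k) a b = k * (b - a).
Proof.
move=> ab; rewrite /segint Rintegral_cst//= lebesgue_measure_itv/= lte_fin.
case: ltgtP ab => // -> _.
by rewrite subrr.
Qed.

Lemma segint_near_cst g k e a b : a <= b -> {in `[a, b], continuous g} ->
  {in `[a, b], forall x, `|g x - k| <= e} ->
  `|segint g a b - k * (b - a)| <= e * (b - a).
Proof.
move=> ab cg ge; have ck (c : R) : {in `[a, b], continuous (fun=> c)}.
  by move=> x _; exact: cvg_cst.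
rewrite ler_norml; apply/andP; split.
  rewrite lerBrDr addrC -mulNr -mulrDl -(segint_cst _ ab) le_segint// => x xab.
  by have := ge x xab; rewrite ler_norml => /andP[+ _]; lra.
rewrite lerBlDr -mulrDl -(segint_cst _ ab) le_segint// => x xab.
by have := ge x xab; rewrite ler_norml => /andP[_]; lra.
Qed.

End segment_integral.

Section forms.
Context {R : realType}.
Implicit Types (P Q : R -> R -> R) (a b c d : R).

(* The counterclockwise integral of P dx + Q dy along the boundary of
   [a, b] x [c, d]; opposite sides are kept under one integral sign. *)
Definition bdint P Q a b c d : R :=
  segint (fun x => P x c - P x d) a b + segint (fun y => Q b y - Q a y) c d.

(* Differentiability at (x, y) of the coefficients of P dx + Q dy, with the
   closedness condition dP/dy = dQ/dx. *)
Definition closed_at P Q (x y : R) : Prop :=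
  exists u v w : R, forall e, 0 < e -> exists2 dl, 0 < dl &
    forall h k, `|h| <= dl -> `|k| <= dl ->
    `|P (x + h) (y + k) - P x y - u * h - v * k| <= e * (`|h| + `|k|) /\
    `|Q (x + h) (y + k) - Q x y - v * h - w * k| <= e * (`|h| + `|k|).

Lemma diff_continuous1 P (x y u v : R) :
  (forall e, 0 < e -> exists2 dl, 0 < dl &
    forall h k, `|h| <= dl -> `|k| <= dl ->
    `|P (x + h) (y + k) - P x y - u * h - v * k| <= e * (`|h| + `|k|)) ->
  {for x, continuous (P^~ y)} /\ {for y, continuous (P x)}.
Proof.
move=> /(_ _ ltr01)[dl dl0 H].
have aux (e : R) : 0 < e -> exists2 r, 0 < r &
    forall h k, `|h| <= r -> `|k| <= r -> `|P x y - P (x + h) (y + k)| <= e.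
  (* The 2 absorbs the error |h| + |k| of the expansion taken with constant 1. *)
  move=> e0; pose K := `|u| + `|v| + 2.
  have K0 : 0 < K by rewrite /K; have := normr_ge0 u; have := normr_ge0 v; lra.
  exists (Num.min dl (e / K)) => [|h k]; first by rewrite lt_min dl0 divr_gt0.
  rewrite !le_min => /andP[hd he] /andP[kd ke].
  have := H h k hd kd; rewrite mul1r => {}H.
  have uh : `|u * h| <= `|u| * (e / K) by rewrite normrM ler_wpM2l.
  have vk : `|v * k| <= `|v| * (e / K) by rewrite normrM ler_wpM2l.
  have -> : e = (`|u| + `|v| + 2) * (e / K) by rewrite -/K mulrCA divff ?mulr1 ?gt_eqF.
  rewrite distrC !mulrDl.
  have -> : P (x + h) (y + k) - P x y =
    (P (x + h) (y + k) - P x y - u * h - v * k) + u * h + v * k by ring.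
  apply: (le_trans (ler_normD _ _)).
  apply: le_trans (lerD (ler_normD _ _) (lexx _)) _; lra.
split; apply/cvgrPdist_le => e e0; have [r r0 Hr] := aux _ e0.
  near=> z; have := Hr (z - x) 0; rewrite addr0 subrKC; apply; last first.
    by rewrite normr0 ltW.
  by rewrite distrC; near: z; apply: cvgr_dist_le.
near=> z; have := Hr 0 (z - y); rewrite addr0 subrKC; apply.
  by rewrite normr0 ltW.
by rewrite distrC; near: z; apply: cvgr_dist_le.
Unshelve. all: by end_near. Qed.

Lemma closed_at_continuous P Q x y : closed_at P Q x y ->
  [/\ {for x, continuous (P^~ y)}, {for y, continuous (P x)},
      {for x, continuous (Q^~ y)} & {for y, continuous (Q x)}].
Proof.
move=> [u [v [w H]]].
have [|p1 p2] := @diff_continuous1 P x y u v.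
  by move=> e /H[dl dl0 K]; exists dl => // h k hd kd; have [] := K h k hd kd.
have [|q1 q2] := @diff_continuous1 Q x y v w.
  by move=> e /H[dl dl0 K]; exists dl => // h k hd kd; have [] := K h k hd kd.
by split.
Qed.

Lemma bdint_splitx P Q a m b c d : a <= m -> m <= b ->
  {in `[a, b], continuous (P^~ c)} -> {in `[a, b], continuous (P^~ d)} ->
  {in `[c, d], continuous (Q a)} -> {in `[c, d], continuous (Q m)} ->
  {in `[c, d], continuous (Q b)} ->
  bdint P Q a b c d = bdint P Q a m c d + bdint P Q m b c d.
Proof.
move=> am mb cP dP aQ mQ bQ; rewrite /bdint (segint_split am mb); last first.
  by move=> x xab; apply: cvgB; [exact: cP|exact: dP].
rewrite (_ : (fun y => Q b y - Q a y) =
    (fun y => (Q m y - Q a y) + (Q b y - Q m y))); last first.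
  by apply/funext => y; ring.
rewrite (@segintD _ (fun y => Q m y - Q a y)); [ring| |] => y ycd; apply: cvgB;
  [exact: mQ|exact: aQ|exact: bQ|exact: mQ].
Qed.

Lemma bdint_splity P Q a b c m d : c <= m -> m <= d ->
  {in `[a, b], continuous (P^~ c)} -> {in `[a, b], continuous (P^~ m)} ->
  {in `[a, b], continuous (P^~ d)} ->
  {in `[c, d], continuous (Q a)} -> {in `[c, d], continuous (Q b)} ->
  bdint P Q a b c d = bdint P Q a b c m + bdint P Q a b m d.
Proof.
move=> cm md cP mP dP aQ bQ; rewrite /bdint (segint_split cm md); last first.
  by move=> x xab; apply: cvgB; [exact: bQ|exact: aQ].
rewrite (_ : (fun x => P x c - P x d) =
    (fun x => (P x c - P x m) + (P x m - P x d))); last first.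
  by apply/funext => y; ring.
rewrite (@segintD _ (fun x => P x c - P x m)); [ring| |] => y ycd; apply: cvgB;
  [exact: cP|exact: mP|exact: mP|exact: dP].
Qed.

End forms.

(** * Goursat's theorem *)

Section goursat.
Context {R : realType}.

(** If [Pr] failed on the whole square, some quarter would fail at every stage, and these quarters
    shrink to a point where the second hypothesis contradicts the failure. The predicate is
    arbitrary because Goursat's theorem, uniform continuity and boundedness all use this
    argument. *)
Lemma square_bisection (Pr : R -> R -> R -> Prop) (X Y L : R) : 0 < L ->
  (forall x y l, 0 < l -> Pr x y (l / 2) -> Pr (x + l / 2) y (l / 2) ->
    Pr x (y + l / 2) (l / 2) -> Pr (x + l / 2) (y + l / 2) (l / 2) ->
    Pr x y l) ->
  (forall x0 y0, X <= x0 <= X + L -> Y <= y0 <= Y + L ->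
    exists2 dl, 0 < dl & forall x y l, 0 < l <= dl ->
      x <= x0 <= x + l -> y <= y0 <= y + l -> Pr x y l) ->
  Pr X Y L.
Proof.
move=> L0 Hstep Hloc; apply: contrapT => nPr.
(* [nxt] picks a failing quarter of a failing square; (0, 0) is a dummy in the remaining cases. *)
have /choice[nxt Hnxt] : forall s : R * R * R, exists t : R * R,
    0 < s.2 -> ~ Pr s.1.1 s.1.2 s.2 ->
    [/\ s.1.1 <= t.1, t.1 + s.2 / 2 <= s.1.1 + s.2,
        s.1.2 <= t.2, t.2 + s.2 / 2 <= s.1.2 + s.2 & ~ Pr t.1 t.2 (s.2 / 2)].
  move=> [[x y] l] /=; have [l0|] := boolP (0 < l); last by exists (0, 0).
  have [?|n1] := EM (Pr x y (l / 2)); last first.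
    by exists (x, y) => /= _ _; split => //; lra.
  have [?|n1] := EM (Pr (x + l / 2) y (l / 2)); last first.
    by exists (x + l / 2, y) => /= _ _; split => //; lra.
  have [?|n1] := EM (Pr x (y + l / 2) (l / 2)); last first.
    by exists (x, y + l / 2) => /= _ _; split => //; lra.
  have [?|n1] := EM (Pr (x + l / 2) (y + l / 2) (l / 2)); last first.
    by exists (x + l / 2, y + l / 2) => /= _ _; split => //; lra.
  by exists (0, 0) => /= _ []; exact: Hstep.
pose u := fix u n : R * R * R :=
  if n is n'.+1 then (nxt (u n'), (u n').2 / 2) else (X, Y, L).
have ul n : (u n).2 = L / 2 ^+ n.
  by elim: n => [|n /= ->]; rewrite ?expr0 ?divr1// exprSr invfM mulrA.
have ul0 n : 0 < (u n).2 by rewrite ul divr_gt0// exprn_gt0.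
have uP n : ~ Pr (u n).1.1 (u n).1.2 (u n).2.
  by elim: n => [//|n IH] /=; have [] := Hnxt (u n) (ul0 n) IH.
have uS n := Hnxt (u n) (ul0 n) (uP n).
have xm n m : (u n).1.1 <= (u (n + m)%N).1.1 /\
    (u (n + m)%N).1.1 + (u (n + m)%N).2 <= (u n).1.1 + (u n).2.
  elim: m => [|m [IH1 IH2]]; first by rewrite addn0.
  by rewrite addnS /=; have [? ? _ _ _] := uS (n + m)%N; lra.
have ym n m : (u n).1.2 <= (u (n + m)%N).1.2 /\
    (u (n + m)%N).1.2 + (u (n + m)%N).2 <= (u n).1.2 + (u n).2.
  elim: m => [|m [IH1 IH2]]; first by rewrite addn0.
  by rewrite addnS /=; have [_ _ ? ? _] := uS (n + m)%N; lra.
(* For either coordinate the lower corners increase and stay below every upper corner, so their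
   supremum lies in all the squares. *)
have supP (v : nat -> R) :
    (forall n m, v n <= v (n + m)%N /\ v (n + m)%N + (u (n + m)%N).2 <= v n + (u n).2) ->
    forall n, v n <= sup (range v) <= v n + (u n).2.
  move=> vm n.
  have vb k : v k <= v n + (u n).2.
    have [h1 h2] := vm n k; have [h3 _] := vm k n.
    by have := ul0 (n + k)%N; rewrite addnC in h3; lra.
  apply/andP; split.
    apply: ub_le_sup; last by exists n.
    by exists (v n + (u n).2) => _ [k _ <-].
  by apply: ge_sup; [exists (v 0%N), 0%N|move=> _ [k _ <-]].
have Hx := supP (fun n => (u n).1.1) xm.
have Hy := supP (fun n => (u n).1.2) ym.
set x0 := sup _ in Hx; set y0 := sup _ in Hy.
have [dl dl0 Hdl] := Hloc x0 y0 (Hx 0%N) (Hy 0%N).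
have [n nL] : exists n, L / 2 ^+ n <= dl.
  exists (Num.truncn (L / dl)).+1.
  rewrite ler_pdivrMr ?exprn_gt0// mulrC -ler_pdivrMr//.
  apply: le_trans (ltW (truncnS_gt _)) _.
  by rewrite -natrX ler_nat ltnW// ltn_expl.
by apply: (uP n); apply: Hdl; rewrite ?ul0 ?ul//= -?ul.
Qed.

(** Edges are horizontal or vertical, so cutting and adding edge integrals uses continuity along
    such lines only, not joint continuity. *)
Definition sepcont (P Q : R -> R -> R) x y :=
  [/\ {for x, continuous (P^~ y)}, {for y, continuous (P x)},
      {for x, continuous (Q^~ y)} & {for y, continuous (Q x)}].

Lemma bdint_quarter (P Q : R -> R -> R) (a m b c n d : R) :
  a <= m <= b -> c <= n <= d ->
  (forall x y, x \in `[a, b] -> y \in `[c, d] -> sepcont P Q x y) ->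
  bdint P Q a b c d = (bdint P Q a m c n + bdint P Q a m n d)
    + (bdint P Q m b c n + bdint P Q m b n d).
Proof.
move=> /andP[am mb] /andP[cn nd] H.
have ab := le_trans am mb; have cd := le_trans cn nd.
have ai : a \in `[a, b] by rewrite in_itv/= lexx.
have bi : b \in `[a, b] by rewrite in_itv/= lexx andbT.
have mi : m \in `[a, b] by rewrite in_itv/= am.
have ci : c \in `[c, d] by rewrite in_itv/= lexx.
have di : d \in `[c, d] by rewrite in_itv/= lexx andbT.
have ni : n \in `[c, d] by rewrite in_itv/= cn.
have cP u v t : a <= u -> v <= b -> t \in `[c, d] -> {in `[u, v], continuous (P^~ t)}.
  move=> au vb ht z; rewrite in_itv/= => /andP[uz zv]; have [] // := H z t _ ht.
  by rewrite in_itv/= (le_trans au uz) (le_trans zv vb).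
have cQ u v t : c <= u -> v <= d -> t \in `[a, b] -> {in `[u, v], continuous (Q t)}.
  move=> au vb ht z; rewrite in_itv/= => /andP[uz zv]; have [] // := H t z ht _.
  by rewrite in_itv/= (le_trans au uz) (le_trans zv vb).
rewrite (bdint_splitx am mb); [|exact: cP|exact: cP|exact: cQ|exact: cQ|exact: cQ].
rewrite (@bdint_splity _ _ _ a m c n); [|by []|by []|exact: cP|exact: cP|exact: cP|exact: cQ|exact: cQ].
by rewrite (@bdint_splity _ _ _ m b c n); [|by []|by []|exact: cP|exact: cP|exact: cP|exact: cQ|exact: cQ].
Qed.

(** The affine parts of [P] and [Q] contribute [- v * B * A] and [v * A * B]; they cancel because
    closedness makes both mixed coefficients the same [v]. What remains is the error, at most [eta]
    on each side. *)
Lemma closed_at_bdint (P Q : R -> R -> R) x0 y0 e : 0 < e -> closed_at P Q x0 y0 ->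
  exists2 dl, 0 < dl & forall a b c d, a <= x0 <= b -> c <= y0 <= d ->
    b - a <= dl -> d - c <= dl ->
    (forall x y, x \in `[a, b] -> y \in `[c, d] -> sepcont P Q x y) ->
    `|bdint P Q a b c d| <= e * (b - a + (d - c)) ^+ 2.
Proof.
move=> e0 [u [v [w Huvw]]].
have [dl dl0 Hd] := Huvw (e / 2) ltac:(by rewrite divr_gt0).
exists dl => // a b c d /andP[ax xb] /andP[cy yd] abl cdl H.
set A := b - a; set B := d - c.
have ab := le_trans ax xb; have cd := le_trans cy yd.
have A0 : 0 <= A by rewrite subr_ge0.
have B0 : 0 <= B by rewrite subr_ge0.
pose eta := e / 2 * (A + B).
have near z t : z \in `[a, b] -> t \in `[c, d] ->
    `|P z t - P x0 y0 - u * (z - x0) - v * (t - y0)| <= eta /\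
    `|Q z t - Q x0 y0 - v * (z - x0) - w * (t - y0)| <= eta.
  rewrite !in_itv/= => /andP[az zb] /andP[ct td].
  have bz : `|z - x0| <= A by rewrite ler_norml /A; clear -az zb ax xb; lra.
  have bt : `|t - y0| <= B by rewrite ler_norml /B; clear -ct td cy yd; lra.
  have := Hd (z - x0) (t - y0); rewrite !subrKC => K.
  have [H1 H2] := K (le_trans bz abl) (le_trans bt cdl).
  have hh : e / 2 * (`|z - x0| + `|t - y0|) <= eta.
    by rewrite ler_wpM2l ?lerD// divr_ge0// ltW.
  by split; [exact: le_trans H1 hh|exact: le_trans H2 hh].
have ai : a \in `[a, b] by rewrite in_itv/= lexx.
have bi : b \in `[a, b] by rewrite in_itv/= lexx andbT.
have ci : c \in `[c, d] by rewrite in_itv/= lexx.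
have di : d \in `[c, d] by rewrite in_itv/= lexx andbT.
have X1 : `|segint (fun z => P z c - P z d) a b - - v * B * A| <= 2 * eta * A.
  apply: segint_near_cst => // z hz.
    apply: cvgB; first by have [] := H z c hz ci.
    by have [] := H z d hz di.
  have [] := near z _ hz ci; have [] := near z _ hz di.
  rewrite /B !ler_norml; clear => /andP[? ?] _ /andP[? ?] _; lra.
have X2 : `|segint (fun z => Q b z - Q a z) c d - v * A * B| <= 2 * eta * B.
  apply: segint_near_cst => // z hz.
    apply: cvgB; first by have [] := H b z bi hz.
    by have [] := H a z ai hz.
  have [_] := near _ z ai hz; have [_] := near _ z bi hz.
  rewrite /A !ler_norml; clear => /andP[? ?] /andP[? ?]; lra.
rewrite /bdint; move: X1 X2; set I1 := segint _ _ _; set I2 := segint _ _ _ => X1 X2.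
rewrite (_ : I1 + I2 = (I1 - - v * B * A) + (I2 - v * A * B)); last by ring.
apply: (le_trans (ler_normD _ _)); apply: (le_trans (lerD X1 X2)).
by apply: le_of_eq; rewrite /eta; field.
Qed.

(** The unit square parametrises the rectangle affinely so that [square_bisection] applies. The
    bound [e * l ^+ 2] is additive over four quarters and holds on small squares by
    [closed_at_bdint]. *)
Lemma goursat (P Q : R -> R -> R) (a b c d : R) : a <= b -> c <= d ->
  (forall x y, x \in `[a, b] -> y \in `[c, d] -> closed_at P Q x y) ->
  bdint P Q a b c d = 0.
Proof.
move=> ab cd cl; pose A := b - a; pose B := d - c.
have A0 : 0 <= A by rewrite subr_ge0.
have B0 : 0 <= B by rewrite subr_ge0.
pose px x := a + A * x; pose py y := c + B * y.
have contP x y : x \in `[a, b] -> y \in `[c, d] -> sepcont P Q x y.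
  by move=> hx hy; exact: closed_at_continuous (cl _ _ hx hy).
suff H e : 0 < e -> `|bdint P Q a b c d| <= e.
  apply/eqP; rewrite -normr_eq0; apply/eqP/le_anti; rewrite normr_ge0 andbT.
  by apply/ler_addgt0Pl => e e0; rewrite addr0 H.
move=> e0.
(* The guard keeps the claim inside the unit square, since the bisection step ranges over all
   squares. *)
pose Pr x y l := [/\ 0 <= x, x + l <= 1, 0 <= y & y + l <= 1] ->
  `|bdint P Q (px x) (px (x + l)) (py y) (py (y + l))| <= e * l ^+ 2.
suff : Pr 0 0 1.
  rewrite /Pr add0r expr1n mulr1 /px /py !mulr0 !mulr1 !addr0 /A /B.
  by rewrite !subrKC; apply.
have pxm x y : x <= y -> px x <= px y.
  by move=> xy; rewrite /px lerD2l ler_wpM2l.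
have pym x y : x <= y -> py x <= py y.
  by move=> xy; rewrite /py lerD2l ler_wpM2l.
have pxab x u v : 0 <= u -> v <= 1 -> x \in `[px u, px v] -> x \in `[a, b].
  move=> u0 v1; rewrite !in_itv/= => /andP[h1 h2]; apply/andP; split.
    by apply: le_trans h1; rewrite /px lerDl mulr_ge0.
  by apply: (le_trans h2); rewrite /px addrC -lerBrDr ler_piMr.
have pycd x u v : 0 <= u -> v <= 1 -> x \in `[py u, py v] -> x \in `[c, d].
  move=> u0 v1; rewrite !in_itv/= => /andP[h1 h2]; apply/andP; split.
    by apply: le_trans h1; rewrite /py lerDl mulr_ge0.
  by apply: (le_trans h2); rewrite /py addrC -lerBrDr ler_piMr.
apply: square_bisection => // [x y l l0 h1 h2 h3 h4 [x0 x1 y0 y1]|x0 y0].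
  have hl : l / 2 + l / 2 = l by field.
  have l20 : 0 <= l / 2 by rewrite divr_ge0// ltW.
  have l2l : l / 2 <= l by rewrite -{2}hl lerDl.
  have xl : x + l / 2 + l / 2 = x + l by rewrite -addrA hl.
  have yl : y + l / 2 + l / 2 = y + l by rewrite -addrA hl.
  have xl1 : x + l / 2 <= 1 by apply: le_trans x1; rewrite lerD2l.
  have yl1 : y + l / 2 <= 1 by apply: le_trans y1; rewrite lerD2l.
  have xl0 : 0 <= x + l / 2 by rewrite addr_ge0.
  have yl0 : 0 <= y + l / 2 by rewrite addr_ge0.
  rewrite (@bdint_quarter _ _ _ (px (x + l / 2)) _ _ (py (y + l / 2))); last first.
  - by move=> z t hz ht; apply: contP; [exact: pxab hz|exact: pycd ht].
  - by rewrite !pym ?lerDl// lerD2l.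
  - by rewrite !pxm ?lerDl// lerD2l.
  have {}h1 := h1 (And4 x0 xl1 y0 yl1).
  rewrite /Pr xl in h2; have {}h2 := h2 (And4 xl0 x1 y0 yl1).
  rewrite /Pr yl in h3; have {}h3 := h3 (And4 x0 xl1 yl0 y1).
  rewrite /Pr xl yl in h4; have {}h4 := h4 (And4 xl0 x1 yl0 y1).
  rewrite (_ : e * l ^+ 2 = (e * (l / 2) ^+ 2 + e * (l / 2) ^+ 2) +
    (e * (l / 2) ^+ 2 + e * (l / 2) ^+ 2)); last by rewrite !expr2; field.
  by apply: (le_trans (ler_normD _ _)); apply: lerD;
    apply: (le_trans (ler_normD _ _)); apply: lerD.
rewrite add0r => x01 y01.
have xab : px x0 \in `[a, b].
  by case/andP: x01 => ? ?; apply: (pxab _ x0 x0); rewrite ?in_itv/= ?lexx.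
have ycd : py y0 \in `[c, d].
  by case/andP: y01 => ? ?; apply: (pycd _ y0 y0); rewrite ?in_itv/= ?lexx.
(* The sum of the sides is [A * l + B * l], at most [K * l]; the 1 keeps [K] positive when the
   rectangle degenerates. *)
pose K := A + B + 1.
have K0 : 0 < K by rewrite ltr_wpDl// addr_ge0.
have eK : 0 < e / K ^+ 2 by rewrite divr_gt0// exprn_gt0.
have [dl dl0 Hd] := closed_at_bdint eK (cl _ _ xab ycd).
exists (dl / K); first by rewrite divr_gt0.
move=> x y l /andP[l0 ldl] /andP[xx0 x0l] /andP[yy0 y0l] [x0' x1 y0' y1].
have pxl : px (x + l) - px x = A * l by rewrite /px; ring.
have pyl : py (y + l) - py y = B * l by rewrite /py; ring.
have Kl : K * l <= dl by rewrite mulrC -ler_pdivlMr.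
have := Hd (px x) (px (x + l)) (py y) (py (y + l)).
rewrite !pxm// !pym// pxl pyl => {}Hd.
apply: le_trans (Hd isT isT _ _ _) _.
- by apply: le_trans Kl; rewrite ler_pM2r// /K -addrA lerDl addr_ge0.
- by apply: le_trans Kl; rewrite ler_pM2r// /K addrAC lerDr addr_ge0.
- by move=> z t hz ht; apply: contP; [exact: pxab hz|exact: pycd ht].
rewrite -mulrDl exprMn mulrA ler_pM2r ?exprn_gt0//.
rewrite mulrAC ler_pdivrMr ?exprn_gt0// ler_pM2l//.
by rewrite ler_pXn2r ?nnegrE ?(addr_ge0 A0 B0) ?(ltW K0)// /K lerDl.
Qed.

End goursat.

(** * Complex derivatives *)

Section cabs_theory.
Context {R : realType}.
Implicit Types (z w : C R) (x y : R).

Lemma norm_cabs z : `|z| = (cabs z)%:C.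
Proof. by rewrite /cabs; case: z => x y; rewrite normc_def. Qed.

Lemma cabs_ge0 z : 0 <= cabs z.
Proof. by rewrite /cabs; case: z => x y /=; exact: sqrtr_ge0. Qed.

Lemma cabs0 : cabs (0 : C R) = 0. Proof. exact: Normc.normc0. Qed.
Lemma cabs1 : cabs (1 : C R) = 1. Proof. exact: Normc.normc1. Qed.

Lemma cabsM z w : cabs (z * w) = cabs z * cabs w.
Proof. exact: Normc.normcM. Qed.

Lemma cabsV z : cabs z^-1 = (cabs z)^-1.
Proof. exact: Normc.normcV. Qed.

Lemma cabsX z n : cabs (z ^+ n) = cabs z ^+ n.
Proof. by elim: n => [|n IH]; rewrite ?expr0 ?cabs1// !exprS cabsM IH. Qed.

Lemma cabsN z : cabs (- z) = cabs z.
Proof. exact: normcN. Qed.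

Lemma cabsD z w : cabs (z + w) <= cabs z + cabs w.
Proof. exact: le_normcD. Qed.

Lemma cabsB z w : cabs (z - w) <= cabs z + cabs w.
Proof. by rewrite -(cabsN w); exact: cabsD. Qed.

Lemma cabsC z w : cabs (z - w) = cabs (w - z).
Proof. by rewrite -cabsN opprB. Qed.

Lemma cabs_tri z w : cabs z <= cabs w + cabs (z - w).
Proof. by rewrite -{1}(subrKC w z) cabsD. Qed.

Lemma cabs_eq0 z : (cabs z == 0) = (z == 0).
Proof. by apply/eqP/eqP => [/Normc.eq0_normc//|->]; exact: cabs0. Qed.

Lemma cabs_gt0 z : (0 < cabs z) = (z != 0).
Proof. by rewrite lt_neqAle cabs_ge0 andbT eq_sym cabs_eq0. Qed.

Lemma cabs_real x : cabs (x%:C : C R) = `|x|.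
Proof. by rewrite /cabs /= expr0n/= addr0 sqrtr_sqr. Qed.

Lemma cabs_sqr x y : cabs (x +i* y : C R) ^+ 2 = x ^+ 2 + y ^+ 2.
Proof. by rewrite /cabs /= sqr_sqrtr// addr_ge0// sqr_ge0. Qed.

Lemma cabs_le z r : 0 <= r -> complex.Re z ^+ 2 + complex.Im z ^+ 2 <= r ^+ 2 ->
  cabs z <= r.
Proof.
case: z => x y /= r0 h.
by rewrite -(ler_pXn2r (_ : 0 < 2)%N)// ?nnegrE// ?cabs_ge0// cabs_sqr.
Qed.

Lemma Re_le_cabs z : `|complex.Re z| <= cabs z.
Proof.
case: z => x y /=; rewrite -(ler_pXn2r (_ : 0 < 2)%N)// ?nnegrE// ?cabs_ge0//.
by rewrite cabs_sqr real_normK ?num_real// lerDl sqr_ge0.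
Qed.

Lemma Im_le_cabs z : `|complex.Im z| <= cabs z.
Proof.
case: z => x y /=; rewrite -(ler_pXn2r (_ : 0 < 2)%N)// ?nnegrE// ?cabs_ge0//.
by rewrite cabs_sqr real_normK ?num_real// lerDr sqr_ge0.
Qed.

Lemma cabs_le_ReIm z : cabs z <= `|complex.Re z| + `|complex.Im z|.
Proof.
apply: cabs_le; first by rewrite addr_ge0.
rewrite sqrrD !real_normK ?num_real// lerD2r lerDl mulrn_wge0//.
Qed.

Lemma cReD z w : complex.Re (z + w) = complex.Re z + complex.Re w.
Proof. by case: z w => [? ?] []. Qed.
Lemma cImD z w : complex.Im (z + w) = complex.Im z + complex.Im w.
Proof. by case: z w => [? ?] []. Qed.
Lemma cReB z w : complex.Re (z - w) = complex.Re z - complex.Re w.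
Proof. by case: z w => [? ?] []. Qed.
Lemma cImB z w : complex.Im (z - w) = complex.Im z - complex.Im w.
Proof. by case: z w => [? ?] []. Qed.
Lemma cReM z w : complex.Re (z * w) =
  complex.Re z * complex.Re w - complex.Im z * complex.Im w.
Proof. by case: z w => [? ?] []. Qed.
Lemma cImM z w : complex.Im (z * w) =
  complex.Re z * complex.Im w + complex.Im z * complex.Re w.
Proof. by case: z w => [? ?] []. Qed.

Lemma CD (a b c d : R) : (a +i* b) + (c +i* d) = (a + c) +i* (b + d) :> C R.
Proof. by []. Qed.

End cabs_theory.

Section complex_derivative.
Context {R : realType}.
Implicit Types (f g : C R -> C R) (z d : C R).

(** Epsilons are real, the derivative is an argument and h = 0 is allowed, so the rules of calculus
    become inequalities between moduli. *)
Definition cdiff f z d : Prop := forall e : R, 0 < e -> exists2 dl : R, 0 < dl &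
  forall h : C R, cabs h <= dl -> cabs (f (z + h) - f z - d * h) <= e * cabs h.

Lemma derivable_cdiff f z : derivable f z 1 -> cdiff f z (derive1 f z).
Proof.
move=> df e e0; rewrite derive1E.
have : (fun h : C R => h^-1 *: (f (h *: 1 + z) - f z)) @ 0^' --> 'D_1 f z by [].
move=> /cvgrPdist_le /(_ (e%:C)); rewrite ltcR => /(_ e0).
case=> /= r r0 H; move: r0 H; case: r => r r'; rewrite ltcE /= => /andP[/eqP->] r0 H.
exists (r / 2); first by rewrite divr_gt0.
move=> h hr; have [->|h0] := eqVneq h 0.
  by rewrite addr0 subrr mulr0 subr0 cabs0 mulr0.
have /= := H h; rewrite sub0r normrN norm_cabs ltcR => /(_ _ h0).
rewrite norm_cabs lecR => K; have {}K := K ltac:(lra).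
rewrite -ler_pdivrMr ?cabs_gt0// -cabsV -cabsM -cabsN.
apply: le_trans K; apply: le_of_eq; congr cabs.
rewrite -[_ *: 1]/(h * 1) -[_^-1 *: _]/(h^-1 * _) mulr1 (addrC h).
by field.
Qed.

Lemma cdiff_derivable f z d : cdiff f z d -> derivable f z 1 /\ derive1 f z = d.
Proof.
move=> fd; have H : (fun h : C R => h^-1 *: (f (h *: 1 + z) - f z)) @ 0^' --> d.
  apply/cvgrPdist_le => e; case: e => e e'; rewrite ltcE /= => /andP[/eqP->] e0.
  have [dl dl0 K] := fd e e0.
  exists (dl%:C) => /=; first by rewrite ltcR.
  move=> h /=; rewrite sub0r normrN norm_cabs ltcR => hd h0.
  rewrite norm_cabs lecR; have := K h (ltW hd).
  rewrite -ler_pdivrMr ?cabs_gt0// -cabsV -cabsM -cabsN.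
  apply: le_trans; apply: le_of_eq; congr cabs.
  rewrite -[_ *: 1]/(h * 1) -[_^-1 *: _]/(h^-1 * _) mulr1 (addrC h).
  by field.
split; first by apply/cvg_ex; exists d.
by rewrite derive1E; apply/cvg_lim.
Qed.

Lemma cdiff_cst (k z : C R) : cdiff (fun=> k) z 0.
Proof.
move=> e e0; exists 1 => // h _; rewrite subrr mul0r subr0 cabs0.
by rewrite mulr_ge0 ?cabs_ge0// ltW.
Qed.

Lemma cdiff_id z : cdiff id z 1.
Proof.
move=> e e0; exists 1 => // h _.
rewrite mul1r (_ : _ - _ = 0); last by rewrite /= (addrC z) addrK subrr.
by rewrite cabs0 mulr_ge0 ?cabs_ge0// ltW.
Qed.

Lemma cdiffD f g z d d' : cdiff f z d -> cdiff g z d' ->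
  cdiff (fun x => f x + g x) z (d + d').
Proof.
move=> df dg e e0.
have [r r0 Hf] := df (e / 2) ltac:(by rewrite divr_gt0).
have [s s0 Hg] := dg (e / 2) ltac:(by rewrite divr_gt0).
exists (Num.min r s); first by rewrite lt_min r0.
move=> h; rewrite le_min => /andP[/Hf h1 /Hg h2].
rewrite (_ : _ - _ = (f (z + h) - f z - d * h) + (g (z + h) - g z - d' * h)); last by ring.
by apply: (le_trans (cabsD _ _)); lra.
Qed.

Lemma cdiff_cont f z d : cdiff f z d -> forall e : R, 0 < e ->
  exists2 dl : R, 0 < dl & forall h : C R, cabs h <= dl -> cabs (f (z + h) - f z) <= e.
Proof.
move=> df e e0; have [r r0 H] := df 1 ltr01.
pose K := cabs d + 1.
have K0 : 0 < K by rewrite ltr_wpDl ?cabs_ge0.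
exists (Num.min r (e / K)); first by rewrite lt_min r0 divr_gt0.
move=> h; rewrite le_min => /andP[/H h1 h2].
apply: (le_trans (cabs_tri _ (d * h))); rewrite cabsM.
apply: (@le_trans _ _ (K * cabs h)); first by rewrite /K; lra.
by rewrite mulrC -ler_pdivlMr.
Qed.

Lemma cdiffM f g z d d' : cdiff f z d -> cdiff g z d' ->
  cdiff (fun x => f x * g x) z (d * g z + f z * d').
Proof.
move=> df dg e e0.
pose K := 3 * (1 + cabs (f z) + cabs (g z) + cabs d).
have K0 : 0 < K.
  by rewrite /K; have := cabs_ge0 (f z); have := cabs_ge0 (g z); have := cabs_ge0 d; lra.
have eK : 0 < e / K by rewrite divr_gt0.
have [r r0 Hf] := df (e / K) eK.
have [s s0 Hg] := dg (e / K) eK.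
have [t t0 Ht] := cdiff_cont dg (eK).
have [u u0 Hu] := cdiff_cont dg ltr01.
exists (Num.min (Num.min r s) (Num.min t u)); first by rewrite !lt_min r0 s0 t0.
move=> h; rewrite !le_min => /andP[/andP[/Hf h1 /Hg h2] /andP[/Ht h3 /Hu h4]].
rewrite (_ : _ - _ = (f (z + h) - f z - d * h) * g z
  + (f (z + h) - f z - d * h) * (g (z + h) - g z)
  + f z * (g (z + h) - g z - d' * h) + d * h * (g (z + h) - g z)); last by ring.
apply: (le_trans (cabsD _ _)).
apply: le_trans (lerD (cabsD _ _) (lexx _)) _.
apply: le_trans (lerD (lerD (cabsD _ _) (lexx _)) (lexx _)) _.
rewrite !cabsM.
have c0 := cabs_ge0 h.
have E : e * cabs h = (e / K * cabs h) * K by field; rewrite gt_eqF.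
rewrite E; set q := e / K * cabs h.
have q0 : 0 <= q by rewrite mulr_ge0// ltW.
have a1 : cabs (f (z + h) - f z - d * h) * cabs (g z) <= q * cabs (g z).
  by rewrite ler_wpM2r ?cabs_ge0.
have a2 : cabs (f (z + h) - f z - d * h) * cabs (g (z + h) - g z) <= q * 1.
  by rewrite ler_pM ?cabs_ge0.
have a3 : cabs (f z) * cabs (g (z + h) - g z - d' * h) <= cabs (f z) * q.
  by rewrite ler_wpM2l ?cabs_ge0.
have a4 : cabs d * cabs h * cabs (g (z + h) - g z) <= cabs d * q.
  by rewrite -mulrA ler_wpM2l ?cabs_ge0// /q (mulrC _ (cabs h)) ler_wpM2l.
apply: (@le_trans _ _ (q * cabs (g z) + q * 1 + cabs (f z) * q + cabs d * q)).
  by rewrite !lerD.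
rewrite /K; have : 0 <= cabs (f z) * q by rewrite mulr_ge0 ?cabs_ge0.
have : 0 <= cabs (g z) * q by rewrite mulr_ge0 ?cabs_ge0.
have : 0 <= cabs d * q by rewrite mulr_ge0 ?cabs_ge0.
lra.
Qed.

Lemma cdiffV f z d : f z != 0 -> cdiff f z d ->
  cdiff (fun x => (f x)^-1) z (- d / f z ^+ 2).
Proof.
move=> fz0 df e e0; set m := cabs (f z).
have m0 : 0 < m by rewrite cabs_gt0.
have [u u0 Hu] := cdiff_cont df (ltac:(by rewrite divr_gt0) : 0 < m / 2).
have c1 : 0 < e * m ^+ 2 / 4 by rewrite divr_gt0// mulr_gt0// exprn_gt0.
have [r r0 Hr] := df _ c1.
have c2 : 0 < e * m ^+ 3 / (4 * (1 + cabs d)).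
  by rewrite divr_gt0 ?mulr_gt0 ?exprn_gt0// ltr_pwDl ?cabs_ge0.
have [t t0 Ht] := cdiff_cont df c2.
exists (Num.min u (Num.min r t)); first by rewrite !lt_min u0 r0 t0.
move=> h; rewrite !le_min => /and3P[/Hu h1 /Hr h2 /Ht h3].
have m2 : m / 2 <= cabs (f (z + h)).
  have := cabs_tri (f z) (f (z + h)); rewrite -/m cabsC => ?.
  by rewrite cabsC in h1; rewrite cabsC in h1; lra.
have fzh : f (z + h) != 0 by rewrite -cabs_gt0; apply: lt_le_trans m2; rewrite divr_gt0.
rewrite (_ : _ - _ = (- (f (z + h) - f z - d * h) * f z + d * h * (f (z + h) - f z))
  / (f (z + h) * f z ^+ 2)); last by field; rewrite fz0.
rewrite cabsM cabsV ler_pdivrMr; last by rewrite cabs_gt0 mulf_neq0// expf_neq0.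
apply: (le_trans (cabsD _ _)); rewrite [cabs (f (z + h) * _)]cabsM cabsX !cabsM cabsN -/m.
have c0 := cabs_ge0 h.
have a1 : cabs (f (z + h) - f z - d * h) * m <= (e * m ^+ 2 / 4 * cabs h) * m.
  by rewrite ler_wpM2r// ltW.
have a2 : cabs d * cabs h * cabs (f (z + h) - f z) <= e * m ^+ 3 / 4 * cabs h.
  apply: (@le_trans _ _ (cabs d * cabs h * (e * m ^+ 3 / (4 * (1 + cabs d))))).
    by rewrite ler_wpM2l ?mulr_ge0 ?cabs_ge0.
  rewrite (_ : _ * _ = e * m ^+ 3 / 4 * cabs h * (cabs d / (1 + cabs d))); last first.
    by field; rewrite gt_eqF// ltr_pwDl ?cabs_ge0.
  rewrite ler_piMr//; last first.
    by rewrite ler_pdivrMr ?mul1r ?lerDr// ltr_pwDl ?cabs_ge0.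
  by rewrite mulr_ge0// divr_ge0// mulr_ge0 ?exprn_ge0// ltW.
apply: (le_trans (lerD a1 a2)).
apply: (@le_trans _ _ (e * cabs h * (m / 2 * m ^+ 2))); last first.
  apply: ler_wpM2l; first by rewrite mulr_ge0 ?cabs_ge0// ltW.
  by apply: ler_wpM2r => //; rewrite exprn_ge0// ltW.
by apply: le_of_eq; field.
Qed.

Lemma cdiffX f z d n : cdiff f z d ->
  cdiff (fun x => f x ^+ n.+1) z (n.+1%:R * f z ^+ n * d).
Proof.
move=> df; elim: n => [|n IH].
  by rewrite expr0 mulr1 mul1r; under [X in cdiff X]funext do rewrite expr1.
under [X in cdiff X]funext do rewrite exprS.
have := cdiffM df IH.
rewrite (_ : d * _ + _ = n.+2%:R * f z ^+ n.+1 * d)//.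
by rewrite [in RHS]exprS -[n.+2]addn1 natrD exprS; ring.
Qed.

Lemma cdiff_shift f (k z d : C R) : cdiff f (k + z) d -> cdiff (fun x => f (k + x)) z d.
Proof.
by move=> df e /df[r r0 H]; exists r => // h /H; rewrite addrA.
Qed.

End complex_derivative.

(** * Complex continuity and restrictions to lines *)

Section complex_continuity.
Context {R : realType}.
Implicit Types (f g : C R -> C R) (z w d : C R).

Definition ccont f z : Prop := forall e : R, 0 < e -> exists2 dl : R, 0 < dl &
  forall h : C R, cabs h <= dl -> cabs (f (z + h) - f z) <= e.

Lemma ccontP f z : ccont f z <-> {for z, continuous f}.
Proof.
split=> [H|H0 e e0].
  apply/(@cvgrPdist_le (C R) (C R) (C R) (nbhs z) _ f (f z)) => e; case: e => e e'; rewrite ltcE /= => /andP[/eqP-> e0].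
  have [dl dl0 K] := H e e0.
  apply/nbhs_normP; exists (dl%:C) => /=; first by rewrite ltcR.
  move=> h hd; have {}hd : cabs (z - h) < dl by rewrite -ltcR -norm_cabs.
  rewrite norm_cabs lecR cabsC; have := K (h - z); rewrite subrKC; apply.
  by rewrite cabsC ltW.
move: H0 => /(@cvgrPdist_le (C R) (C R) (C R) (nbhs z) _ f (f z)) H.
have := H (e%:C); rewrite ltcR => /(_ e0).
move=> /nbhs_normP[/= r r0 K]; move: r0 K; case: r => r r'; rewrite ltcE /= => /andP[/eqP-> r0] K.
exists (r / 2); first by rewrite divr_gt0.
move=> h hr; have /= := K (z + h).
rewrite (norm_cabs (f z - f _)) lecR cabsC; apply.
rewrite -[ltLHS]/(`|z - (z + h)|) norm_cabs ltcR cabsC (_ : z + h - z = h); last by ring.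
by lra.
Qed.

Lemma cdiff_ccont f z d : cdiff f z d -> ccont f z.
Proof. exact: cdiff_cont. Qed.

Lemma ccont_cst (k : C R) z : ccont (fun=> k) z.
Proof. exact: cdiff_ccont (cdiff_cst _ _). Qed.

Lemma ccont_id z : ccont id z.
Proof. exact: cdiff_ccont (cdiff_id _). Qed.

Lemma ccontD f g z : ccont f z -> ccont g z -> ccont (fun x => f x + g x) z.
Proof. by move=> /ccontP cf /ccontP cg; apply/ccontP; exact: (continuousD cf cg). Qed.

Lemma ccontB f g z : ccont f z -> ccont g z -> ccont (fun x => f x - g x) z.
Proof.
move=> cf cg; apply: ccontD => // e /cg[r r0 H]; exists r => // h /H.
by rewrite -opprD cabsN.
Qed.

Lemma ccontM f g z : ccont f z -> ccont g z -> ccont (fun x => f x * g x) z.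
Proof. by move=> /ccontP cf /ccontP cg; apply/ccontP; exact: (continuousM cf cg). Qed.

Lemma ccontV f z : f z != 0 -> ccont f z -> ccont (fun x => (f x)^-1) z.
Proof. by move=> f0 /ccontP cf; apply/ccontP; exact: (continuousV f0 cf). Qed.

Lemma ccont_shift f (k z : C R) : ccont f (k + z) -> ccont (fun x => f (k + x)) z.
Proof. by move=> cf e /cf[r r0 H]; exists r => // h /H; rewrite addrA. Qed.

(** What [Re], [Im] and [cabs] have in common; continuity of the real functions built from a complex
    one is proved once for all three. *)
Definition lip1 (phi : C R -> R) := forall z w, `|phi z - phi w| <= cabs (z - w).

Lemma lip1_Re : lip1 (@complex.Re R).
Proof. by move=> z w; rewrite -cReB; exact: Re_le_cabs. Qed.

Lemma lip1_Im : lip1 (@complex.Im R).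
Proof. by move=> z w; rewrite -cImB; exact: Im_le_cabs. Qed.

Lemma lip1_cabs : lip1 (@cabs R).
Proof.
move=> z w; rewrite ler_norml; have := cabs_tri w z; have := cabs_tri z w.
by rewrite (cabsC w z); lra.
Qed.

Lemma ccont_line (phi : C R -> R) f (a v : C R) (t : R) : lip1 phi ->
  ccont f (a + t%:C * v) -> {for t, continuous (fun t : R => phi (f (a + t%:C * v)))}.
Proof.
move=> phi1 cf; apply/cvgrPdist_le => e e0.
have [dl dl0 H] := cf e e0.
have K0 : 0 < 1 + cabs v by rewrite ltr_pwDl ?cabs_ge0.
near=> u; apply: (le_trans (phi1 _ _)); rewrite cabsC.
have := H ((u - t)%:C * v); rewrite (_ : a + _ + _ = a + u%:C * v); last first.
  by rewrite rmorphB /=; ring.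
apply; rewrite cabsM cabs_real.
apply: (@le_trans _ _ (dl / (1 + cabs v) * (1 + cabs v))); last by rewrite divfK ?gt_eqF.
apply: ler_pM => //; [exact: cabs_ge0| |by rewrite lerDr].
by rewrite distrC; near: u; apply: cvgr_dist_le => //; rewrite divr_gt0.
Unshelve. all: by end_near. Qed.

Lemma xline (x y : R) : x +i* y = (0 +i* y) + x%:C * 1 :> C R.
Proof. by rewrite mulr1 CD add0r addr0. Qed.

Lemma yline (x y : R) : x +i* y = (x +i* 0) + y%:C * (0 +i* 1) :> C R.
Proof.
apply/eqP; rewrite eq_complex /=; apply/andP; split; apply/eqP; ring.
Qed.

Lemma ccont_x (phi : C R -> R) f (x y : R) : lip1 phi -> ccont f (x +i* y) ->
  {for x, continuous (fun x : R => phi (f (x +i* y)))}.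
Proof.
move=> phi1; rewrite xline => /(ccont_line phi1).
by under [X in {for _, continuous X}]funext do rewrite -xline.
Qed.

Lemma ccont_y (phi : C R -> R) f (x y : R) : lip1 phi -> ccont f (x +i* y) ->
  {for y, continuous (fun y : R => phi (f (x +i* y)))}.
Proof.
move=> phi1; rewrite yline => /(ccont_line phi1).
by under [X in {for _, continuous X}]funext do rewrite -yline.
Qed.

(** Heine's theorem by bisection. The shifted point may leave the square, which [derivative_ccont]
    relies on. *)
Lemma ccont_unif f (X Y L : R) : 0 < L ->
  (forall x y : R, X <= x <= X + L -> Y <= y <= Y + L -> ccont f (x +i* y)) ->
  forall e, 0 < e -> exists2 dl : R, 0 < dl & forall x y : R,
    X <= x <= X + L -> Y <= y <= Y + L ->
    forall h, cabs h <= dl -> cabs (f (x +i* y + h) - f (x +i* y)) <= e.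
Proof.
move=> L0 cf e e0.
apply: (@square_bisection _ (fun X Y L => exists2 dl : R, 0 < dl & forall x y : R,
    X <= x <= X + L -> Y <= y <= Y + L ->
    forall h, cabs h <= dl -> cabs (f (x +i* y + h) - f (x +i* y)) <= e)) => //.
  move=> x y l l0 [r1 r10 H1] [r2 r20 H2] [r3 r30 H3] [r4 r40 H4].
  exists (Num.min (Num.min r1 r2) (Num.min r3 r4)).
    by rewrite !lt_min r10 r20 r30.
  move=> u v /andP[xu ux] /andP[yv vy] h.
  rewrite !le_min => /andP[/andP[h1 h2] /andP[h3 h4]].
  have [ux2|ux2] := leP u (x + l / 2); have [vy2|vy2] := leP v (y + l / 2).
  - by apply: H1 => //; apply/andP; split.
  - by apply: H3 => //; apply/andP; split=> //; lra.
  - by apply: H2 => //; apply/andP; split=> //; lra.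
  - by apply: H4 => //; apply/andP; split=> //; lra.
move=> x0 y0 hx hy.
have [dl dl0 H] := cf _ _ hx hy (e / 2) ltac:(by rewrite divr_gt0).
(* With side at most dl/4 every point of the small square is within dl/2 of the limit point, which
   leaves dl/2 for [h]. *)
exists (dl / 4); first by rewrite divr_gt0.
move=> x y l /andP[l0 ldl] /andP[xx0 x0x] /andP[yy0 y0y].
exists (dl / 2); first by rewrite divr_gt0.
move=> u v /andP[xu ux] /andP[yv vy] h hdl.
pose k : C R := (u - x0) +i* (v - y0).
have kdl : cabs k <= dl / 2.
  apply: (le_trans (cabs_le_ReIm _)) => /=.
  have : `|u - x0| <= dl / 4 by rewrite ler_norml; lra.
  have : `|v - y0| <= dl / 4 by rewrite ler_norml; lra.
  lra.
have -> : u +i* v = x0 +i* y0 + k :> C R by rewrite CD !subrKC.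
have h1 := H k ltac:(lra).
have h2 : cabs (k + h) <= dl by apply: (le_trans (cabsD _ _)); lra.
have {h2} := H _ h2; rewrite addrA => h2.
apply: (le_trans (cabs_tri _ (f (x0 +i* y0 + k + h) - f (x0 +i* y0)))).
rewrite (_ : f (x0 +i* y0 + k + h) - f (x0 +i* y0 + k) - _ =
  - (f (x0 +i* y0 + k) - f (x0 +i* y0))); last by ring.
by rewrite cabsN; lra.
Qed.

End complex_continuity.

Section complex_lines.
Context {R : realType}.
Implicit Types (f g : C R -> C R) (z w d : C R).

Lemma is_derive_eps (g : R -> R) (x d : R) :
  (forall e, 0 < e -> exists2 dl, 0 < dl &
    forall k, `|k| <= dl -> `|g (x + k) - g x - d * k| <= e * `|k|) ->
  is_derive x 1 g d.
Proof.
move=> H; have K : (fun h : R => h^-1 *: (g (h *: 1 + x) - g x)) @ 0^' --> d.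
  apply/cvgrPdist_le => e e0; have [dl dl0 K] := H e e0.
  exists dl => //= h /=; rewrite sub0r normrN => hd h0.
  have := K h (ltW hd).
  rewrite -ler_pdivrMr ?normr_gt0// -normfV -normrM -normrN.
  apply: le_trans; apply: le_of_eq; congr (`|_|).
  rewrite -[_ *: 1]/(h * 1) -[_^-1 *: _]/(h^-1 * _) mulr1 (addrC h).
  by field.
by split; [apply/cvg_ex; exists d|exact/cvg_lim].
Qed.

Lemma is_derive_line (phi : C R -> R) f a v (t : R) d : lip1 phi ->
  (forall z w, phi (z + w) = phi z + phi w) ->
  (forall (k : R) z, phi (k%:C * z) = k * phi z) ->
  cdiff f (a + t%:C * v) d ->
  is_derive t 1 (fun t : R => phi (f (a + t%:C * v))) (phi (d * v)).
Proof.
move=> phi1 phiD phiZ fd; apply: is_derive_eps => e e0.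
have K0 : 0 < 1 + cabs v by rewrite ltr_pwDl ?cabs_ge0.
have [dl dl0 H] := fd (e / (1 + cabs v)) (divr_gt0 e0 K0).
exists (dl / (1 + cabs v)); first by rewrite divr_gt0.
move=> k kd; have := H (k%:C * v).
have -> : a + t%:C * v + k%:C * v = a + (t + k)%:C * v by rewrite rmorphD /=; ring.
rewrite cabsM cabs_real => {}H.
have phiN z : phi (- z) = - phi z.
  by have := phiZ (-1) z; rewrite rmorphN rmorph1 !mulN1r.
have phi0 : phi 0 = 0 by have := phiZ 0 0; rewrite mulr0 mul0r.
have vk : `|k| * cabs v <= `|k| * (1 + cabs v) by rewrite ler_wpM2l// lerDr.
have {}H := H ltac:(apply: (le_trans vk); by rewrite -ler_pdivlMr).
have -> : phi (f (a + (t + k)%:C * v)) - phi (f (a + t%:C * v)) - phi (d * v) * k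
   = phi (f (a + (t + k)%:C * v) - f (a + t%:C * v) - d * (k%:C * v)) - phi 0.
  by rewrite phi0 subr0 !phiD !phiN mulrCA phiZ (mulrC k).
apply: (le_trans (phi1 _ _)); rewrite subr0; apply: (le_trans H).
by rewrite mulrAC ler_pdivrMr// -mulrA ler_wpM2l// ltW.
Qed.

Lemma is_derive_Re_line f a v (t : R) d : cdiff f (a + t%:C * v) d ->
  is_derive t 1 (fun t : R => complex.Re (f (a + t%:C * v))) (complex.Re (d * v)).
Proof.
apply: is_derive_line; [exact: lip1_Re|exact: cReD|].
by move=> k z; rewrite cReM /= mul0r subr0.
Qed.

Lemma is_derive_Im_line f a v (t : R) d : cdiff f (a + t%:C * v) d ->
  is_derive t 1 (fun t : R => complex.Im (f (a + t%:C * v))) (complex.Im (d * v)).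
Proof.
apply: is_derive_line; [exact: lip1_Im|exact: cImD|].
by move=> k z; rewrite cImM /= mul0r addr0.
Qed.

Lemma segint_derive (g g' : R -> R) (a b : R) : a <= b ->
  {in `[a, b], continuous g'} -> {in `[a, b], forall x : R, is_derive x 1 g (g' x)} ->
  segint g' a b = g b - g a.
Proof.
rewrite le_eqVlt => /predU1P[<- _ _|ab cg' dg].
  by rewrite /segint set_itv1 Rintegral_set1 subrr.
rewrite /segint /Rintegral (@continuous_FTC2 _ _ g)//.
- by apply: continuous_in_subspaceT => x /set_mem xab; exact: cg'.
- have cg : {in `[a, b], continuous g}.
    move=> x /dg dgx; apply/differentiable_continuous/derivable1_diffP.
    exact: ex_derive.
  split.
  + by move=> x xab; have /dg dgx := subset_itv_oo_cc xab; exact: ex_derive.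
  + by apply: cvg_at_right_filter; apply: cg; rewrite in_itv/= lexx ltW.
  + by apply: cvg_at_left_filter; apply: cg; rewrite in_itv/= lexx ltW.
- move=> x xab; have /dg dgx := subset_itv_oo_cc xab.
  by rewrite derive1E; exact: derive_val.
Qed.

End complex_lines.

(** * Cauchy's theorem on a punctured square and mean values *)

Section cauchy.
Context {R : realType}.
Implicit Types (f g G : C R -> C R) (z w d l : C R).

(** Since Im(G dz) = Im G dx + Re G dy, [bdint (imf G) (ref G)] is the imaginary part of the contour
    integral of [G], the part to which 1/w contributes. *)
Definition imf G (x y : R) : R := complex.Im (G (x +i* y)).
Definition ref G (x y : R) : R := complex.Re (G (x +i* y)).

(** The Cauchy-Riemann equations in disguise: the y-derivative of Im G and the x-derivative of Re G
    are both Re d. *)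
Lemma cdiff_closed_at G (x y : R) d : cdiff G (x +i* y) d ->
  closed_at (imf G) (ref G) x y.
Proof.
move=> dG; exists (complex.Im d), (complex.Re d), (- complex.Im d) => e e0.
have [dl dl0 H] := dG e e0; exists (dl / 2); first by rewrite divr_gt0.
move=> h k hd kd.
have hk := cabs_le_ReIm (h +i* k : C R); rewrite /= in hk.
have {}H := H (h +i* k) ltac:(by apply: (le_trans hk); lra).
have {}H : cabs (G (x +i* y + (h +i* k)) - G (x +i* y) - d * (h +i* k)) <=
  e * (`|h| + `|k|) by apply: (le_trans H); rewrite ler_pM2l.
rewrite CD in H; split.
  apply: le_trans H; apply: le_trans (Im_le_cabs _); rewrite !cImB cImM /=.
  by apply: le_of_eq; congr (`|_|); rewrite /imf; ring.
apply: le_trans H; apply: le_trans (Re_le_cabs _); rewrite !cReB cReM /=.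
by apply: le_of_eq; congr (`|_|); rewrite /ref; ring.
Qed.

(** A singularity that is o(1/r) at the origin is invisible: shrinking the square does not change
    the integral, and on a small square it is at most the perimeter times o(1/r). *)
Lemma goursat_punctured (P Q : R -> R -> R) (s : R) : 0 < s ->
  (forall x y, `|x| <= s -> `|y| <= s -> x != 0 \/ y != 0 -> closed_at P Q x y) ->
  (forall e, 0 < e -> exists2 dl, 0 < dl & forall x y, `|x| <= dl -> `|y| <= dl ->
    x != 0 \/ y != 0 -> (`|x| + `|y|) * (`|P x y| + `|Q x y|) <= e) ->
  bdint P Q (- s) s (- s) s = 0.
Proof.
move=> s0 cl small.
have ins (u v x : R) : `|u| <= s -> `|v| <= s -> x \in `[u, v] -> `|x| <= s.
  rewrite in_itv/= !ler_norml => /andP[? ?] /andP[? ?] /andP[? ?].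
  by apply/andP; split; lra.
have cP (u v y : R) : `|u| <= s -> `|v| <= s -> `|y| <= s -> y != 0 ->
    {in `[u, v], continuous (P^~ y)}.
  move=> us vs ys y0 x xuv.
  by have [] := closed_at_continuous (cl x y (ins _ _ _ us vs xuv) ys (or_intror y0)).
have cQ (u v x : R) : `|u| <= s -> `|v| <= s -> `|x| <= s -> x != 0 ->
    {in `[u, v], continuous (Q x)}.
  move=> us vs xs x0 y yuv.
  by have [] := closed_at_continuous (cl x y xs (ins _ _ _ us vs yuv) (or_introl x0)).
have ss : `|s| <= s by rewrite gtr0_norm.
have Nss : `|- s| <= s by rewrite normrN.
have sn0 : s != 0 by rewrite gt_eqF.
have Nsn0 : - s != 0 by rewrite oppr_eq0.
(* The frame between the two squares is cut into four rectangles missing the origin: two of full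
   height, and two above and below the inner square. *)
have shrink t : 0 < t -> t <= s ->
    bdint P Q (- s) s (- s) s = bdint P Q (- t) t (- t) t.
  move=> t0 ts.
  have tt : `|t| <= s by rewrite gtr0_norm.
  have Ntt : `|- t| <= s by rewrite normrN.
  have tn0 : t != 0 by rewrite gt_eqF.
  have Ntn0 : - t != 0 by rewrite oppr_eq0.
  have NtNs : - s <= - t by rewrite lerN2.
  have Nt_t : - t <= t by lra.
  have Nts : - t <= s by lra.
  rewrite (@bdint_splitx _ P Q _ (- t)); try (by []); try exact: cP; try exact: cQ.
  rewrite [X in _ + X](@bdint_splitx _ P Q _ t); try (by []); try exact: cP; try exact: cQ.
  rewrite [X in _ + (X + _)](@bdint_splity _ P Q _ _ _ (- t)); try (by []); try exact: cP; try exact: cQ.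
  rewrite [X in _ + (_ + X + _)](@bdint_splity _ P Q _ _ _ t); try (by []); try exact: cP; try exact: cQ.
  have Nss' : - s <= s by lra.
  rewrite (goursat (b := - t)) // ?(goursat (a := t)) // ?(goursat (d := - t)) //
    ?(goursat (c := t)) // ?addr0 ?add0r// => x y; rewrite !in_itv/= => /andP[h1 h2] /andP[h3 h4];
    (apply: cl; [by rewrite ler_norml; clear -h1 h2 h3 h4 s0 t0 ts; lra|
                 by rewrite ler_norml; clear -h1 h2 h3 h4 s0 t0 ts; lra|]);
    clear -h1 h2 h3 h4 s0 t0 ts.
  - by right; rewrite gt_eqF//; lra.
  - by right; rewrite lt_eqF//; lra.
  - by left; rewrite gt_eqF//; lra.
  - by left; rewrite lt_eqF//; lra.
apply/eqP; rewrite -normr_eq0; apply/eqP/le_anti; rewrite normr_ge0 andbT.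
apply/ler_addgt0Pl => e e0; rewrite addr0.
(* The coefficients are at most e/8/t on a square of half-side t, whose perimeter is 8 t. *)
have [dl dl0 H] := small (e / 8) ltac:(by rewrite divr_gt0).
pose t := Num.min s dl.
have t0 : 0 < t by rewrite lt_min s0.
have ts : t <= s by rewrite ge_min lexx.
have tdl : t <= dl by rewrite ge_min lexx orbT.
rewrite (shrink t)//.
have tt : `|t| <= s by rewrite gtr0_norm.
have Ntt : `|- t| <= s by rewrite normrN.
have tn0 : t != 0 by rewrite gt_eqF.
have Ntn0 : - t != 0 by rewrite oppr_eq0.
have bnd x y : `|x| <= t -> `|y| <= t -> `|x| = t \/ `|y| = t ->
    `|P x y| <= e / 8 / t /\ `|Q x y| <= e / 8 / t.
  move=> xt yt xy.
  have xy0 : x != 0 \/ y != 0.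
    by case: xy => h; [left|right]; rewrite -normr_gt0 h.
  have := H x y (le_trans xt tdl) (le_trans yt tdl) xy0.
  have t1 : t <= `|x| + `|y| by case: xy => <-; rewrite ?lerDl ?lerDr.
  move=> h; have {}h : t * (`|P x y| + `|Q x y|) <= e / 8.
    by apply: le_trans h; rewrite ler_wpM2r ?addr_ge0.
  rewrite !(ler_pdivlMr _ _ t0) !(mulrC _ t); split; apply: le_trans h.
    by rewrite ler_pM2l// lerDl.
  by rewrite ler_pM2l// lerDr.
have tin x : x \in `[- t, t] -> `|x| <= t by rewrite in_itv/= ler_norml.
have Nt_t : - t <= t by lra.
have X1 : `|segint (fun x => P x (- t) - P x t) (- t) t - 0 * (t - - t)|
    <= (2 * (e / 8 / t)) * (t - - t).
  apply: segint_near_cst => // x xt.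
    by apply: cvgB; apply: (cP (- t) t).
  rewrite subr0; apply: (le_trans (ler_normB _ _)); rewrite mulr_natl mulr2n lerD//.
    by apply: (bnd _ _ _ _ _).1; rewrite ?normrN ?(gtr0_norm t0) ?tin//; right.
  by apply: (bnd _ _ _ _ _).1; rewrite ?normrN ?(gtr0_norm t0) ?tin//; right.
have X2 : `|segint (fun y => Q t y - Q (- t) y) (- t) t - 0 * (t - - t)|
    <= (2 * (e / 8 / t)) * (t - - t).
  apply: segint_near_cst => // x xt.
    by apply: cvgB; apply: (cQ (- t) t).
  rewrite subr0; apply: (le_trans (ler_normB _ _)); rewrite mulr_natl mulr2n lerD//.
    by apply: (bnd _ _ _ _ _).2; rewrite ?normrN ?(gtr0_norm t0) ?tin//; left.
  by apply: (bnd _ _ _ _ _).2; rewrite ?normrN ?(gtr0_norm t0) ?tin//; left.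
rewrite mul0r subr0 in X1; rewrite mul0r subr0 in X2.
rewrite /bdint; apply: (le_trans (ler_normD _ _)); apply: (le_trans (lerD X1 X2)).
by apply: le_of_eq; field.
Qed.

Lemma cauchy_punctured G (s : R) : 0 < s ->
  (forall x y : R, `|x| <= s -> `|y| <= s -> x +i* y != 0 :> C R ->
     exists d, cdiff G (x +i* y) d) ->
  (forall e, 0 < e -> exists2 dl : R, 0 < dl & forall w, w != 0 -> cabs w <= dl ->
    cabs w * cabs (G w) <= e) ->
  bdint (imf G) (ref G) (- s) s (- s) s = 0.
Proof.
move=> s0 dG small.
have xy0 (x y : R) : x != 0 \/ y != 0 -> x +i* y != 0 :> C R.
  by case=> h; rewrite eq_complex /= negb_and h ?orbT.
apply: goursat_punctured => // [x y xs ys /xy0 h|e e0].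
  by have [d] := dG x y xs ys h; exact: cdiff_closed_at.
have [dl dl0 H] := small (e / 4) ltac:(by rewrite divr_gt0).
exists (dl / 2); first by rewrite divr_gt0.
move=> x y xd yd /xy0 h.
have hk := cabs_le_ReIm (x +i* y : C R); rewrite /= in hk.
have {}H := H _ h ltac:(by apply: (le_trans hk); lra).
have hx := Re_le_cabs (x +i* y : C R); have hy := Im_le_cabs (x +i* y : C R).
have hP := Im_le_cabs (G (x +i* y)); have hQ := Re_le_cabs (G (x +i* y)).
rewrite /imf /ref; move: hx hy hP hQ H; rewrite [complex.Re (_ +i* _)]/= [complex.Im (_ +i* _)]/=.
set c := cabs (_ +i* _); set k := cabs _ => hx hy hP hQ H.
apply: (@le_trans _ _ ((2 * c) * (2 * k))); last by lra.
by apply: ler_pM; rewrite ?addr_ge0//; lra.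
Qed.

End cauchy.

(** * Mean value inequality over the edges of a square *)

Section mean_value.
Context {R : realType}.
Implicit Types (f g G E D : C R -> C R) (z w d l xi : C R).

Definition cconj l : C R := conjc l.

Lemma cabs_conj l : cabs (cconj l) = cabs l.
Proof. by case: l => a b; rewrite /cabs /= sqrrN. Qed.

Lemma mul_conj l : cconj l * l = (cabs l ^+ 2)%:C.
Proof.
case: l => a b; rewrite cabs_sqr; apply/eqP; rewrite eq_complex /=.
by apply/andP; split; apply/eqP; ring.
Qed.

Lemma Re_inv (x y : R) : complex.Re ((x +i* y : C R)^-1) = x / (x ^+ 2 + y ^+ 2).
Proof. by []. Qed.

Lemma Im_inv (x y : R) : complex.Im ((x +i* y : C R)^-1) = - (y / (x ^+ 2 + y ^+ 2)).
Proof. by []. Qed.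

Lemma segintZ (k : R) (g : R -> R) a b : {in `[a, b], continuous g} ->
  segint (fun x => k * g x) a b = k * segint g a b.
Proof.
by move=> cg; rewrite /segint RintegralZl//; exact: continuous_integrable.
Qed.

Definition edge_sum (s : R) (g : C R -> R) : R :=
  segint (fun x => g (x +i* (- s)) + g (x +i* s)) (- s) s +
  segint (fun y => g (s +i* y) + g ((- s) +i* y)) (- s) s.

Definition ccont_edges (s : R) E := forall x : R, `|x| <= s ->
  [/\ ccont E (x +i* (- s)), ccont E (x +i* s), ccont E (s +i* x) &
      ccont E ((- s) +i* x)].

(** [G] is conj(l) E/w - |l|^2/w. On the edges |w| >= s, so the first term has modulus at most |l|
    |E|/s, while the second contributes at most -2 |l|^2 per pair of opposite sides. Hence 0 <=
    (|l|/s) [edge_sum] - 4 |l|^2, and one divides by |l|/s. *)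
Lemma edge_mean E l (s : R) : 0 < s -> ccont_edges s E ->
  let G := fun w => cconj l * (E w - l) * w^-1 in
  bdint (imf G) (ref G) (- s) s (- s) s = 0 ->
  4 * s * cabs l <= edge_sum s (fun w => cabs (E w)).
Proof.
move=> s0 cE G G0.
have cG : ccont_edges s G.
  have aux w : w != 0 -> ccont E w -> ccont G w.
    move=> w0 cw; apply: ccontM; last exact: ccontV (ccont_id w).
    by apply: ccontM; [exact: ccont_cst|apply: ccontB => //; exact: ccont_cst].
  have nz (x y : R) : x != 0 \/ y != 0 -> x +i* y != 0 :> C R.
    by case=> h; rewrite eq_complex /= negb_and h ?orbT.
  have s0' : s != 0 by rewrite gt_eqF.
  have Ns0' : - s != 0 by rewrite oppr_eq0.
  by move=> x /cE[? ? ? ?]; split; apply: aux => //; apply: nz; tauto.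
have sin x : x \in `[- s, s] -> `|x| <= s by rewrite in_itv/= ler_norml.
pose L := cabs l; have L0 : 0 <= L by exact: cabs_ge0.
(* Pointwise bound for the integrand of a pair of opposite sides, [a] and [b] being the values of
   |E| there. *)
pose kh (a b : R) := L / s * (a + b) - L ^+ 2 / s.
have big (phi : C R -> R) w : (forall z, `|phi z| <= cabs z) -> s <= cabs w ->
    `|phi (cconj l * E w * w^-1)| <= L / s * cabs (E w).
  move=> phi1 sw; apply: (le_trans (phi1 _)); rewrite !cabsM cabs_conj cabsV.
  rewrite -/L mulrAC ler_wpM2r ?cabs_ge0// ler_wpM2l// lef_pV2// posrE//.
  exact: lt_le_trans sw.
have GE w : G w = cconj l * E w * w^-1 - (L ^+ 2)%:C * w^-1.
  by rewrite /G -mul_conj; ring.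
have ImG w : complex.Im (G w) = complex.Im (cconj l * E w * w^-1) - L ^+ 2 * complex.Im w^-1.
  by rewrite GE cImB [in X in _ - X]cImM /= mul0r addr0.
have ReG w : complex.Re (G w) = complex.Re (cconj l * E w * w^-1) - L ^+ 2 * complex.Re w^-1.
  by rewrite GE cReB [in X in _ - X]cReM /= mul0r subr0.
have cabs_geR (x y : R) : `|x| = s \/ `|y| = s -> s <= cabs (x +i* y : C R).
  by case=> <-; [exact: (Re_le_cabs (x +i* y))|exact: (Im_le_cabs (x +i* y))].
have ss : `|s| = s by rewrite gtr0_norm.
have Nss : `|- s| = s by rewrite normrN.
(* x^2 + s^2 <= 2 s^2 on a side; the factor 2 in front counts the opposite sides, on which 1/w gives
   equal contributions. *)
have frac (x : R) : `|x| <= s -> L ^+ 2 / s <= 2 * (L ^+ 2 * (s / (x ^+ 2 + s ^+ 2))).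
  move=> xs; have x2 : x ^+ 2 <= s ^+ 2 by rewrite -(real_normK (num_real x)) ler_pXn2r ?nnegrE// ltW.
  have h : s^-1 <= 2 * (s / (x ^+ 2 + s ^+ 2)).
    have xs0 : 0 < x ^+ 2 + s ^+ 2 by rewrite ltr_wpDl ?sqr_ge0 ?exprn_gt0.
    rewrite mulrA ler_pdivlMr// mulrC ler_pdivrMr// -mulrA -expr2; lra.
  by apply: (le_trans (ler_wpM2l (sqr_ge0 L) h)); rewrite mulrCA.
have B1 : segint (fun x => imf G x (- s) - imf G x s) (- s) s <=
    segint (fun x => kh (cabs (E (x +i* (- s)))) (cabs (E (x +i* s)))) (- s) s.
  apply: le_segint => x /sin xs.
  - by have [c1 c2 _ _] := cG x xs; apply: cvgB; apply: ccont_x => //; exact: lip1_Im.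
  - have [c1 c2 _ _] := cE x xs; apply: cvgB; last exact: cvg_cst.
    apply: cvgM; first exact: cvg_cst.
    by apply: cvgD; apply: ccont_x => //; exact: lip1_cabs.
  rewrite /imf !ImG !Im_inv sqrrN /kh.
  have := big (@complex.Im R) (x +i* (- s)) (@Im_le_cabs R) (cabs_geR _ _ (or_intror Nss)).
  have := big (@complex.Im R) (x +i* s) (@Im_le_cabs R) (cabs_geR _ _ (or_intror ss)).
  rewrite !ler_norml => /andP[? ?] /andP[? ?].
  by have := frac x xs; rewrite mulNr opprK mulrDr; lra.
have B2 : segint (fun y => ref G s y - ref G (- s) y) (- s) s <=
    segint (fun y => kh (cabs (E (s +i* y))) (cabs (E ((- s) +i* y)))) (- s) s.
  apply: le_segint => x /sin xs.
  - by have [_ _ c1 c2] := cG x xs; apply: cvgB; apply: ccont_y => //; exact: lip1_Re.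
  - have [_ _ c1 c2] := cE x xs; apply: cvgB; last exact: cvg_cst.
    apply: cvgM; first exact: cvg_cst.
    by apply: cvgD; apply: ccont_y => //; exact: lip1_cabs.
  rewrite /ref !ReG !Re_inv sqrrN /kh.
  have := big (@complex.Re R) ((- s) +i* x) (@Re_le_cabs R) (cabs_geR _ _ (or_introl Nss)).
  have := big (@complex.Re R) (s +i* x) (@Re_le_cabs R) (cabs_geR _ _ (or_introl ss)).
  rewrite !ler_norml => /andP[? ?] /andP[? ?].
  by have := frac x xs; rewrite (addrC (s ^+ 2)) mulNr mulrDr; lra.
have khE (a b : R -> R) : {in `[- s, s], continuous a} -> {in `[- s, s], continuous b} ->
    segint (fun x => kh (a x) (b x)) (- s) s =
    L / s * segint (fun x => a x + b x) (- s) s - 2 * L ^+ 2.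
  move=> ca cb; have cab : {in `[- s, s], continuous (fun x => a x + b x)}.
    by move=> x xs; apply: cvgD; [exact: ca|exact: cb].
  rewrite /kh (@segintD _ (fun x => L / s * (a x + b x)) (fun=> - (L ^+ 2 / s))).
  - rewrite segintZ// segint_cst; last by lra.
    by congr (_ + _); field; rewrite gt_eqF.
  - by move=> x xs; apply: cvgM; [exact: cvg_cst|exact: cab].
  - by move=> x _; exact: cvg_cst.
rewrite khE in B1; last 2 first.
- by move=> x /sin /cE[c1 _ _ _]; apply: ccont_x => //; exact: lip1_cabs.
- by move=> x /sin /cE[_ c1 _ _]; apply: ccont_x => //; exact: lip1_cabs.
rewrite khE in B2; last 2 first.
- by move=> x /sin /cE[_ _ c1 _]; apply: ccont_y => //; exact: lip1_cabs.
- by move=> x /sin /cE[_ _ _ c1]; apply: ccont_y => //; exact: lip1_cabs.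
move: G0; rewrite /bdint => G0.
have B12 : 0 <= L / s * edge_sum s (fun w => cabs (E w)) - 4 * L ^+ 2.
  by rewrite -G0 /edge_sum mulrDr; lra.
have es0 : 0 <= edge_sum s (fun w => cabs (E w)).
  by rewrite addr_ge0// Rintegral_ge0// => x _; rewrite addr_ge0 ?cabs_ge0.
(* The case l = 0 is separate because the inequality is divided by [L / s]. *)
have [L00|Lpos] := eqVneq L 0; first by rewrite -/L L00 mulr0.
have {}Lpos : 0 < L by rewrite lt_neqAle eq_sym Lpos.
rewrite -/L -(ler_pM2l (ltac:(by rewrite divr_gt0) : 0 < L / s)).
rewrite (_ : L / s * (4 * s * L) = 4 * L ^+ 2); last by field; rewrite gt_eqF.
by lra.
Qed.

Definition insquare (s : R) w : Prop := `|complex.Re w| <= s /\ `|complex.Im w| <= s.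

(** Near the puncture |w| |G(w)| = |l| |f(xi + w) - f(xi)|, which tends to 0 by continuity, so
    [cauchy_punctured] applies with l = f(xi). *)
Lemma edge_mean_diff f xi (s : R) : 0 < s ->
  (forall w, insquare s w -> exists d, cdiff f (xi + w) d) ->
  4 * s * cabs (f xi) <= edge_sum s (fun w => cabs (f (xi + w))).
Proof.
move=> s0 df; have ss : `|s| <= s by rewrite gtr0_norm.
have Nss : `|- s| <= s by rewrite normrN.
apply: (edge_mean s0).
  by move=> x xs; split; apply: ccont_shift;
    match goal with |- ccont f (xi + ?w) => have [|d] := df w; [by split|exact: cdiff_ccont] end.
apply: cauchy_punctured => // [x y xs ys xy0|e e0].
  have [|d dd] := df (x +i* y); first by split.
  eexists; apply: cdiffM; last exact: cdiffV (cdiff_id _).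
  apply: cdiffM; first exact: cdiff_cst.
  by apply: cdiffD; [exact: cdiff_shift dd|exact: cdiff_cst].
have [d] := df 0 ltac:(by split; rewrite normr0 ltW); rewrite addr0 => /cdiff_ccont cf.
have K0 : 0 < 1 + cabs (f xi) by rewrite ltr_pwDl ?cabs_ge0.
have [dl dl0 H] := cf _ (divr_gt0 e0 K0).
exists dl => // w w0 wd; rewrite !cabsM cabsV cabs_conj mulrCA divff ?mulr1 ?cabs_eq0//.
apply: (@le_trans _ _ ((1 + cabs (f xi)) * (e / (1 + cabs (f xi))))).
  by apply: ler_pM; rewrite ?cabs_ge0 ?lerDr// H.
by rewrite mulrC divfK// gt_eqF.
Qed.

End mean_value.

(** * Continuity and mean value inequality of the derivative *)

Section derivative_mean.
Context {R : realType}.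
Implicit Types (f g G E D h : C R -> C R) (z w d l xi : C R).

Definition on_edges (s : R) (P : C R -> Prop) := forall x : R, `|x| <= s ->
  [/\ P (x +i* (- s)), P (x +i* s), P (s +i* x) & P ((- s) +i* x)].

Lemma on_edgesW (s : R) (P : C R -> Prop) : 0 < s ->
  (forall w, insquare s w -> s <= cabs w -> w != 0 -> P w) -> on_edges s P.
Proof.
move=> s0 H x xs.
have ss : `|s| = s by rewrite gtr0_norm.
have Nss : `|- s| = s by rewrite normrN.
have aux (a b : R) : `|a| <= s -> `|b| <= s -> `|a| = s \/ `|b| = s -> P (a +i* b).
  move=> ha hb hab; have sc : s <= cabs (a +i* b : C R).
    by case: hab => <-; [exact: (Re_le_cabs (a +i* b))|exact: (Im_le_cabs (a +i* b))].
  by apply: H => //; rewrite -cabs_gt0 (lt_le_trans s0 sc).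
by split; apply: aux; rewrite ?ss ?Nss//; tauto.
Qed.

Lemma in_sym_norm (s x : R) : x \in `[- s, s] -> `|x| <= s.
Proof. by rewrite in_itv/= ler_norml. Qed.

Lemma edge_sum_le E (s M : R) : 0 < s -> on_edges s (ccont E) ->
  on_edges s (fun w => cabs (E w) <= M) ->
  edge_sum s (fun w => cabs (E w)) <= 8 * s * M.
Proof.
move=> s0 cE EM; have ck : {in `[- s, s], continuous (fun=> 2 * M)}.
  by move=> x _; exact: cvg_cst.
have Ns : - s <= s by lra.
rewrite (_ : 8 * s * M = 2 * M * (s - - s) + 2 * M * (s - - s)); last by ring.
rewrite -(segint_cst (2 * M) Ns); apply: lerD; apply: le_segint => // x /in_sym_norm xs.
- by have [c1 c2 _ _] := cE x xs; apply: cvgD; apply: ccont_x => //; exact: lip1_cabs.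
- by have [? ? _ _] := EM x xs; lra.
- by have [_ _ c1 c2] := cE x xs; apply: cvgD; apply: ccont_y => //; exact: lip1_cabs.
- by have [_ _ ? ?] := EM x xs; lra.
Qed.

Lemma bdint_add G G1 G2 (s : R) : 0 < s ->
  on_edges s (ccont G1) -> on_edges s (ccont G2) ->
  on_edges s (fun w => G w = G1 w + G2 w) ->
  bdint (imf G) (ref G) (- s) s (- s) s =
  bdint (imf G1) (ref G1) (- s) s (- s) s + bdint (imf G2) (ref G2) (- s) s (- s) s.
Proof.
move=> s0 c1 c2 GE; rewrite /bdint addrACA; congr (_ + _); rewrite -segintD.
- apply: eq_Rintegral => x /[!inE]/= /in_sym_norm /GE[e1 e2 e3 e4].
  by rewrite /imf e1 e2 !cImD; ring.
- by move=> x /in_sym_norm /c1[? ? ? ?]; apply: cvgB; apply: ccont_x => //; exact: lip1_Im.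
- by move=> x /in_sym_norm /c2[? ? ? ?]; apply: cvgB; apply: ccont_x => //; exact: lip1_Im.
- apply: eq_Rintegral => x /[!inE]/= /in_sym_norm /GE[e1 e2 e3 e4].
  by rewrite /ref e3 e4 !cReD; ring.
- by move=> x /in_sym_norm /c1[? ? ? ?]; apply: cvgB; apply: ccont_y => //; exact: lip1_Re.
- by move=> x /in_sym_norm /c2[? ? ? ?]; apply: cvgB; apply: ccont_y => //; exact: lip1_Re.
Qed.

(** On each side the integral is a difference of values of Im h at the corners, and the corners
    cancel. [g] is only assumed continuous, which is how the second derivative is avoided. *)
Lemma bdint_exact h g (s : R) : 0 < s -> on_edges s (fun w => cdiff h w (g w)) ->
  on_edges s (ccont g) -> bdint (imf g) (ref g) (- s) s (- s) s = 0.
Proof.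
move=> s0 dh cg; have Ns : - s <= s by lra.
have segB (a b : R -> R) : {in `[- s, s], continuous a} -> {in `[- s, s], continuous b} ->
   segint (fun x => a x - b x) (- s) s = segint a (- s) s - segint b (- s) s.
  by move=> ca cb; rewrite /segint RintegralB//; exact: continuous_integrable.
have hor y : (forall x, `|x| <= s -> cdiff h (x +i* y) (g (x +i* y)) /\ ccont g (x +i* y)) ->
   segint (fun x => imf g x y) (- s) s = complex.Im (h (s +i* y)) - complex.Im (h ((- s) +i* y)).
  move=> H; rewrite (segint_derive (g := fun x => complex.Im (h (x +i* y)))) //.
    by move=> x /in_sym_norm /H[_ c]; apply: ccont_x => //; exact: lip1_Im.
  move=> x /in_sym_norm /H[d _]; move: d; rewrite xline => /is_derive_Im_line.
  by rewrite -xline mulr1; under [X in is_derive _ _ X]funext do rewrite -xline.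
have ver x : (forall y, `|y| <= s -> cdiff h (x +i* y) (g (x +i* y)) /\ ccont g (x +i* y)) ->
   segint (fun y => ref g x y) (- s) s = complex.Im (h (x +i* s)) - complex.Im (h (x +i* (- s))).
  move=> H; rewrite (segint_derive (g := fun y => complex.Im (h (x +i* y)))) //.
    by move=> y /in_sym_norm /H[_ c]; apply: ccont_y => //; exact: lip1_Re.
  move=> y /in_sym_norm /H[d _]; move: d; rewrite yline => /is_derive_Im_line.
  rewrite -yline cImM /= mulr1 mulr0 addr0.
  by under [X in is_derive _ _ X]funext do rewrite -yline.
rewrite /bdint !segB.
- rewrite !hor ?ver; first by ring.
  + by move=> x xs; have [] := dh x xs; have [] := cg x xs.
  + by move=> x xs; have [] := dh x xs; have [] := cg x xs.
  + by move=> x xs; have [] := dh x xs; have [] := cg x xs.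
  + by move=> x xs; have [] := dh x xs; have [] := cg x xs.
- by move=> x /in_sym_norm /cg[? ? ? ?]; apply: ccont_y => //; exact: lip1_Re.
- by move=> x /in_sym_norm /cg[? ? ? ?]; apply: ccont_y => //; exact: lip1_Re.
- by move=> x /in_sym_norm /cg[? ? ? ?]; apply: ccont_x => //; exact: lip1_Im.
- by move=> x /in_sym_norm /cg[? ? ? ?]; apply: ccont_x => //; exact: lip1_Im.
Qed.

Lemma small_quotient f (xi d : C R) : cdiff f xi d -> forall e : R, 0 < e ->
  exists2 dl : R, 0 < dl & forall w, w != 0 -> cabs w <= dl ->
    cabs ((f (xi + w) - f xi - d * w) / w) <= e.
Proof.
move=> fd e /fd[r r0 H]; exists r => // w w0 /H.
by rewrite cabsM cabsV ler_pdivrMr// cabs_gt0.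
Qed.

(** The quotient [E] is differentiable off 0 and tends to l = D(xi + h) - D(xi) there, so
    [edge_mean] bounds |l| by the size of [E] on the edges. There |w| >= s, and uniform continuity
    of f makes the numerator small with h. *)
Lemma derivative_ccont f D xi (s : R) : 0 < s ->
  (forall w, insquare (2 * s) w -> cdiff f (xi + w) (D (xi + w))) -> ccont D xi.
Proof.
move=> s0 dfD e e0; case: xi dfD => a b dfD; set xi := a +i* b.
have [|||r r0 H] := @ccont_unif _ f (a - s) (b - s) (2 * s) _ _ (e * s / 4).
- by rewrite mulr_gt0.
- move=> x y hx hy; have := dfD ((x - a) +i* (y - b)).
  rewrite CD !subrKC => dd; apply: cdiff_ccont (dd _).
  by split; rewrite /= ler_norml; lra.
- by rewrite divr_gt0// mulr_gt0.
exists (Num.min s r); first by rewrite lt_min s0.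
move=> h; rewrite le_min => /andP[hs hr].
pose l := D (xi + h) - D xi; rewrite -/l.
have insq w : insquare s w -> insquare (2 * s) w.
  by move=> [? ?]; split; lra.
have insqh w : insquare s w -> insquare (2 * s) (h + w).
  move=> [h1 h2]; have := Re_le_cabs h; have := Im_le_cabs h => h3 h4.
  by split; rewrite ?cReD ?cImD; apply: (le_trans (ler_normD _ _)); lra.
have in0 : insquare s 0 by split; rewrite normr0 ltW.
pose E w := ((f (xi + h + w) - f (xi + h)) - (f (xi + w) - f xi)) / w.
have dE w : w != 0 -> insquare s w -> exists d, cdiff E w d.
  move=> w0 ws; eexists; apply: cdiffM; last exact: cdiffV (cdiff_id _).
  have d1 := dfD _ (insqh _ ws); rewrite addrA in d1.
  have d2 := dfD _ (insq _ ws).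
  have dN g v d : cdiff g v d -> cdiff (fun x => - g x) v (- d).
    move=> dg; have := cdiffM (cdiff_cst (-1) v) dg.
    rewrite mul0r add0r mulN1r.
    by under [X in cdiff X]funext do rewrite mulN1r.
  apply: cdiffD; last apply: dN; (apply: cdiffD; last exact: cdiff_cst).
    exact: cdiff_shift d1.
  exact: cdiff_shift d2.
(* The numerator is at most 2 e s/4 and |w| >= s, hence e/2; eight half-sides of length s then give
   [edge_sum] <= 4 s e, exactly what [edge_mean] needs for |l| <= e. *)
have EM : on_edges s (fun w => cabs (E w) <= e / 2).
  apply: on_edgesW => // w [ws1 ws2] sw w0.
  rewrite cabsM cabsV ler_pdivrMr ?cabs_gt0//.
  apply: (@le_trans _ _ (e / 2 * s)); last by rewrite ler_pM2l// divr_gt0.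
  have h1 : cabs (f (xi + w + h) - f (xi + w)) <= e * s / 4.
    case: w ws1 ws2 {sw w0} => x y /=; rewrite !ler_norml => /andP[? ?] /andP[? ?].
    by rewrite /xi CD; apply: H => //; apply/andP; split; lra.
  have h2 : cabs (f (xi + h) - f xi) <= e * s / 4.
    by apply: H => //; apply/andP; split; lra.
  rewrite (_ : _ - _ = (f (xi + w + h) - f (xi + w)) - (f (xi + h) - f xi)); last first.
    by rewrite (addrAC xi w h); ring.
  by apply: (le_trans (cabsB _ _)); lra.
have cE : on_edges s (ccont E).
  by apply: on_edgesW => // w ws _ w0; have [d] := dE _ w0 ws; exact: cdiff_ccont.
have : 4 * s * cabs l <= edge_sum s (fun w => cabs (E w)).
  apply: edge_mean => //; apply: cauchy_punctured => // [x y xs ys xy0|e' e'0].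
    have [|d dd] := dE _ xy0; first by split.
    eexists; apply: cdiffM; last exact: cdiffV (cdiff_id _).
    apply: cdiffM; first exact: cdiff_cst.
    by apply: cdiffD; [exact: dd|exact: cdiff_cst].
  have K0 : 0 < 1 + cabs l by rewrite ltr_pwDl ?cabs_ge0.
  have e2 : 0 < e' / (1 + cabs l) / 2 by rewrite !divr_gt0.
  have d1 := dfD _ (insqh _ in0); rewrite addr0 in d1.
  have d2 := dfD _ (insq _ in0); rewrite addr0 in d2.
  have [r1 r10 H1] := small_quotient d1 e2.
  have [r2 r20 H2] := small_quotient d2 e2.
  exists (Num.min r1 r2); first by rewrite lt_min r10.
  move=> w w0; rewrite le_min => /andP[/(H1 _ w0) h1 /(H2 _ w0) h2].
  rewrite !cabsM cabsV cabs_conj mulrCA divff ?mulr1 ?cabs_eq0//.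
  rewrite (_ : E w - l = (f (xi + h + w) - f (xi + h) - D (xi + h) * w) / w -
     (f (xi + w) - f xi - D xi * w) / w); last by rewrite /E /l; field.
  apply: (@le_trans _ _ ((1 + cabs l) * (e' / (1 + cabs l)))).
    apply: ler_pM; rewrite ?cabs_ge0 ?lerDr//.
    by apply: (le_trans (cabsB _ _)); lra.
  by rewrite mulrC divfK// gt_eqF.
move=> /le_trans /(_ (edge_sum_le s0 cE EM)).
rewrite (_ : 8 * s * (e / 2) = 4 * s * e); last by field.
by rewrite ler_pM2l// mulr_gt0.
Qed.

(** The form (D - l)/w cannot be fed to Goursat, because D is not known to be differentiable. It is
    the sum of an exact form and a quotient in f alone. *)
Lemma edge_mean_derivative f D xi (s : R) : 0 < s ->
  (forall w, insquare s w -> cdiff f (xi + w) (D (xi + w))) ->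
  on_edges s (fun w => ccont D (xi + w)) ->
  4 * s * cabs (D xi) <= edge_sum s (fun w => cabs (D (xi + w))).
Proof.
move=> s0 dfD cD.
have cD' : on_edges s (ccont (fun w => D (xi + w))).
  by move=> x /cD[? ? ? ?]; split; exact: ccont_shift.
have d0 := dfD 0 ltac:(by split; rewrite normr0 ltW); rewrite addr0 in d0.
apply: edge_mean => //.
pose l := D xi; set G := fun w => _.
(* D/w - l/w = (D/w - (f - f(xi))/w^2) + (f - f(xi) - l w)/w^2. The first bracket is the derivative
   of (f - f(xi))/w; the second is [q], with |w| |q| -> 0 by differentiability of f at xi. *)
pose q w := (f (xi + w) - f xi - l * w) / w ^+ 2.
pose G2 w := cconj l * q w.
pose h w := cconj l * ((f (xi + w) - f xi) / w).
pose h' w := cconj l * (D (xi + w) / w - (f (xi + w) - f xi) / w ^+ 2).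
have cf : on_edges s (ccont (fun w => f (xi + w))).
  by apply: on_edgesW => // w ws _ _; apply: ccont_shift; exact: cdiff_ccont (dfD _ ws).
have cw2 w : w != 0 -> ccont (fun w => (w ^+ 2)^-1) w.
  move=> w0; apply: ccontV; first by rewrite expf_neq0.
  exact: cdiff_ccont (cdiffX _ (cdiff_id _)).
have edge0 : on_edges s (fun w => w != 0) by apply: on_edgesW.
have ch' : on_edges s (ccont h').
  move=> x xs; have [f1 f2 f3 f4] := cf x xs; have [d1 d2 d3 d4] := cD' x xs.
  have aux w : w != 0 -> ccont (fun w => f (xi + w)) w -> ccont (fun w => D (xi + w)) w -> ccont h' w.
    move=> w0 cfw cdw; apply: ccontM; first exact: ccont_cst.
    apply: ccontB; first by apply: ccontM => //; exact: ccontV (ccont_id w).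
    by apply: ccontM; [apply: ccontB => //; exact: ccont_cst|exact: cw2].
  by have [? ? ? ?] := edge0 x xs; split; exact: aux.
have dq w : w != 0 -> insquare s w -> exists d, cdiff G2 w d.
  move=> w0 ws; eexists; apply: cdiffM; first exact: cdiff_cst.
  apply: cdiffM; last by apply: cdiffV; [rewrite expf_neq0|exact: cdiffX (cdiff_id _)].
  have dN g v d : cdiff g v d -> cdiff (fun x => - g x) v (- d).
    move=> dg; have := cdiffM (cdiff_cst (-1) v) dg.
    rewrite mul0r add0r mulN1r.
    by under [X in cdiff X]funext do rewrite mulN1r.
  apply: cdiffD; last by apply: dN; apply: cdiffM; [exact: cdiff_cst|exact: cdiff_id].
  by apply: cdiffD; [exact: cdiff_shift (dfD _ ws)|exact: cdiff_cst].
have cG2 : on_edges s (ccont G2).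
  by apply: on_edgesW => // w ws _ w0; have [d] := dq _ w0 ws; exact: cdiff_ccont.
rewrite (bdint_add (G1 := h') (G2 := G2))//; last first.
  apply: on_edgesW => // w ws _ w0; rewrite /G /h' /G2 /q.
  by rewrite -/l; field.
rewrite (bdint_exact (h := h))//; last first.
  apply: on_edgesW => // w ws _ w0.
  have -> : h' w = 0 * ((f (xi + w) - f xi) / w) +
     cconj l * (((D (xi + w) + 0) / w + (f (xi + w) - f xi) * (- 1 / w ^+ 2))).
    by rewrite /h'; field.
  apply: cdiffM; first exact: cdiff_cst.
  apply: cdiffM; last exact: cdiffV (cdiff_id _).
  by apply: cdiffD; [exact: cdiff_shift (dfD _ ws)|exact: cdiff_cst].
rewrite add0r; apply: cauchy_punctured => // [x y xs ys xy0|e e0].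
  by apply: dq => //; split.
have K0 : 0 < 1 + cabs l by rewrite ltr_pwDl ?cabs_ge0.
have [r r0 H] := small_quotient d0 (divr_gt0 e0 K0).
exists r => // w w0 /(H _ w0) wr.
rewrite /G2 cabsM cabs_conj mulrCA.
rewrite (_ : cabs w * cabs (q w) = cabs ((f (xi + w) - f xi - D xi * w) / w)); last first.
  by rewrite -cabsM; congr cabs; rewrite /q -/l; field.
apply: (@le_trans _ _ ((1 + cabs l) * (e / (1 + cabs l)))).
  by apply: ler_pM; rewrite ?cabs_ge0 ?lerDr.
by rewrite mulrC divfK// gt_eqF.
Qed.

End derivative_mean.

(** * Area mean inequalities *)

Arguments cabs : simpl never.
Arguments cplx : simpl never.

Notation area_measure R :=
  (@lebesgue_measure R \x @lebesgue_measure R)%E.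

Section plane_measurability.
Context {R : realType}.

(** An open set is the countable union of the boxes with rational centre and radius 1/(n + 1) that
    it contains. *)
Lemma open_measurable2 (U : set (R * R)) : open U -> measurable U.
Proof.
move=> oU.
pose box (i : rat * rat * nat) : set (R * R) :=
  `]ratr i.1.1 - i.2.+1%:R^-1, ratr i.1.1 + i.2.+1%:R^-1[%classic `*`
  `]ratr i.1.2 - i.2.+1%:R^-1, ratr i.1.2 + i.2.+1%:R^-1[%classic.
have -> : U = \bigcup_(i in [set i | box i `<=` U]) box i.
  apply/seteqP; split=> [[x y] Uxy|z [i /= iU zi]]; last exact: iU.
  have /nbhs_ballP[/= e e0 eU] : nbhs (x, y) U by exact: open_nbhs_nbhs.
  have [n ne] : exists n : nat, n.+1%:R^-1 < e / 2.
    exists (Num.truncn (e / 2)^-1).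
    rewrite invf_plt ?posrE//; [exact: truncnS_gt|by rewrite divr_gt0].
  have n0 : 0 < n.+1%:R^-1 :> R by rewrite invr_gt0.
  have kE : n.+1%:R^-1 = n.+1%:R^-1 :> R by [].
  move: {1 3 4}n.+1%:R^-1 kE ne n0 => k kE ne k0.
  have [q1] := @rat_in_itvoo R (x - k) (x + k) ltac:(lra).
  have [q2] := @rat_in_itvoo R (y - k) (y + k) ltac:(lra).
  rewrite !in_itv/= => /andP[y1 y2] /andP[x1 x2].
  exists (q1, q2, n) => /=; last first.
    by rewrite /box /= !in_itv/= -kE; split; apply/andP; split; lra.
  move=> [u v]; rewrite /box /= !in_itv/= -kE => -[/andP[u1 u2] /andP[v1 v2]].
  by apply: eU; split; rewrite /ball /= ltr_norml /=; apply/andP; split; lra.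
rewrite bigcup_mkcond; apply: countable_bigcupT_measurable => // i.
by case: ifP => // _; apply: measurableX; exact: measurable_itv.
Qed.

Lemma open_continuous_measurable_fun2 (U : set (R * R)) (g : R * R -> R) :
  open U -> {in U, continuous g} -> measurable_fun U g.
Proof.
move=> oU cg; apply: (measurability _ (RGenOInfty.measurableE R)).
move=> _ [_ [a ->] <-]; apply: open_measurable2; rewrite openE => z [Uz /= ga].
apply: filterI; first exact: open_nbhs_nbhs.
have /= := cg z (mem_set Uz); apply.
by apply: open_nbhs_nbhs; split => //; exact: interval_open.
Qed.

Lemma ccont_plane (phi : C R -> R) E (w : R * R) : lip1 phi -> ccont E (cplx w) ->
  {for w, continuous (fun w => phi (E (cplx w)))}.
Proof.
move=> phi1 cE; apply/(@cvgrPdist_le R R (R * R)%type (nbhs w)) => e e0.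
have [dl dl0 H] := cE e e0.
apply/nbhs_ballP; exists (dl / 2) => /=; first by rewrite divr_gt0.
move=> v [v1 v2]; rewrite /ball /= in v1 v2.
apply: (le_trans (phi1 _ _)); rewrite cabsC.
have := H (cplx v - cplx w); rewrite subrKC; apply.
apply: (le_trans (cabs_le_ReIm _)); rewrite cReB cImB /=.
by rewrite (distrC v.1) (distrC v.2); lra.
Qed.

Lemma ccont_measurable (phi : C R -> R) E (U : set (R * R)) : lip1 phi -> open U ->
  (forall w, U w -> ccont E (cplx w)) -> measurable_fun U (fun w => phi (E (cplx w))).
Proof.
move=> phi1 oU cE; apply: open_continuous_measurable_fun2 => // w /set_mem Uw.
exact: (ccont_plane phi1 (cE _ Uw)).
Qed.

Lemma continuous_cabs_plane (c : C R) : continuous (fun w : R * R => cabs (cplx w - c)).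
Proof.
move=> w; have c1 : lip1 (fun z : C R => cabs (z - c)); last first.
  exact: (ccont_plane c1 (ccont_id (cplx w))).
move=> z v; apply: (le_trans (lip1_cabs _ _)).
by rewrite (_ : z - c - (v - c) = z - v)//; ring.
Qed.

Lemma measurable_cabs (c : C R) : measurable_fun setT (fun w : R * R => cabs (cplx w - c)).
Proof.
apply: open_continuous_measurable_fun2; first exact: openT.
by move=> w _; exact: continuous_cabs_plane.
Qed.

Lemma open_disc : open (@disc R).
Proof.
have -> : @disc R = (fun w => cabs (cplx w - 0)) @^-1` [set x | x < 1].
  by apply/funext => w; rewrite /disc /preimage /mkset /= subr0.
have /continuousP := @continuous_cabs_plane 0; apply; exact: open_lt.
Qed.

Lemma measurable_disc : measurable (@disc R).
Proof. exact: open_measurable2 open_disc. Qed.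

End plane_measurability.

Section area_shift.
Context {R : realType}.
Local Notation leb := (@lebesgue_measure R).
Implicit Types (F : R -> \bar R).

Lemma measurable_affine (c k : R) :
  measurable_fun [set: measurableTypeR R] (fun x : measurableTypeR R => c + k * x : measurableTypeR R).
Proof.
have := @measurable_funD _ R R setT (cst c) (fun x => k * x) (measurable_cst c).
apply; exact: (@measurable_funM _ R R setT (cst k) id (measurable_cst k) (@measurable_id _ R setT)).
Qed.

(** By uniqueness of Lebesgue measure it suffices to compare half-open intervals. Translations and
    reflections are the motions by which the four sides of a square sweep the plane. *)
Lemma lebesgue_affine (c k : R) (A : set R) : k = 1 \/ k = -1 -> measurable A ->
  leb ((fun x => c + k * x) @^-1` A) = leb A.
Proof.
move=> k1 mA; apply/esym.
pose f : {mfun measurableTypeR R >-> measurableTypeR R} := mfun_Sub (mem_set (measurable_affine c k)).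
apply: (@lebesgue_measure_unique _ (pushforward leb f)) => // _ [[a b]] _ <-.
rewrite /pushforward /f /=.
case: k1 => ->; rewrite ?lebesgue_measure_itv/=.
  rewrite [X in _ = lebesgue_measure X](_ : _ = `]a - c, b - c]%classic); last first.
    by apply/seteqP; split=> x /=; rewrite !in_itv/= mul1r => /andP[? ?]; apply/andP; split; lra.
  rewrite lebesgue_measure_itv/= !lte_fin ltrD2r -!EFinB.
  by congr (if _ then _%:E else _); ring.
rewrite [X in _ = lebesgue_measure X](_ : _ = `[c - b, c - a[%classic); last first.
  by apply/seteqP; split=> x /=; rewrite !in_itv/= mulN1r => /andP[? ?]; apply/andP; split; lra.
rewrite lebesgue_measure_itv/= !lte_fin ltrD2l ltrN2 -!EFinB.
by congr (if _ then _%:E else _); ring.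
Qed.

Lemma integral_affine (c k : R) F : k = 1 \/ k = -1 ->
  measurable_fun setT F -> (forall x, 0 <= F x)%E ->
  (\int[leb]_x F (c + k * x)%R = \int[leb]_x F x)%E.
Proof.
move=> k1 mF F0.
have -> : (\int[leb]_x F x = \int[pushforward leb (mfun_Sub (mem_set (measurable_affine c k)))]_x F x)%E.
  apply: eq_measure_integral => A mA _.
  by rewrite /pushforward /=; apply/esym/lebesgue_affine.
rewrite ge0_integral_pushforward//.
Qed.

End area_shift.

Section area_mean.
Context {R : realType}.
Local Notation leb := (@lebesgue_measure R).
Local Notation area := (area_measure R).
Implicit Types (E : C R -> C R).

Definition qsquare (c : R * R) (a : R) : set (R * R) :=
  `[c.1 - a, c.1 + a]%classic `*` `[c.2 - a, c.2 + a]%classic.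

Lemma measurable_qsquare c a : measurable (qsquare c a).
Proof. by apply: measurableX; exact: measurable_itv. Qed.

Lemma qsquareP c a (w : R * R) :
  qsquare c a w <-> insquare a (cplx w - cplx c).
Proof.
rewrite /qsquare /insquare cReB cImB /= !in_itv/= !ler_norml.
by split=> -[/andP[? ?] /andP[? ?]]; split; apply/andP; split; lra.
Qed.

Lemma segint_EFin (g : R -> R) a b : {in `[a, b], continuous g} ->
  (segint g a b)%:E = (\int[leb]_(x in `[a, b]) (g x)%:E)%E.
Proof.
move=> cg; rewrite /segint /Rintegral fineK//; apply: integrable_fin_num => //.
exact: continuous_integrable.
Qed.

(** Integrate the edge inequality over the half-side s. As s varies each of the four sides sweeps
    part of the square once, so by Tonelli each contributes at most the area integral; hence the
    factor 4. *)
Lemma area_mean_edges E (c : R * R) (a M : R) : 0 < a -> 0 <= M ->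
  (forall w, insquare a w -> ccont E (cplx c + w)) ->
  measurable_fun (qsquare c a) (fun w => cabs (E (cplx w))) ->
  (forall s, 0 < s <= a -> 4 * s * M <= edge_sum s (fun w => cabs (E (cplx c + w)))) ->
  ((a ^+ 2 * M)%:E <= 4%:E * \int[area]_(w in qsquare c a) (cabs (E (cplx w)))%:E)%E.
Proof.
case: c => x0 y0 a0 M0 cE mE HM; set Q := qsquare _ _ in mE *.
(* Extending |E| by 0 lets the section integrals run over whole lines, where translation and
   reflection are available. *)
pose K : R * R -> \bar R := (EFin \o (fun w => cabs (E (cplx w)))) \_ Q.
have K0 w : (0 <= K w)%E.
  by rewrite /K patchE; case: ifP => // _; rewrite lee_fin cabs_ge0.
have mK : measurable_fun [set: measurableTypeR R * measurableTypeR R] K.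
  have : measurable_fun [set: R * R] K; last by [].
  apply/(measurable_restrictT _ (measurable_qsquare _ _)).
  by apply: measurableT_comp.
pose A' y := (\int[leb]_x K (x, y))%E; pose B' x := (\int[leb]_y K (x, y))%E.
have A0 y : (0 <= A' y)%E by apply: integral_ge0.
have B0 x : (0 <= B' x)%E by apply: integral_ge0.
have mA : measurable_fun [set: R] A' by exact: (measurable_fun_fubini_tonelli_G _ mK).
have mB : measurable_fun [set: R] B' by exact: (measurable_fun_fubini_tonelli_F _ mK).
have KE x t : `|x| <= a -> `|t| <= a ->
    K (x0 + x, y0 + t) = (cabs (E (cplx (x0, y0) + (x +i* t))))%:E.
  move=> xa ta; rewrite /K patchE mem_set//.
  by apply/qsquareP; split; rewrite /= addrC addKr.
have inS s x : s <= a -> x \in `[- s, s] -> `|x| <= a.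
  by move=> sa; rewrite in_itv/= ler_norml => /andP[? ?]; apply/andP; split; lra.
have hor s t : 0 < s -> s <= a -> `|t| <= a ->
    {in `[- s, s], continuous (fun x => cabs (E (cplx (x0, y0) + (x +i* t))))} /\
    ((segint (fun x => cabs (E (cplx (x0, y0) + (x +i* t)))) (- s) s)%:E <= A' (y0 + t)%R)%E.
  move=> s0 sa ta; have cg : {in `[- s, s], continuous (fun x => cabs (E (cplx (x0, y0) + (x +i* t))))}.
    move=> x xs; apply: (ccont_x (@lip1_cabs R) (f := fun w => E (cplx (x0, y0) + w))).
    by apply: ccont_shift; apply: cE; split; rewrite //= (inS s).
  split=> //; rewrite segint_EFin//.
  have mKt : measurable_fun [set: measurableTypeR R] (fun x => K (x, y0 + t)).
    exact: (measurable_fun_pair1 (y0 + t) mK).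
  rewrite /A' -(@integral_affine _ x0 1)//; last by left.
  apply: (@le_trans _ _ (\int[leb]_(x in `[(- s)%R, s]) K (x0 + 1 * x, y0 + t)%R)%E).
    apply: le_of_eq; apply: eq_integral => x /[!inE] xs.
    by rewrite mul1r KE// (inS s).
  apply: ge0_subset_integral => //.
  exact: (measurableT_comp mKt (measurable_affine x0 1)).
have ver s t : 0 < s -> s <= a -> `|t| <= a ->
    {in `[- s, s], continuous (fun y => cabs (E (cplx (x0, y0) + (t +i* y))))} /\
    ((segint (fun y => cabs (E (cplx (x0, y0) + (t +i* y)))) (- s) s)%:E <= B' (x0 + t)%R)%E.
  move=> s0 sa ta; have cg : {in `[- s, s], continuous (fun y => cabs (E (cplx (x0, y0) + (t +i* y))))}.
    move=> x xs; apply: (ccont_y (@lip1_cabs R) (f := fun w => E (cplx (x0, y0) + w))).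
    by apply: ccont_shift; apply: cE; split; rewrite //= (inS s).
  split=> //; rewrite segint_EFin//.
  have mKt : measurable_fun [set: measurableTypeR R] (fun y => K (x0 + t, y)).
    exact: (measurable_fun_pair2 (x0 + t) mK).
  rewrite /B' -(@integral_affine _ y0 1)//; last by left.
  apply: (@le_trans _ _ (\int[leb]_(y in `[(- s)%R, s]) K (x0 + t, y0 + 1 * y)%R)%E).
    apply: le_of_eq; apply: eq_integral => x /[!inE] xs.
    by rewrite mul1r KE// (inS s).
  apply: ge0_subset_integral => //.
  exact: (measurableT_comp mKt (measurable_affine y0 1)).
have IAK : (\int[leb]_y A' y = \int[area]_w K w)%E.
  by rewrite (@fubini_tonelli2 _ _ _ _ _ leb leb K mK K0).
have IBK : (\int[leb]_x B' x = \int[area]_w K w)%E.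
  by rewrite (@fubini_tonelli1 _ _ _ _ _ leb leb K mK K0).
clearbody A' B'.
pose S s := (A' (y0 + -1 * s)%R + A' (y0 + 1 * s)%R + (B' (x0 + 1 * s)%R + B' (x0 + -1 * s)%R))%E.
have mAk k : measurable_fun [set: measurableTypeR R] (fun s => A' (y0 + k * s)).
  exact: (measurableT_comp mA (measurable_affine y0 k)).
have mBk k : measurable_fun [set: measurableTypeR R] (fun s => B' (x0 + k * s)).
  exact: (measurableT_comp mB (measurable_affine x0 k)).
have S0 s : (0 <= S s)%E by rewrite /S; apply: adde_ge0; apply: adde_ge0; [exact: A0|exact: A0|exact: B0|exact: B0].
have mS : measurable_fun [set: measurableTypeR R] S.
  by apply: emeasurable_funD; apply: emeasurable_funD; [exact: mAk|exact: mAk|exact: mBk|exact: mBk].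
(* For s >= a/2 the bound 4 s M is at least 2 a M; the interval [a/2, a] has length a/2, which
   yields a^2 M. *)
have HS s : s \in `[a / 2, a] -> ((2 * a * M)%:E <= S s)%E.
  rewrite in_itv/= => /andP[as1 sa]; have s0 : 0 < s by lra.
  have ss : `|s| <= a by rewrite gtr0_norm.
  have Nss : `|- s| <= a by rewrite normrN.
  have [c1 h1] := hor s (- s) s0 sa Nss; have [c2 h2] := hor s s s0 sa ss.
  have [c3 h3] := ver s s s0 sa ss; have [c4 h4] := ver s (- s) s0 sa Nss.
  rewrite /S !mul1r !mulN1r; apply: le_trans (leeD (leeD h1 h2) (leeD h3 h4)).
  rewrite -!EFinD lee_fin; have := HM s ltac:(by rewrite s0 sa).
  rewrite /edge_sum segintD// segintD// => h; apply: le_trans h.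
  by apply: ler_wpM2r => //; lra.
have -> : (a ^+ 2 * M)%:E = (\int[leb]_(s in `[(a / 2)%R, a]) (2 * a * M)%:E)%E.
  rewrite integral_cst//= lebesgue_measure_itv/= lte_fin ifT; last by lra.
  by rewrite -EFinD -EFinM; congr EFin; field.
apply: (@le_trans _ _ (\int[leb]_(s in `[(a / 2)%R, a]) S s)%E).
  apply: ge0_le_integral => //.
  - by move=> s _; rewrite lee_fin !mulr_ge0// ltW.
  - exact: measurable_funTS.
apply: (@le_trans _ _ (\int[leb]_s S s)%E); first exact: ge0_subset_integral.
rewrite /S ge0_integralD//; last 4 first.
- by move=> s _; apply: adde_ge0; exact: A0.
- by apply: emeasurable_funD; [exact: mAk|exact: mAk].
- by move=> s _; apply: adde_ge0; exact: B0.
- by apply: emeasurable_funD; [exact: mBk|exact: mBk].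
have IA k : k = 1 \/ k = -1 -> (\int[leb]_s A' (y0 + k * s)%R = \int[leb]_s A' s)%E.
  by move=> k1; exact: integral_affine.
have IB k : k = 1 \/ k = -1 -> (\int[leb]_s B' (x0 + k * s)%R = \int[leb]_s B' s)%E.
  by move=> k1; exact: integral_affine.
have p1 : 1 = 1 :> R \/ 1 = -1 :> R by left.
have m1 : -1 = 1 :> R \/ -1 = -1 :> R by right.
rewrite ge0_integralD//.
rewrite ge0_integralD//.
rewrite (IA 1 p1) (IA (-1) m1) (IB 1 p1) (IB (-1) m1).
rewrite IAK IBK.
rewrite [X in (_ <= 4%:E * X)%E]integral_mkcond -/K.
rewrite (_ : 4%:E = 1 + 1 + (1 + 1) :> \bar R)%E; last by rewrite -!EFinD; congr EFin; ring.
have I0 : (0 <= \int[area]_w K w)%E by apply: integral_ge0.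
by rewrite !ge0_muleDl ?adde_ge0// !mul1e.
Qed.

End area_mean.

Section power_mean.
Context {R : realType}.
Local Notation leb := (@lebesgue_measure R).
Local Notation area := (area_measure R).
Implicit Types (E f : C R -> C R).

Lemma insquare_cabs a (w : C R) : insquare a w -> cabs w <= 2 * a.
Proof. by move=> [h1 h2]; apply: (le_trans (cabs_le_ReIm _)); lra. Qed.

Lemma qsquare_disc (c : R * R) a : cabs (cplx c) + 2 * a < 1 -> qsquare c a `<=` @disc R.
Proof.
move=> ca w /qsquareP /insquare_cabs wa; rewrite /disc /=.
by apply: le_lt_trans ca; rewrite -{1}(subrKC (cplx c) (cplx w)) (le_trans (cabsD _ _))// lerD2l.
Qed.

(** The modulus on a square of half-side a is at most 2 a, so the condition puts the square inside
    the disc. Isolating this property lets f and f' share the passage to p-th powers. *)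
Definition area_mv E := forall (c : R * R) (a : R), 0 < a -> cabs (cplx c) + 2 * a < 1 ->
  ((a ^+ 2 * cabs (E (cplx c)))%:E <=
    4%:E * \int[area]_(w in qsquare c a) (cabs (E (cplx w)))%:E)%E.

Definition ccont_disc E := forall z : C R, cabs z < 1 -> ccont E z.

Lemma ccont_disc_measurable E : ccont_disc E ->
  measurable_fun (@disc R) (fun w => cabs (E (cplx w))).
Proof.
by move=> cE; apply: ccont_measurable; [exact: lip1_cabs|exact: open_disc|move=> w /cE].
Qed.

Lemma ccont_disc_square E c a : ccont_disc E -> cabs (cplx c) + 2 * a < 1 ->
  forall w, insquare a w -> ccont E (cplx c + w).
Proof.
move=> cE ca w /insquare_cabs wa; apply: cE.
by apply: le_lt_trans ca; rewrite (le_trans (cabsD _ _))// lerD2l.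
Qed.

Lemma area_mv_edges E : ccont_disc E ->
  (forall (c : C R) (s : R), 0 < s -> cabs c + 2 * s < 1 ->
     4 * s * cabs (E c) <= edge_sum s (fun w => cabs (E (c + w)))) -> area_mv E.
Proof.
move=> cE H c a a0 ca; apply: area_mean_edges => //; first exact: cabs_ge0.
- exact: ccont_disc_square.
- apply: measurable_funS (ccont_disc_measurable cE); last exact: qsquare_disc.
  exact: measurable_disc.
- by move=> s /andP[s0 sa]; apply: H => //; lra.
Qed.

Lemma analytic_cdiff f : analytic_disc f -> forall z, cabs z < 1 -> cdiff f z (derive1 f z).
Proof. by move=> af z /af; exact: derivable_cdiff. Qed.

Lemma analytic_ccont f : analytic_disc f -> ccont_disc f.
Proof. by move=> af z /(analytic_cdiff af); exact: cdiff_ccont. Qed.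

Lemma analytic_area_mv f : analytic_disc f -> area_mv f.
Proof.
move=> af; apply: area_mv_edges; first exact: analytic_ccont.
move=> c s s0 cs; apply: edge_mean_diff => // w ws; eexists.
apply: analytic_cdiff => //; apply: le_lt_trans cs; apply: (le_trans (cabsD _ _)).
by rewrite lerD2l insquare_cabs.
Qed.

Lemma derive_ccont f : analytic_disc f -> ccont_disc (derive1 f).
Proof.
(* [derivative_ccont] uses a square of half-side 2 s, hence moduli up to 4 s, less than 1 - |z|. *)
move=> af z z1; pose s := (1 - cabs z) / 5.
have s0 : 0 < s by rewrite divr_gt0// subr_gt0.
apply: (@derivative_ccont _ f (derive1 f) z s) => // w /insquare_cabs ws.
apply: analytic_cdiff => //; apply: (le_lt_trans (cabsD _ _)).
by apply: (le_lt_trans (lerD (lexx _) ws)); rewrite /s; lra.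
Qed.

Lemma derive_area_mv f : analytic_disc f -> area_mv (derive1 f).
Proof.
move=> af; apply: area_mv_edges; first exact: derive_ccont.
move=> c s s0 cs.
have cw w : insquare s w -> cabs (c + w) < 1.
  move=> /insquare_cabs ws; apply: le_lt_trans cs; apply: (le_trans (cabsD _ _)).
  by rewrite lerD2l.
apply: (edge_mean_derivative s0 (f := f)) => [w /cw|]; first exact: analytic_cdiff.
by apply: on_edgesW => // w /cw ws _ _; exact: derive_ccont.
Qed.

Lemma ccont_square_bounded E (c : R * R) (a : R) : 0 < a ->
  (forall w, insquare a w -> ccont E (cplx c + w)) ->
  exists K, forall w, qsquare c a w -> cabs (E (cplx w)) <= K.
Proof.
move=> a0 cE.
have : exists K, forall x y : R, c.1 - a <= x <= c.1 - a + 2 * a ->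
    c.2 - a <= y <= c.2 - a + 2 * a -> cabs (E (x +i* y)) <= K; last first.
  move=> [K HK]; exists K => -[x y]; rewrite /qsquare /= !in_itv/= => -[/andP[h1 h2] /andP[h3 h4]].
  by apply: HK; apply/andP; split=> //=; lra.
apply: (@square_bisection _ (fun X Y L => exists K, forall x y : R, X <= x <= X + L ->
    Y <= y <= Y + L -> cabs (E (x +i* y)) <= K) (c.1 - a) (c.2 - a) (2 * a)); first by rewrite mulr_gt0.
  move=> X Y l l0 [K1 H1] [K2 H2] [K3 H3] [K4 H4].
  exists (Num.max (Num.max K1 K2) (Num.max K3 K4)) => x y /andP[x1 x2] /andP[y1 y2].
  rewrite !le_max; have [?|?] := leP x (X + l / 2); have [?|?] := leP y (Y + l / 2).
  - by rewrite H1 ?orbT//; apply/andP; split=> //; lra.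
  - by rewrite H3 ?orbT//; apply/andP; split=> //; lra.
  - by rewrite H2 ?orbT//; apply/andP; split=> //; lra.
  - by rewrite H4 ?orbT//; apply/andP; split=> //; lra.
move=> x0 y0 hx hy.
have cz : ccont E (x0 +i* y0).
  have := cE ((x0 +i* y0) - cplx c); rewrite subrKC; apply.
  by split; rewrite ?cReB ?cImB /= ler_norml; lra.
have [dl dl0 H] := cz 1 ltr01.
exists (dl / 2); first by rewrite divr_gt0.
move=> X Y l /andP[l0 ld] /andP[? ?] /andP[? ?].
exists (cabs (E (x0 +i* y0)) + 1) => x y /andP[? ?] /andP[? ?].
have := H ((x - x0) +i* (y - y0)); rewrite CD !subrKC => {}H.
apply: (le_trans (cabs_tri _ (E (x0 +i* y0)))); rewrite lerD2l H//.
apply: (le_trans (cabs_le_ReIm _)) => /=.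
have : `|x - x0| <= dl / 2 by rewrite ler_norml; lra.
have : `|y - y0| <= dl / 2 by rewrite ler_norml; lra.
lra.
Qed.

Lemma area_qsquare c (a : R) : 0 < a -> area (qsquare c a) = (4 * a ^+ 2)%:E.
Proof.
move=> a0; rewrite product_measure1E//; try exact: measurable_itv.
rewrite /= !lebesgue_measure_itv/= !lte_fin !ifT; [|by lra|by lra].
by rewrite -!EFinD -EFinM; congr EFin; ring.
Qed.

(** In place of Jensen's inequality: t <= lam^(1-p) t^p + lam for every t >= 0, and lam is chosen so
    small that its contribution is absorbed by the left-hand side. *)
Lemma area_mv_pow_ge1 E p : ccont_disc E -> area_mv E -> 1 <= p ->
  forall (c : R * R) (a : R), 0 < a -> cabs (cplx c) + 2 * a < 1 ->
  ((a ^+ 2 * cabs (E (cplx c)) `^ p)%:E <=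
    (8 * 32 `^ (p - 1))%:E * \int[area]_(w in qsquare c a) (cabs (E (cplx w)) `^ p)%:E)%E.
Proof.
move=> cE mv p1 c a a0 ca; set M := cabs (E (cplx c)).
have p0 : 0 < p by rewrite (lt_le_trans ltr01).
set I := (\int[area]_(w in _) _)%E.
have I0 : (0 <= I)%E by apply: integral_ge0 => w _; rewrite lee_fin powR_ge0.
have C0 : 0 < 8 * 32 `^ (p - 1) :> R by rewrite mulr_gt0// powR_gt0.
have [M0|M0] := eqVneq M 0.
  by rewrite M0 powR0 ?gt_eqF// mulr0 mule_ge0// lee_fin ltW.
have {}M0 : 0 < M by rewrite lt_neqAle eq_sym M0 cabs_ge0.
(* The constant part costs 4 lam (4 a^2) = a^2 M/2, half of the left-hand side. *)
pose lam := M / 32; have lam0 : 0 < lam by rewrite divr_gt0.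
have mQ := measurable_qsquare c a.
have mE : measurable_fun (qsquare c a) (fun w => cabs (E (cplx w))).
  apply: measurable_funS (ccont_disc_measurable cE); last exact: qsquare_disc.
  exact: measurable_disc.
have mEp : measurable_fun (qsquare c a) (fun w => cabs (E (cplx w)) `^ p).
  exact: (measurableT_comp (measurable_powR p) mE).
have key : (\int[area]_(w in qsquare c a) (cabs (E (cplx w)))%:E <=
    (lam `^ (1 - p))%:E * I + (lam * (4 * a ^+ 2))%:E)%E.
  apply: (@le_trans _ _ (\int[area]_(w in qsquare c a)
      ((lam `^ (1 - p))%:E * (cabs (E (cplx w)) `^ p)%:E + (cst lam%:E w)))%E).
    apply: ge0_le_integral => //.
    - by move=> w _; rewrite lee_fin cabs_ge0.
    - exact/measurable_EFinP.
    - apply: emeasurable_funD => //.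
      apply/measurable_EFinP.
      exact: (measurable_funM (measurable_cst _) mEp).
    move=> w _; rewrite -EFinM -EFinD lee_fin; have g0 := cabs_ge0 (E (cplx w)).
    set g := cabs _ in g0 *.
    have [gl|lg] := leP g lam.
      by apply: (le_trans gl); rewrite lerDr mulr_ge0 ?powR_ge0.
    rewrite ler_wpDr ?(ltW lam0)//.
    have gp : 0 < g by exact: lt_trans lg.
    have gE : g = g `^ (1 - p) * g `^ p.
      by rewrite -powRD ?subrK ?powRr1 ?ltW// (gt_eqF gp) implybT.
    rewrite {1}gE ler_wpM2r ?powR_ge0//.
    rewrite -[1 - p]opprB !powRN lef_pV2 ?posrE ?powR_gt0//.
    by rewrite ge0_ler_powR ?nnegrE ?subr_ge0// ltW.
  rewrite ge0_integralD//.
  - rewrite ge0_integralZl//.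
    + rewrite integral_cst//= leeD2l// area_qsquare// -EFinM lee_fin//.
    + exact/measurable_EFinP.
    + by move=> w _; rewrite lee_fin powR_ge0.
    + by rewrite lee_fin powR_ge0.
  - by move=> w _; rewrite -EFinM lee_fin mulr_ge0 ?powR_ge0.
  - apply/measurable_EFinP.
    exact: (measurable_funM (measurable_cst _) mEp).
  - by move=> w _; rewrite lee_fin ltW.
have {key} := le_trans (mv c a a0 ca) (lee_wpmul2l (ltac:(by rewrite lee_fin) : (0 <= 4%:E)%E) key).
rewrite -/M; move: I0; case: I => [r| |//]; last first.
  by move=> _ _; rewrite gt0_muley ?lte_fin// leey.
rewrite lee_fin => r0; rewrite -!EFinM !lee_fin.
rewrite (_ : 4 * (_ + lam * (4 * a ^+ 2)) = 4 * (lam `^ (1 - p) * r) + a ^+ 2 * M / 2); last first.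
  by rewrite /lam; field.
move=> H; have {}H : a ^+ 2 * M <= 8 * (lam `^ (1 - p) * r) by lra.
have Mp : M `^ p = M * M `^ (p - 1).
  by rewrite -{2}(@powRr1 _ M) ?ltW// -powRD ?subrKC// (gt_eqF M0) implybT.
rewrite Mp mulrA; apply: (le_trans (ler_wpM2r (powR_ge0 _ _) H)).
apply: le_of_eq.
have M1 : 0 < M `^ (p - 1) by rewrite powR_gt0.
have -> : lam `^ (1 - p) = 32 `^ (p - 1) / M `^ (p - 1).
  rewrite -[1 - p]opprB powRN /lam powRM ?ltW// ?invr_ge0//.
  rewrite invfM mulrC; congr (_ / _).
  by rewrite -(powR_inv1 (ltac:(by []) : 0 <= 32)) -powRrM mulN1r powRN invrK.
by field; rewrite gt_eqF.
Qed.

(** With N the supremum of d^(2/p) |E|, take a point v where it is nearly reached. On a square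
    around v of half the distance to the boundary |E| is at most N b^(-2/p), so |E| = |E|^(1-p)
    |E|^p is controlled by |E|^p. The exponent 2/p makes the powers of b cancel. *)
Lemma area_mv_pow_lt1 E p : ccont_disc E -> area_mv E -> 0 < p < 1 ->
  forall (c : R * R) (a : R), 0 < a -> cabs (cplx c) + 2 * a < 1 ->
  ((a ^+ 2 * cabs (E (cplx c)) `^ p)%:E <=
    (8 * 2 `^ (2 / p))%:E * \int[area]_(w in qsquare c a) (cabs (E (cplx w)) `^ p)%:E)%E.
Proof.
move=> cE mv /andP[p0 p1] c a a0 ca.
set I := (\int[area]_(w in _) _)%E.
have I0 : (0 <= I)%E by apply: integral_ge0 => w _; rewrite lee_fin powR_ge0.
have C0 : 0 < 8 * 2 `^ (2 / p) :> R by rewrite mulr_gt0// powR_gt0.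
have mQ := measurable_qsquare c a.
(* Sup-norm distance to the boundary of the square; it equals a at the centre, so phi(c)^p is the
   left-hand side. *)
pose d (w : R * R) := a - Num.max `|w.1 - c.1| `|w.2 - c.2|.
have dQ w : qsquare c a w -> 0 <= d w.
  move=> /qsquareP[]; rewrite cReB cImB /= => h1 h2.
  by rewrite subr_ge0 ge_max h1.
have da w : d w <= a by rewrite lerBlDr lerDl le_max normr_ge0.
pose phi w := d w `^ (2 / p) * cabs (E (cplx w)).
have phi0 w : 0 <= phi w by rewrite mulr_ge0 ?powR_ge0 ?cabs_ge0.
have p2 : 0 < 2 / p by rewrite divr_gt0.
have [K HK] := ccont_square_bounded a0 (ccont_disc_square cE ca).
have cQ : qsquare c a c by rewrite /qsquare /= !in_itv/=; split; apply/andP; split; lra.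
have K0 : 0 <= K by apply: le_trans (HK _ cQ); exact: cabs_ge0.
have phiK w : qsquare c a w -> phi w <= a `^ (2 / p) * K.
  move=> Qw; apply: ler_pM; rewrite ?powR_ge0 ?cabs_ge0 ?HK//.
  by rewrite ge0_ler_powR ?nnegrE ?dQ ?(ltW a0) ?(ltW p2).
pose N := sup [set phi w | w in qsquare c a].
have hs : has_sup [set phi w | w in qsquare c a].
  split; first by exists (phi c), c.
  by exists (a `^ (2 / p) * K) => _ [w Qw <-]; exact: phiK.
have phiN w : qsquare c a w -> phi w <= N.
  by move=> Qw; apply: ub_le_sup; [exact: hs.2|exists w].
have phic : phi c = a `^ (2 / p) * cabs (E (cplx c)).
  by rewrite /phi /d !subrr normr0 maxxx subr0.
have Nle : (a ^+ 2 * cabs (E (cplx c)) `^ p <= N `^ p).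
  have -> : a ^+ 2 * cabs (E (cplx c)) `^ p = phi c `^ p.
    rewrite phic powRM ?powR_ge0 ?cabs_ge0// -powRrM divfK ?gt_eqF//.
    by rewrite powR_mulrn// ltW.
  by rewrite ge0_ler_powR ?nnegrE ?(ltW p0) ?phiN// (le_trans (phi0 c))// phiN.
have N0' : 0 <= N by rewrite (le_trans (phi0 c))// phiN.
have [N0|N0] := eqVneq N 0.
  apply: (@le_trans _ _ 0%:E); first by rewrite lee_fin (le_trans Nle)// N0 powR0// gt_eqF.
  by rewrite mule_ge0// lee_fin ltW.
have {N0'}N0 : 0 < N by rewrite lt_neqAle eq_sym N0.
apply: (@le_trans _ _ (N `^ p)%:E); first by rewrite lee_fin.
(* Half of the supremum suffices, so attainment need not be shown. *)
have [_ [v Qv <-] vN] := sup_adherent (ltac:(by rewrite divr_gt0) : 0 < N / 2) hs.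
rewrite -/N in vN; have {}vN : N / 2 < phi v by lra.
set b := d v / 2.
have dv0 : 0 < d v.
  rewrite lt_neqAle dQ// andbT; apply/eqP => dv.
  by move: vN; rewrite /phi -dv powR0 ?gt_eqF// mul0r; lra.
have b0 : 0 < b by rewrite divr_gt0.
(* d(v) = 2 b and d decreases by at most b on the square around v. *)
have subQ : qsquare v b `<=` qsquare c a /\ (forall w, qsquare v b w -> b <= d w).
  have aux w : qsquare v b w -> b <= d w.
    move=> /qsquareP[]; rewrite cReB cImB /= => h1 h2.
    have hd : Num.max `|v.1 - c.1| `|v.2 - c.2| = a - 2 * b by rewrite /b /d; field.
    have m1 : `|v.1 - c.1| <= a - 2 * b by rewrite -hd le_max lexx.
    have m2 : `|v.2 - c.2| <= a - 2 * b by rewrite -hd le_max lexx orbT.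
    rewrite /d lerBrDl -lerBrDr ge_max; apply/andP; split.
      by have := ler_distD v.1 w.1 c.1; lra.
    by have := ler_distD v.2 w.2 c.2; lra.
  split=> // w /aux bd; apply/qsquareP; split; rewrite ?cReB ?cImB /=.
    have : `|w.1 - c.1| <= Num.max `|w.1 - c.1| `|w.2 - c.2| by rewrite le_max lexx.
    by rewrite /d in bd; lra.
  have : `|w.2 - c.2| <= Num.max `|w.1 - c.1| `|w.2 - c.2| by rewrite le_max lexx orbT.
  by rewrite /d in bd; lra.
have [sQ bd] := subQ.
have vb : cabs (cplx v) + 2 * b < 1.
  have : cabs (cplx v - cplx c) <= 2 * (a - d v).
    apply: insquare_cabs; split; rewrite ?cReB ?cImB /= /d; set m := Num.max _ _.
      by rewrite subKr le_max lexx.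
    by rewrite subKr le_max lexx orbT.
  have := cabs_tri (cplx v) (cplx c); rewrite /b; lra.
(* [k] bounds |E|^(1-p) on the square around v, where |E| <= N b^(-2/p). *)
pose k := (N * b `^ (- (2 / p))) `^ (1 - p).
have mE : measurable_fun (qsquare v b) (fun w => cabs (E (cplx w))).
  apply: measurable_funS (ccont_disc_measurable cE); last exact: qsquare_disc.
  exact: measurable_disc.
have mEp : measurable_fun (qsquare c a) (fun w => cabs (E (cplx w)) `^ p).
  apply: (measurableT_comp (measurable_powR p)).
  apply: measurable_funS (ccont_disc_measurable cE); last exact: qsquare_disc.
  exact: measurable_disc.
have mQv := measurable_qsquare v b.
have mEpv : measurable_fun (qsquare v b) (fun w => cabs (E (cplx w)) `^ p).
  exact: measurable_funS mEp.
have key : (\int[area]_(w in qsquare v b) (cabs (E (cplx w)))%:E <= k%:E * I)%E.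
  apply: (@le_trans _ _ (\int[area]_(w in qsquare v b)
      (k%:E * (cabs (E (cplx w)) `^ p)%:E))%E).
    apply: ge0_le_integral => //.
    - by move=> w _; rewrite lee_fin cabs_ge0.
    - exact/measurable_EFinP.
    - apply/measurable_EFinP.
      exact: (measurable_funM (measurable_cst _) mEpv).
    move=> w Qw; rewrite -EFinM lee_fin; have g0 := cabs_ge0 (E (cplx w)).
    have := phiN _ (sQ _ Qw); rewrite /phi; set g := cabs _ in g0 * => gN.
    have [->|gn0] := eqVneq g 0; first by rewrite mulr_ge0 ?powR_ge0.
    have gp : 0 < g by rewrite lt_neqAle eq_sym gn0.
    rewrite -{1}(@powRr1 _ g)// -[X in g `^ X](subrK p) powRD; last by rewrite gn0 implybT.
    rewrite ler_wpM2r ?powR_ge0// ge0_ler_powR ?nnegrE ?subr_ge0 ?(ltW p1)//.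
      by rewrite mulr_ge0 ?powR_ge0 ?(ltW N0).
    rewrite powRN ler_pdivlMr ?powR_gt0// mulrC; apply: le_trans gN.
    have dw := dQ _ (sQ _ Qw); have bw := bd _ Qw.
    by apply: ler_wpM2r => //; rewrite ge0_ler_powR ?nnegrE ?(ltW p2) ?(ltW b0).
  rewrite ge0_integralZl//.
  - apply: lee_wpmul2l; first by rewrite lee_fin powR_ge0.
    apply: ge0_subset_integral => //; first exact/measurable_EFinP.
    by move=> w _; rewrite lee_fin powR_ge0.
  - exact/measurable_EFinP.
  - by move=> w _; rewrite lee_fin powR_ge0.
  - by rewrite lee_fin powR_ge0.
have {key} := le_trans (mv v b b0 vb) (lee_wpmul2l (ltac:(by rewrite lee_fin) : (0 <= 4%:E)%E) key).
move: I0; case: I => [r| |//]; last first.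
  by move=> _ _; rewrite gt0_muley ?lte_fin// leey.
rewrite lee_fin => r0; rewrite -!EFinM !lee_fin => H.
have h1 : N / 2 * (2 * b) `^ (- (2 / p)) <= cabs (E (cplx v)).
  rewrite powRN ler_pdivrMr ?powR_gt0 ?mulr_gt0// ltW//.
  have db : d v = 2 * b by rewrite /b; field.
  by move: vN; rewrite /phi db [_ * cabs _]mulrC.
have h2 : b ^+ 2 * (N / 2 * (2 * b) `^ (- (2 / p))) <= 4 * (k * r).
  by apply: le_trans H; rewrite ler_wpM2l// exprn_ge0// ltW.
have kE : k = N / N `^ p * (b ^+ 2 / b `^ (2 / p)).
  rewrite /k powRM ?powR_ge0 ?(ltW N0)// powRB ?powRr1 ?(ltW N0) ?(gt_eqF N0) ?implybT//.
  congr (_ * _); rewrite -powRrM (_ : - (2 / p) * (1 - p) = 2 - 2 / p); last by field; rewrite gt_eqF.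
  by rewrite powRB ?(gt_eqF b0) ?implybT// powR_mulrn// ltW.
have Np : 0 < N `^ p by rewrite powR_gt0.
have bp : 0 < b `^ (2 / p) by rewrite powR_gt0.
have tp : 0 < 2 `^ (2 / p) :> R by rewrite powR_gt0.
(* [q0] concerns the factor that turns N^p and the integral bound into the two sides of [h2], with
   constant 8 * 2^(2/p). *)
have q0 : 0 < b ^+ 2 * N / (b `^ (2 / p) * N `^ p * (2 * 2 `^ (2 / p))).
  by rewrite divr_gt0 ?mulr_gt0// exprn_gt0.
rewrite -(ler_pM2l q0).
move: h2; rewrite kE powRN powRM ?(ltW b0)// => h2.
by apply: le_trans (le_trans _ h2) _; apply: le_of_eq; field;
  rewrite ?gt_eqF.
Qed.

Lemma area_mv_pow p : 0 < p -> exists2 K : R, 0 < K & forall E, ccont_disc E -> area_mv E ->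
  forall (c : R * R) (a : R), 0 < a -> cabs (cplx c) + 2 * a < 1 ->
  ((a ^+ 2 * cabs (E (cplx c)) `^ p)%:E <=
    K%:E * \int[area]_(w in qsquare c a) (cabs (E (cplx w)) `^ p)%:E)%E.
Proof.
move=> p0; have [p1|p1] := ltP p 1.
  exists (8 * 2 `^ (2 / p)); first by rewrite mulr_gt0// powR_gt0.
  by move=> E cE mv; apply: area_mv_pow_lt1 => //; rewrite p0.
exists (8 * 32 `^ (p - 1)); first by rewrite mulr_gt0// powR_gt0.
by move=> E cE mv; exact: area_mv_pow_ge1.
Qed.

End power_mean.

(** * Carleson squares *)

Section arcs.
Context {R : realType}.
Implicit Types (I : circle_arc R) (t s : R) (z w : C R).

Definition eit t : C R := cos t +i* sin t.

Lemma eitD t s : eit (t + s) = eit t * eit s.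
Proof.
rewrite /eit cosD sinD; apply/eqP; rewrite eq_complex /=.
by apply/andP; split; apply/eqP; ring.
Qed.

Lemma cabs_eit t : cabs (eit t) = 1.
Proof. by rewrite /eit /cabs /Normc.normc cos2Dsin2 sqrtr1. Qed.

Lemma sin_le_norm t : `|sin t| <= `|t|.
Proof.
wlog t0 : t / 0 < t => [H|].
  have [t0|t0|->] := ltgtP t 0; last by rewrite sin0.
    by rewrite -normrN -sinN -(normrN t) H// oppr_gt0.
  exact: H.
have [|x _] := @MVT_segment R (@sin R) (@cos R) 0 t (ltW t0).
  by apply: continuous_subspaceT => x; exact: continuous_sin.
rewrite sin0 !subr0 => ->; rewrite normrM ler_piMl//.
by rewrite ler_norml cos_geN1 cos_le1.
Qed.

Lemma sin_half_sqr t : 2 - 2 * cos t = (2 * sin (t / 2)) ^+ 2.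
Proof.
have {1}-> : t = t / 2 + t / 2 by field.
by rewrite cosD -!expr2; have := cos2Dsin2 (t / 2); rewrite exprMn => h; rewrite -[cos _ ^+ 2](addrK (sin (t / 2) ^+ 2)) h; ring.
Qed.

Lemma cabs_eitB t s : cabs (eit t - eit s) = `|2 * sin ((t - s) / 2)|.
Proof.
rewrite -{1}(subrK s t) eitD -{2}(mul1r (eit s)) -mulrBl cabsM cabs_eit mulr1.
rewrite -sqrtr_sqr -sin_half_sqr /cabs /Normc.normc /eit; congr Num.sqrt.
by rewrite /= subr0; have := cos2Dsin2 (t - s) => h; rewrite -[sin _ ^+ 2](addKr (cos (t - s) ^+ 2)) h; ring.
Qed.

Lemma cabs_eitB_le t s : cabs (eit t - eit s) <= `|t - s|.
Proof.
rewrite cabs_eitB normrM ger0_norm//.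
apply: (le_trans (ler_wpM2l _ (sin_le_norm _))) => //.
by rewrite normrM (ger0_norm (_ : 0 <= 2^-1))// mulrCA divff ?mulr1.
Qed.

(** If cos t >= 1/3, the mean value theorem applies since cos decreases. Otherwise sin t >= 2/3, and
    t <= pi/2 < 2. *)
Lemma sin_ge_third t : 0 <= t <= pi / 2 -> t / 3 <= sin t.
Proof.
move=> /andP[t0 tp]; have p2 := @pihalf_lt2 R.
have s0 : 0 <= sin t by apply: sin_ge0_pi; rewrite t0; have := @pi_gt0 R; lra.
have [c3|c3] := leP (1 / 3) (cos t).
  have [|x /[!in_itv]/= /andP[x0 xt]] := @MVT_segment R (@sin R) (@cos R) 0 t t0.
    by apply: continuous_subspaceT => x; exact: continuous_sin.
  rewrite sin0 !subr0 => ->; rewrite mulrC ler_wpM2r//.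
  suff : cos t <= cos x by lra.
  move: xt; rewrite le_eqVlt => /predU1P[->//|xt]; apply: ltW.
  by rewrite ltr_cos// in_itv/=; have := @pi_gt0 R; lra.
have c0 : 0 <= cos t by rewrite cos_ge0_pihalf//; lra.
have : sin t ^+ 2 >= (2 / 3) ^+ 2.
  have c2 : cos t ^+ 2 <= (1 / 3) ^+ 2 by rewrite ler_pXn2r ?nnegrE// ?ltW//; lra.
  have := cos2Dsin2 t; lra.
rewrite ler_pXn2r ?nnegrE//; lra.
Qed.

Lemma cabs_eitB_ge t s : `|t - s| <= pi -> `|t - s| <= 3 * cabs (eit t - eit s).
Proof.
move=> h; rewrite cabs_eitB normrM (ger0_norm (_ : 0 <= 2))//.
have -> : `|sin ((t - s) / 2)| = sin (`|t - s| / 2).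
  have sp (x : R) : 0 <= x -> x <= pi -> `|sin (x / 2)| = sin (x / 2).
    by move=> x0 xp; rewrite ger0_norm// sin_ge0_pi//; lra.
  have [x0|x0] := leP 0 (t - s); first by rewrite (ger0_norm x0) sp// -(ger0_norm x0).
  rewrite -normrN -sinN -mulNr -(ltr0_norm x0) sp//.
have := @sin_ge_third (`|t - s| / 2); rewrite divr_ge0//= ler_pM2r// => /(_ h).
lra.
Qed.

(** The reference angle fixes the branch: an argument within pi of [t] makes angles comparable with
    chords. *)
Lemma polar z t : exists s, `|s - t| <= pi /\ z = (cabs z)%:C * eit s.
Proof.
have [->|z0] := eqVneq z 0.
  by exists t; rewrite subrr normr0 pi_ge0 cabs0 mul0r.
have cz : 0 < cabs z by rewrite cabs_gt0.
pose v := z / (cabs z)%:C * eit (- t).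
have v1 : cabs v = 1.
  by rewrite /v !cabsM cabs_eit cabsV cabs_real gtr0_norm// mulr1 divff// gt_eqF.
have vE : z = (cabs z)%:C * (v * eit t).
  rewrite /v -mulrA -eitD addNr /eit cos0 sin0.
  have -> : 1 +i* 0 = 1 :> C R by [].
  by rewrite mulr1 mulrCA divff ?mulr1// -cabs_gt0 cabs_real gtr0_norm.
move: v1 vE; case: v => a b v1 vE.
have ab : a ^+ 2 + b ^+ 2 = 1 by rewrite -cabs_sqr v1 expr1n.
have a1 : -1 <= a <= 1.
  have b2 := sqr_ge0 b; rewrite -ler_norml -(ler_pXn2r (_ : 0 < 2)%N)// ?nnegrE//.
  by rewrite expr1n real_normK ?num_real//; lra.
have sb : Num.sqrt (1 - a ^+ 2) = `|b| by rewrite -ab addrC addKr sqrtr_sqr.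
have a0 := acos_ge0 a1; have ap := acos_lepi a1.
have ca : cos (acos a) = a by rewrite acosK// in_itv.
have sa : sin (acos a) = `|b| by rewrite sin_acos.
have [b0|b0] := leP 0 b.
  exists (acos a + t); rewrite addrK ger0_norm//; split=> //.
  by rewrite {1}vE eitD /eit ca sa (ger0_norm b0).
exists (- acos a + t); rewrite addrK normrN ger0_norm//; split=> //.
by rewrite {1}vE eitD /eit cosN sinN ca sa (ltr0_norm b0) opprK.
Qed.

Lemma arc_length_gt0 I : 0 < arc_length I.
Proof.
by have /andP[se _] := arc_proper I; rewrite /arc_length divr_gt0 ?subr_gt0// mulr_gt0// pi_gt0.
Qed.

Lemma arc_length_le1 I : arc_length I <= 1.
Proof.
have /andP[_ es] := arc_proper I; rewrite /arc_length ler_pdivrMr ?mul1r; first by lra.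
by rewrite mulr_gt0// pi_gt0.
Qed.

Definition polar_coord (x : R * R) : R * R := (x.1 * cos x.2, x.1 * sin x.2).

Lemma polar_coordE (x : R * R) : cplx (polar_coord x) = x.1%:C * eit x.2.
Proof.
by rewrite /cplx /eit; apply/eqP; rewrite eq_complex /=; apply/andP; split; apply/eqP; ring.
Qed.

Lemma cplx_inj : injective (@cplx R).
Proof. by move=> [a b] [c d] [-> ->]. Qed.

Lemma continuous_polar_coord : continuous polar_coord.
Proof.
move=> x.
have c1 : {for x, continuous (fun x : R * R => x.1 * cos x.2)}.
  apply: cvgM; first exact: cvg_fst.
  by apply: (@continuous_comp _ _ _ snd cos); [exact: cvg_snd|exact: continuous_cos].
have c2 : {for x, continuous (fun x : R * R => x.1 * sin x.2)}.
  apply: cvgM; first exact: cvg_fst.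
  by apply: (@continuous_comp _ _ _ snd sin); [exact: cvg_snd|exact: continuous_sin].
exact: (cvg_pair c1 c2).
Qed.

Definition arc_itv I : interval R :=
  Interval (BSide (arc_left I) (arc_start I)) (BSide (arc_right I) (arc_end I)).

Lemma carleson_squareP I (w : R * R) : carleson_square I w <->
  exists r t, [/\ 1 - arc_length I <= r < 1, t \in arc_itv I & cplx w = r%:C * eit t].
Proof.
split=> [[r [_ [h [t ht <-] wE]]]|[r [t [h ht wE]]]]; first by exists r, t; split.
by exists r, (eit t); split=> //; exists t.
Qed.

Lemma carleson_square_image I : carleson_square I =
  [set polar_coord x | x in `[1 - arc_length I, 1[%classic `*` [set` arc_itv I]].
Proof.
apply/seteqP; split=> [w /carleson_squareP[r [t [h ht wE]]]|_ [[r t] [/= h ht] <-]].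
  by exists (r, t); [split=> //=; rewrite in_itv|apply: cplx_inj; rewrite wE polar_coordE].
apply/carleson_squareP; exists r, t; split=> //; last by rewrite polar_coordE.
Qed.

Lemma measurable_polar_rect (a b c d : R) :
  measurable [set polar_coord x | x in `[a, b]%classic `*` `[c, d]%classic].
Proof.
have : compact [set polar_coord x | x in `[a, b]%classic `*` `[c, d]%classic].
  apply: continuous_compact.
    by apply: continuous_subspaceT => x; exact: continuous_polar_coord.
  by apply: compact_setX; exact: segment_compact.
move=> /(compact_closed (@norm_hausdorff _ (R * R)%type)) cl.
by rewrite -[X in measurable X]setCK; apply: measurableC; apply: open_measurable2; exact: closed_openC.
Qed.

(** Arcs may contain or omit each endpoint, so the square is exhausted by countably many compact
    images of closed polar rectangles. *)
Lemma measurable_carleson_square I : measurable (carleson_square I).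
Proof.
rewrite carleson_square_image.
pose a := arc_start I; pose b := arc_end I; pose h := arc_length I.
pose eps n : R := n.+1%:R^-1.
(* [arc_left] true includes the left endpoint, whereas [arc_right] true excludes the right one; only
   an excluded endpoint is approached from inside. *)
pose F n := [set polar_coord x | x in `[1 - h, 1 - eps n]%classic `*`
   `[a + (~~ arc_left I)%:R * eps n, b - (arc_right I)%:R * eps n]%classic].
have eps0 n : 0 < eps n by rewrite /eps invr_gt0.
have epsm n m : (n <= m)%N -> eps m <= eps n.
  by move=> nm; rewrite /eps lef_pV2 ?posrE// ler_nat.
have small d : 0 < d -> exists n, eps n < d.
  move=> d0; exists (Num.truncn d^-1); rewrite /eps invf_plt ?posrE//.
  exact: truncnS_gt.
suff -> : [set polar_coord x | x in `[1 - h, 1[%classic `*` [set` arc_itv I]] =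
    \bigcup_n F n.
  by apply: bigcupT_measurable => n; exact: measurable_polar_rect.
apply/seteqP; split=> [_ [[r t] [/= hr ht] <-]|w [n _ [[r t] [/= hr ht] <-]]]; last first.
  exists (r, t) => //; split=> /=.
    move: hr; rewrite !in_itv/= => /andP[-> h2]/=.
    by rewrite (le_lt_trans h2)// ltrBlDr ltrDl.
  have e0 := eps0 n; move: ht; rewrite /arc_itv !in_itv /=; rewrite -/a -/b.
  by case: (arc_left I); case: (arc_right I) => /=; rewrite ?mul1r ?mul0r ?addr0 ?subr0;
    move=> /andP[h1 h2]; apply/andP; split=> //; rewrite /= ?lteBSide /=; lra.
move: hr; rewrite in_itv/= => /andP[hr r1].
have [n1 e1] := small (1 - r) ltac:(by rewrite subr_gt0).
have [n2 e2] : exists n, a + (~~ arc_left I)%:R * eps n <= t.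
  move: ht; rewrite /arc_itv in_itv/= -/a -/b; case: (arc_left I) => /= /andP[h1 _].
    by exists 0%N; rewrite mul0r addr0.
  have [n en] := small (t - a) ltac:(by rewrite subr_gt0).
  by exists n; rewrite mul1r; lra.
have [n3 e3] : exists n, t <= b - (arc_right I)%:R * eps n.
  move: ht; rewrite /arc_itv in_itv/= -/a -/b; case: (arc_right I) => /= /andP[_ h1].
    have [n en] := small (b - t) ltac:(by rewrite subr_gt0).
    by exists n; rewrite mul1r; lra.
  by exists 0%N; rewrite mul0r subr0.
pose n := (n1 + (n2 + n3))%N.
have m1 : eps n <= eps n1 by apply: epsm; rewrite /n leq_addr.
have m2 : eps n <= eps n2 by apply: epsm; rewrite /n addnCA leq_addr.
have m3 : eps n <= eps n3 by apply: epsm; rewrite /n addnA leq_addl.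
exists n => //; exists (r, t) => //; split=> /=; rewrite in_itv/=.
  by rewrite hr/=; lra.
apply/andP; split; [apply: le_trans e2|apply: (le_trans e3)].
  by rewrite lerD2l ler_wpM2l.
by rewrite lerB// ler_wpM2l.
Qed.

Lemma carleson_square_disc I (w : R * R) : carleson_square I w ->
  1 - arc_length I <= cabs (cplx w) < 1.
Proof.
move=> /carleson_squareP[r [t [h _ ->]]]; rewrite cabsM cabs_eit mulr1 cabs_real.
by rewrite ger0_norm//; have := arc_length_le1 I; case/andP: h; lra.
Qed.

(** 9 = 1 + 8: the radial displacement is at most |I| and the angular one at most 2 pi |I| <= 8
    |I|. *)
Lemma carleson_square_near I (w : R * R) : carleson_square I w ->
  cabs (cplx w - eit (arc_start I)) <= 9 * arc_length I.
Proof.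
move=> /carleson_squareP[r [t [/andP[h1 h2] ht ->]]]; have I0 := arc_length_gt0 I.
have t1 : arc_start I <= t <= arc_end I.
  by move: ht; rewrite /arc_itv in_itv/=; case: (arc_left I); case: (arc_right I) => /= /andP[? ?]; apply/andP; split=> //; exact: ltW.
have lE : arc_end I - arc_start I = arc_length I * (2 * pi).
  by rewrite /arc_length divfK// gt_eqF// mulr_gt0// pi_gt0.
have p4 : 2 * pi <= 8 :> R by have := @pihalf_lt2 R; lra.
have -> : r%:C * eit t - eit (arc_start I) = (r - 1)%:C * eit t + (eit t - eit (arc_start I)).
  by rewrite rmorphB rmorph1; ring.
apply: (le_trans (cabsD _ _)); rewrite cabsM cabs_eit mulr1 cabs_real.
have : cabs (eit t - eit (arc_start I)) <= arc_length I * 8.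
  apply: (le_trans (cabs_eitB_le _ _)).
  apply: (@le_trans _ _ (arc_length I * (2 * pi))); last by rewrite ler_pM2l.
  by rewrite -lE ger0_norm; lra.
have : `|r - 1| <= arc_length I by rewrite ler0_norm; lra.
lra.
Qed.

Lemma closed_arc_proof (a l : R) : 0 < l <= 1 -> a < a + l * (2 * pi) <= a + 2 * pi.
Proof.
have p0 : 0 < 2 * pi :> R by rewrite mulr_gt0// pi_gt0.
move=> /andP[l0 l1]; apply/andP; split; first by rewrite ltrDl mulr_gt0.
by rewrite lerD2l ler_piMl// ltW.
Qed.

Definition closed_arc (a l : R) (h : 0 < l <= 1) : circle_arc R :=
  CircleArc true false (closed_arc_proof a h).

Lemma closed_arc_length a l (h : 0 < l <= 1) : arc_length (closed_arc a h) = l.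
Proof.
by rewrite /arc_length /= addrC addKr mulfK// gt_eqF// mulr_gt0// pi_gt0.
Qed.

Lemma closed_arcP a l (h : 0 < l <= 1) (w : R * R) : carleson_square (closed_arc a h) w <->
  exists r t, [/\ 1 - l <= r < 1, a <= t <= a + l * (2 * pi) & cplx w = r%:C * eit t].
Proof.
by rewrite (carleson_squareP (closed_arc a h)) closed_arc_length; split=> -[r [t [? ? ?]]]; exists r, t; split.
Qed.

Lemma carleson_square_closed I : exists (a l : R) (h : 0 < l <= 1),
  l = arc_length I /\ carleson_square I `<=` carleson_square (closed_arc a h).
Proof.
have h : 0 < arc_length I <= 1 by rewrite arc_length_gt0 arc_length_le1.
exists (arc_start I), (arc_length I), h; split=> // w /carleson_squareP[r [t [hr ht wE]]].
apply/closed_arcP; exists r, t; split=> //.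
rewrite /arc_length divfK; last by rewrite gt_eqF// mulr_gt0// pi_gt0.
rewrite subrKC; move: ht; rewrite /arc_itv in_itv/=.
by case: (arc_left I); case: (arc_right I) => /= /andP[? ?]; apply/andP; split=> //; exact: ltW.
Qed.

(** Two points of the box are within 2 rho, so their directions differ by a chord of at most 4 rho
    and an angle of at most 12 rho. The arc reaches 32 rho pi to either side; for rho >= 1/32 the
    full circle serves. *)
Lemma box_in_carleson_square (c : C R) (rho : R) : 0 < rho ->
  exists I, arc_length I <= 32 * rho /\
    forall w : R * R, cabs (cplx w) < 1 -> 1 - cabs (cplx w) <= rho ->
      cabs (cplx w - c) <= rho -> carleson_square I w.
Proof.
move=> rho0; have [rhob|rhos] := leP 32^-1 rho.
  have h1 : 0 < (1 : R) <= 1 by rewrite lexx ltr01.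
  exists (closed_arc 0 h1); rewrite closed_arc_length; split.
    by move: rhob; rewrite -div1r ler_pdivrMr// mulrC.
  move=> w w1 _ _; apply/closed_arcP.
  have [s [sp wE]] := polar (cplx w) pi.
  exists (cabs (cplx w)), s; split=> //; first by rewrite subrr cabs_ge0.
  by move: sp; rewrite ler_norml; lra.
have p2 := @pi_ge2 R; have p4 := @pihalf_lt2 R.
have h1 : 0 < 32 * rho <= 1 by rewrite mulr_gt0//=; move: rhos; rewrite -div1r ltr_pdivlMr; lra.
(* The arc is centred at the argument of a point of the box, not of [c], which is arbitrary; for an
   empty box any arc will do. *)
have [[w1 [w11 w12 w13]]|no] := pselect (exists w : R * R,
    [/\ cabs (cplx w) < 1, 1 - cabs (cplx w) <= rho & cabs (cplx w - c) <= rho]); last first.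
  exists (closed_arc 0 h1); rewrite closed_arc_length; split=> // w *.
  by exfalso; apply: no; exists w.
have [th [_ w1E]] := polar (cplx w1) 0.
exists (closed_arc (th - 32 * rho * pi) h1); rewrite closed_arc_length; split=> // w wd wr wc.
apply/closed_arcP; have [t [ht wE]] := polar (cplx w) th.
exists (cabs (cplx w)), t; split=> //; first by apply/andP; split=> //; lra.
set r := cabs (cplx w) in wE wd wr; set r1 := cabs (cplx w1) in w1E w11 w12.
have d : cabs (cplx w - cplx w1) <= 2 * rho.
  rewrite (_ : _ - _ = (cplx w - c) - (cplx w1 - c)); last by ring.
  by apply: (le_trans (cabsB _ _)); lra.
have e : cabs (eit t - eit th) <= 4 * rho.
  have -> : eit t - eit th = (1 - r)%:C * eit t + (cplx w - cplx w1) - (1 - r1)%:C * eit th.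
    by rewrite {1}wE {1}w1E !rmorphB !rmorph1; ring.
  apply: (le_trans (cabsB _ _)); apply: (le_trans (lerD (cabsD _ _) (lexx _))).
  rewrite !cabsM !cabs_eit !mulr1 !cabs_real !ger0_norm; [|by lra|by lra].
  lra.
have hp : 32 * rho * 2 <= 32 * rho * pi by rewrite ler_pM2l// mulr_gt0.
have hl : `|t - th| <= 12 * rho by have := cabs_eitB_ge ht; lra.
by move: hl; rewrite ler_norml => /andP[? ?]; apply/andP; split; lra.
Qed.

End arcs.

(** * Integration lemmas *)

Section ge0_monotone.
Context d (T : measurableType d) {R : realType} (m : {measure set T -> \bar R}).
Local Open Scope ereal_scope.

(** The integral of a non-negative function is a supremum over simple functions below it, so
    monotonicity holds without measurability. *)
Lemma ge0_integral_mono (D : set T) (f g : T -> \bar R) :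
  (forall x, D x -> 0 <= f x) -> (forall x, D x -> f x <= g x) ->
  \int[m]_(x in D) f x <= \int[m]_(x in D) g x.
Proof.
move=> f0 fg; rewrite !ge0_integralE//; last first.
  by move=> x Dx; rewrite (le_trans (f0 x Dx))// fg.
apply: ereal_sup_le => _ [h hf <-]; exists h => // x; apply: le_trans (hf x) _.
by rewrite !patchE; case: ifPn => // /set_mem /fg.
Qed.

End ge0_monotone.

Section series_bound.
Context d (T : measurableType d) {R : realType} (m : {measure set T -> \bar R}).
Local Open Scope ereal_scope.

(** Domination by a series: the sets [A k] may overlap, since F <= c_k W is required for just one k
    with x in [A k]. Used for dyadic levels and for dyadic annuli. *)
Lemma integral_le_geometric (D : set T) (F W : T -> \bar R) (A : (set T)^nat)
    (c : nat -> R) (M th : R) : measurable D -> measurable_fun D W ->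
  (forall x, D x -> 0 <= F x) -> (forall x, 0 <= W x) -> (forall k, measurable (A k)) ->
  (forall k, (0 <= c k)%R) -> (0 < th < 1)%R ->
  (forall x, D x -> exists2 k, A k x & F x <= (c k)%:E * W x) ->
  (forall k, (c k)%:E * \int[m]_(x in A k `&` D) W x <= (M * th ^+ k)%:E) ->
  \int[m]_(x in D) F x <= (M / (1 - th))%:E.
Proof.
move=> mD mW F0 W0 mA c0 /andP[t0 t1] FA cM.
have M0 : (0 <= M)%R.
  have := cM 0%N; rewrite expr0 mulr1 -lee_fin; apply: le_trans.
  by apply: mule_ge0; [rewrite lee_fin|exact: integral_ge0].
pose g k x := (c k)%:E * ((\1_(A k) x)%:E * W x).
have g0 k x : 0 <= g k x by rewrite !mule_ge0// lee_fin.
have mi k : measurable_fun D (fun x => (\1_(A k) x)%:E * W x).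
  by apply: emeasurable_funM => //; apply/measurable_EFinP; exact: measurable_indic.
have mg k : measurable_fun D (g k) by exact: emeasurable_funM.
apply: (@le_trans _ _ (\int[m]_(x in D) \sum_(0 <= k <oo) g k x)).
  apply: ge0_integral_mono => // x Dx; have [k Akx Fk] := FA x Dx.
  apply: (le_trans Fk); apply: le_trans (nneseries_lim_ge k.+1 _); last by [].
  rewrite big_nat_recr//=; apply: le_trans (leeDr _ _); last by rewrite sume_ge0.
  by rewrite /g indicE mem_set// mul1e.
rewrite integral_nneseries//; apply: lime_le.
  by apply: is_cvg_nneseries => k _ _; exact: integral_ge0.
apply: nearW => n; apply: (@le_trans _ _ (\sum_(0 <= k < n) (M * th ^+ k)%:E)).
  apply: lee_sum => k _; rewrite ge0_integralZl//.
  - apply: le_trans (cM k); apply: lee_wpmul2l; first by rewrite lee_fin.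
    rewrite integral_mkcond [leRHS]integral_mkcond; apply: ge0_integral_mono => x _.
      by rewrite patchE; case: ifP => // _; rewrite mule_ge0// lee_fin.
    rewrite !patchE in_setI indicE; case: (x \in D); rewrite ?andbF// andbT.
    by case: (x \in A k); rewrite ?mul1e ?mul0e.
  - by move=> x _; rewrite mule_ge0// lee_fin.
  - by rewrite lee_fin.
rewrite sumEFin lee_fin; apply: geometric_le_lim => //.
by rewrite ger0_norm// ltW.
Qed.

End series_bound.

Section tonelli.
Context d1 d2 (T1 : measurableType d1) (T2 : measurableType d2) {R : realType}.
Variables (m1 : {measure set T1 -> \bar R}) (m2 : {measure set T2 -> \bar R}).
Local Open Scope ereal_scope.

(** mu is an arbitrary measure that is finite only on the sets considered; replacing it by its
    restriction gives the finiteness required by Tonelli. *)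
Lemma finite_measure_on d (T : measurableType d) (m : {measure set T -> \bar R}) (D : set T) :
  measurable D -> m D < +oo -> exists n : {finite_measure set T -> \bar R},
    forall F, \int[m]_(x in D) F x = \int[n]_(x in D) F x.
Proof.
move=> mD fin; have fn : fin_num_fun (mrestr m mD).
  move=> U mU; rewrite ge0_fin_numE// /mrestr; apply: le_lt_trans fin.
  by apply: le_measure; rewrite ?inE//; exact: measurableI.
exists (HB.pack_for {finite_measure set T -> \bar R} (mrestr m mD)
  (Measure_isFinite.Build _ _ _ (mrestr m mD) fn)) => F.
by apply: eq_measure_integral => A mA AD; rewrite /= /mrestr; congr (m _); apply/esym/setIidPl.
Qed.

Lemma measurable_section_integral (D1 : set T1) (D2 : set T2) (f : T1 * T2 -> \bar R) :
  measurable D1 -> measurable D2 -> m2 D2 < +oo ->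
  measurable_fun (D1 `*` D2) f -> (forall z, 0 <= f z) ->
  measurable_fun D1 (fun x => \int[m2]_(y in D2) f (x, y)).
Proof.
move=> mD1 mD2 fin2 mf f0; have [n2 i2] := finite_measure_on mD2 fin2.
pose g := f \_ (D1 `*` D2).
have g0 z : 0 <= g z by rewrite /g patchE; case: ifP.
have mg : measurable_fun setT g by apply/(measurable_restrictT _ (measurableX mD1 mD2)).
apply: (eq_measurable_fun (fun x => \int[n2]_y g (x, y))).
  move=> x xD; rewrite i2.
  by rewrite [RHS]integral_mkcond; apply: eq_integral => y _; rewrite /g !patchE in_setX /= xD.
by apply: measurable_funTS; exact: (@measurable_fun_fubini_tonelli_F _ _ _ _ R n2 g mg g0).
Qed.

Lemma tonelli_finite (D1 : set T1) (D2 : set T2) (f : T1 * T2 -> \bar R) :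
  measurable D1 -> measurable D2 -> m1 D1 < +oo -> m2 D2 < +oo ->
  measurable_fun (D1 `*` D2) f -> (forall z, 0 <= f z) ->
  \int[m1]_(x in D1) \int[m2]_(y in D2) f (x, y) =
  \int[m2]_(y in D2) \int[m1]_(x in D1) f (x, y).
Proof.
move=> mD1 mD2 fin1 fin2 mf f0.
have [n1 i1] := finite_measure_on mD1 fin1; have [n2 i2] := finite_measure_on mD2 fin2.
pose g := f \_ (D1 `*` D2).
have g0 z : 0 <= g z by rewrite /g patchE; case: ifP.
have mg : measurable_fun setT g by apply/(measurable_restrictT _ (measurableX mD1 mD2)).
have e1 : \int[m1]_(x in D1) \int[m2]_(y in D2) f (x, y) = \int[n1]_x \int[n2]_y g (x, y).
  rewrite i1 integral_mkcond; apply: eq_integral => x _; rewrite patchE; case: ifP => xD.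
    rewrite i2 integral_mkcond; apply: eq_integral => y _; rewrite /g !patchE in_setX /=.
    by rewrite xD.
  by rewrite integral0_eq// => y _; rewrite /g patchE in_setX /= xD.
have e2 : \int[m2]_(y in D2) \int[m1]_(x in D1) f (x, y) = \int[n2]_y \int[n1]_x g (x, y).
  rewrite i2 integral_mkcond; apply: eq_integral => y _; rewrite patchE; case: ifP => yD.
    rewrite i1 integral_mkcond; apply: eq_integral => x _; rewrite /g !patchE in_setX /=.
    by rewrite yD andbT.
  by rewrite integral0_eq// => x _; rewrite /g patchE in_setX /= yD andbF.
by rewrite e1 e2; exact: fubini_tonelli.
Qed.

(** Turns a pointwise bound of f by a kernel average of [phi] into a norm bound, given the integral
    of the kernel in its first variable. *)
Lemma schur_tonelli (D1 : set T1) (D2 : set T2) (k : T1 * T2 -> \bar R) (phi psi : T2 -> \bar R) :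
  measurable D1 -> measurable D2 -> m1 D1 < +oo -> m2 D2 < +oo ->
  measurable_fun (D1 `*` D2) k -> (forall z, 0 <= k z) ->
  measurable_fun D2 phi -> (forall y, 0 <= phi y) ->
  (forall y, D2 y -> \int[m1]_(x in D1) k (x, y) <= psi y) ->
  \int[m1]_(x in D1) \int[m2]_(y in D2) (phi y * k (x, y)) <=
  \int[m2]_(y in D2) (phi y * psi y).
Proof.
move=> mD1 mD2 fin1 fin2 mk k0 mphi phi0 H.
pose f (z : T1 * T2) := phi z.2 * k z.
have mf : measurable_fun (D1 `*` D2) f.
  apply: emeasurable_funM => //; apply: (measurable_comp (F := D2)) => //.
    by move=> _ [[x y] [_ /= Dy] <-].
  exact: measurable_funTS.
rewrite (@tonelli_finite D1 D2 f)//; last by move=> z; rewrite mule_ge0.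
apply: ge0_integral_mono.
  by move=> y _; apply: integral_ge0 => x _; rewrite mule_ge0.
move=> y Dy; rewrite /f /= ge0_integralZl//; first by apply: lee_wpmul2l => //; exact: H.
apply: (measurable_comp (F := D1 `*` D2)) => //.
- exact: measurableX.
- by move=> _ [x Dx <-].
- exact: measurable_funTS.
Qed.

End tonelli.

(** * Carleson measures *)

Section dyadic.
Context {R : realType}.

Lemma dyadic_bracket (l u : R) : 0 < u -> u <= l ->
  exists k : nat, l / 2 ^+ k.+1 < u <= l / 2 ^+ k.
Proof.
move=> u0 ul; have l0 := lt_le_trans u0 ul.
have ex : exists k : nat, l / 2 ^+ k.+1 < u.
  exists (Num.truncn (l / u)); rewrite ltr_pdivrMr ?exprn_gt0// mulrC -ltr_pdivrMr//.
  apply: (lt_trans (truncnS_gt _)); rewrite -natrX ltr_nat.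
  exact: ltn_expl.
exists (ex_minn ex); case: ex_minnP => k -> kmin /=.
case: k kmin => [|k] kmin; first by rewrite expr0 divr1.
rewrite leNgt; apply/negP => h; have := kmin _ h.
by rewrite ltnn.
Qed.

End dyadic.

Section carleson.
Context {R : realType} (mu : {measure set (R * R) -> \bar R}) (s : R).

Lemma carleson_measure_bound : carleson_measure s mu ->
  exists2 K : R, 0 <= K & forall I, (mu (carleson_square I) <= (K * arc_length I `^ s)%:E)%E.
Proof.
rewrite /carleson_measure; set S := ereal_sup _ => Sfin.
have ub I : (((arc_length I `^ s)^-1)%:E * mu (carleson_square I) <= S)%E.
  by apply: ereal_sup_ubound; exists I.
have p0 I : 0 < arc_length I `^ s by rewrite powR_gt0// arc_length_gt0.
have S0 : (0 <= S)%E.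
  have h1 : 0 < (1 : R) <= 1 by rewrite lexx ltr01.
  apply: le_trans (ub (closed_arc 0 h1)).
  by rewrite mule_ge0// lee_fin invr_ge0 ltW.
have Sr : S = (fine S)%:E by rewrite fineK// ge0_fin_numE.
exists (fine S); first by rewrite fine_ge0.
by move=> I; have := ub I; rewrite lee_pdivrMl// Sr -EFinM mulrC.
Qed.

Lemma bound_carleson_measure (K : R) :
  (forall I, (mu (carleson_square I) <= (K * arc_length I `^ s)%:E)%E) -> carleson_measure s mu.
Proof.
move=> H; apply: (@le_lt_trans _ _ K%:E); last exact: ltry.
apply: ge_ereal_sup => _ [I _ <-]; rewrite lee_pdivrMl ?powR_gt0 ?arc_length_gt0//.
by rewrite -EFinM mulrC.
Qed.

Variable K : R.
Hypothesis K0 : 0 <= K.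
Hypothesis HK : forall I, (mu (carleson_square I) <= (K * arc_length I `^ s)%:E)%E.

Definition ring_near (d : R) : set (R * R) := [set w | 1 - cabs (cplx w) <= d].

Lemma measurable_ring_near d : measurable (ring_near d).
Proof.
have -> : ring_near d = (fun w => 1 - cabs (cplx w - 0)) @^-1` `]-oo, d].
  by apply/funext => w; rewrite /ring_near /preimage /mkset /= in_itv/= subr0.
rewrite -[X in measurable X]setTI; apply: (measurable_funB (measurable_cst _) (measurable_cabs 0)) => //.
Qed.

(** The part of the square within l/2^k of the circle is covered by 2^k squares of size l/2^k; the
    induction halves the arc. *)
Lemma carleson_level (k : nat) (a l : R) (h : 0 < l <= 1) :
  (mu (ring_near (l / 2 ^+ k) `&` carleson_square (closed_arc a h)) <=
    (2 ^+ k * K * (l / 2 ^+ k) `^ s)%:E)%E.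
Proof.
elim: k a l h => [|k IH] a l h.
  rewrite expr0 mul1r divr1; have := HK (closed_arc a h); rewrite closed_arc_length.
  apply: le_trans; apply: le_measure; rewrite ?inE; last exact: subIsetr.
    by apply: measurableI; [exact: measurable_ring_near|exact: measurable_carleson_square].
  exact: measurable_carleson_square.
have h2 : 0 < l / 2 <= 1 by lra.
have lE : l / 2 ^+ k.+1 = l / 2 / 2 ^+ k by rewrite exprS invfM mulrA.
pose b := a + l / 2 * (2 * pi).
pose S1 := ring_near (l / 2 ^+ k.+1) `&` carleson_square (closed_arc a h2).
pose S2 := ring_near (l / 2 ^+ k.+1) `&` carleson_square (closed_arc b h2).
have mS1 : measurable S1.
  by apply: measurableI; [exact: measurable_ring_near|exact: measurable_carleson_square].
have mS2 : measurable S2.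
  by apply: measurableI; [exact: measurable_ring_near|exact: measurable_carleson_square].
apply: (@le_trans _ _ (mu (S1 `|` S2))).
  apply: le_measure; rewrite ?inE.
  - by apply: measurableI; [exact: measurable_ring_near|exact: measurable_carleson_square].
  - exact: measurableU.
  move=> w [wn /closed_arcP[r [t [/andP[r1 r2] /andP[t1 t2] wE]]]].
  have rl : 1 - l / 2 <= r < 1.
    rewrite r2 andbT; move: wn; rewrite /ring_near /= wE cabsM cabs_eit mulr1 cabs_real.
    rewrite ger0_norm; last by lra.
    have : l / 2 ^+ k.+1 <= l / 2.
      rewrite lE ler_pdivrMr ?exprn_gt0// ler_peMr ?exprn_ege1 ?ler1n//.
      by have /andP[/ltW] := h2.
    lra.
  have [tb|tb] := leP t b.
    by left; split=> //; apply/closed_arcP; exists r, t; split=> //; rewrite t1.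
  right; split=> //; apply/closed_arcP; exists r, t; split=> //; rewrite (ltW tb)/=.
  apply: (le_trans t2); rewrite /b -addrA -mulrDl lerD2l.
  by rewrite (_ : l / 2 + l / 2 = l)//; field.
apply: (@le_trans _ _ (mu S1 + mu S2)); first exact: measureU2.
have := leeD (IH a _ h2) (IH b _ h2); rewrite -lE -EFinD => /le_trans; apply.
rewrite lee_fin; set v := (l / 2 ^+ k.+1) `^ s; rewrite exprS.
by apply: le_of_eq; ring.
Qed.

Lemma carleson_integral (e : R) : 0 < e -> e < s - 1 ->
  exists2 K' : R, 0 <= K' & forall I,
    (\int[mu]_(w in carleson_square I) ((1 - cabs (cplx w)) `^ (- e))%:E <=
      (K' * arc_length I `^ (s - e))%:E)%E.
Proof.
(* Level k has measure at most 2^k K (l/2^k)^s and weight at most (l/2^(k+1))^(-e). Consecutive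
   levels have ratio 2^(e+1-s), below 1 because e < s - 1. *)
move=> e0 es; pose th : R := 2 `^ (e + 1 - s).
have th0 : 0 < th by rewrite powR_gt0.
have th1 : th < 1.
  rewrite /th -(opprB s) powRN invf_lt1 ?powR_gt0//.
  have := @gt0_ltr_powR R (s - (e + 1)) ltac:(lra) 1 2 ltac:(by rewrite nnegrE) ltac:(by rewrite nnegrE).
  by rewrite powR1; apply; rewrite ltr1n.
exists (K * 2 `^ e / (1 - th)).
  by rewrite divr_ge0 ?subr_ge0 ?(ltW th1)// mulr_ge0// powR_ge0.
move=> I; have [a [l [h [lI sub]]]] := carleson_square_closed I.
rewrite -lI; set S := carleson_square (closed_arc a h) in sub.
have mS : measurable S by exact: measurable_carleson_square.
have mF : measurable_fun S (fun w => ((1 - cabs (cplx w)) `^ (- e))%:E).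
  apply/measurable_EFinP; apply: (measurableT_comp (measurable_powR (- e))).
  have := measurable_funB (measurable_cst (1 : R)) (@measurable_cabs R 0).
  move=> /(_ _ _); under eq_fun do rewrite subr0.
  exact: measurable_funTS.
apply: (@le_trans _ _ (\int[mu]_(w in S) ((1 - cabs (cplx w)) `^ (- e))%:E)%E).
  apply: ge0_subset_integral => //; first exact: measurable_carleson_square.
  by move=> w _; rewrite lee_fin powR_ge0.
have l0 : 0 < l by have /andP[] := h.
rewrite (_ : K * 2 `^ e / (1 - th) * l `^ (s - e) = (K * 2 `^ e * l `^ (s - e)) / (1 - th)); last by ring.
apply: (@integral_le_geometric _ _ _ mu S _ (cst 1%E) (fun k => ring_near (l / 2 ^+ k))
   (fun k => (l / 2 ^+ k.+1) `^ (- e))) => //.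
- by move=> w _; rewrite lee_fin powR_ge0.
- by move=> k; exact: measurable_ring_near.
- by move=> k; exact: powR_ge0.
- by rewrite th0.
- move=> w Sw; have := carleson_square_disc Sw; rewrite closed_arc_length => /andP[w1 w2].
  have [k /andP[k1 k2]] := @dyadic_bracket R l (1 - cabs (cplx w)) ltac:(lra) ltac:(lra).
  exists k => //; rewrite mule1 lee_fin !powRN lef_pV2 ?posrE ?powR_gt0 ?divr_gt0 ?exprn_gt0//; last by lra.
  rewrite ge0_ler_powR ?nnegrE ?(ltW e0)// ?divr_ge0 ?exprn_ge0 ?(ltW l0)//; first by lra.
  exact: ltW.
- move=> k; rewrite integral_cst ?mul1e; last by apply: measurableI => //; exact: measurable_ring_near.
  apply: (@le_trans _ _ (((l / 2 ^+ k.+1) `^ (- e))%:E * (2 ^+ k * K * (l / 2 ^+ k) `^ s)%:E)%E).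
    by apply: lee_wpmul2l; [rewrite lee_fin powR_ge0|exact: carleson_level].
  rewrite -EFinM lee_fin; apply: le_of_eq.
  have q0 : 0 < 2 ^+ k :> R by rewrite exprn_gt0.
  pose v := l / 2 ^+ k; have v0 : 0 < v by rewrite divr_gt0.
  have -> : l / 2 ^+ k.+1 = v * 2^-1 by rewrite exprSr invfM mulrA.
  rewrite -/v (_ : l `^ (s - e) = v `^ (s - e) * (2 ^+ k) `^ (s - e)); last first.
    by rewrite -powRM ?(ltW v0) ?(ltW q0)// divfK// gt_eqF.
  have -> : th ^+ k = 2 ^+ k * (2 ^+ k) `^ (- (s - e)).
    rewrite /th -powR_mulrn ?powR_ge0// -powRrM mulrC powRrM powR_mulrn//.
    rewrite (_ : e + 1 - s = 1 + - (s - e)); last by ring.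
    by rewrite powRD ?(gt_eqF q0) ?implybT// powRr1// ltW.
  rewrite powRM ?invr_ge0// ?(ltW v0)// (_ : 2^-1 `^ (- e) = 2 `^ e); last first.
    by rewrite -(powR_inv1 (ltac:(by []) : 0 <= (2 : R))) -powRrM mulrNN mul1r.
  rewrite [in RHS]powRD ?(gt_eqF v0) ?implybT// (powRN (2 ^+ k)).
  have : (2 ^+ k) `^ (s - e) != 0 by rewrite gt_eqF// powR_gt0.
  by move=> ?; field.
Qed.

(** A boundary box with free centre and size, for which kernel supports are easier to place than for
    a Carleson square. *)
Definition dbox (c : C R) (rho : R) : set (R * R) :=
  [set w | [/\ cabs (cplx w) < 1, 1 - cabs (cplx w) <= rho & cabs (cplx w - c) <= rho]].

Lemma measurable_dbox c rho : measurable (dbox c rho).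
Proof.
have -> : dbox c rho = @disc R `&` (ring_near rho `&` (fun w => cabs (cplx w - c)) @^-1` `]-oo, rho]).
  apply/seteqP; split=> w; rewrite /dbox /disc /ring_near /preimage /= in_itv/=.
    by move=> [].
  by move=> [? [? ?]].
apply: measurableI; first exact: measurable_disc.
apply: measurableI; first exact: measurable_ring_near.
by rewrite -[X in measurable X]setTI; exact: measurable_cabs.
Qed.

Lemma carleson_dbox : 0 <= s -> exists2 K' : R, 0 <= K' & forall c rho, 0 < rho ->
  (mu (dbox c rho) <= (K' * rho `^ s)%:E)%E.
Proof.
move=> s0; exists (K * 32 `^ s); first by rewrite mulr_ge0 ?powR_ge0.
move=> c rho rho0; have [I [Il sub]] := box_in_carleson_square c rho0.
apply: (@le_trans _ _ (mu (carleson_square I))).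
  apply: le_measure; rewrite ?inE; [exact: measurable_dbox|exact: measurable_carleson_square|].
  by move=> w [? ? ?]; exact: sub.
apply: (le_trans (HK I)); rewrite lee_fin -mulrA -powRM ?(ltW rho0)//.
apply: ler_wpM2l => //; apply: ge0_ler_powR => //; rewrite nnegrE.
  by rewrite ltW// arc_length_gt0.
by rewrite mulr_ge0// ltW.
Qed.

Lemma carleson_dbox_integral (e : R) : 0 < e -> e < s - 1 ->
  exists2 K' : R, 0 <= K' & forall c rho, 0 < rho ->
    (\int[mu]_(w in dbox c rho) ((1 - cabs (cplx w)) `^ (- e))%:E <= (K' * rho `^ (s - e))%:E)%E.
Proof.
move=> e0 es; have [K' K'0 H] := carleson_integral e0 es.
exists (K' * 32 `^ (s - e)); first by rewrite mulr_ge0 ?powR_ge0.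
move=> c rho rho0; have [I [Il sub]] := box_in_carleson_square c rho0.
apply: (@le_trans _ _ (\int[mu]_(w in carleson_square I) ((1 - cabs (cplx w)) `^ (- e))%:E)%E).
  apply: ge0_subset_integral.
  - exact: measurable_dbox.
  - exact: measurable_carleson_square.
  - apply/measurable_EFinP; apply: (measurableT_comp (measurable_powR (- e))).
    have := measurable_funB (measurable_cst (1 : R)) (@measurable_cabs R 0).
    move=> /(_ _ _); under eq_fun do rewrite subr0.
    exact: measurable_funTS.
  - by move=> w _; rewrite lee_fin powR_ge0.
  by move=> w [? ? ?]; exact: sub.
apply: (le_trans (H I)); rewrite lee_fin -mulrA -powRM ?(ltW rho0)//.
apply: ler_wpM2l => //; apply: ge0_ler_powR; rewrite ?nnegrE//; first by lra.
  by rewrite ltW// arc_length_gt0.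
by rewrite mulr_ge0// ltW.
Qed.

End carleson.

(** * Carleson measures give bounded inclusions *)

Section kernels.
Context {R : realType}.
Local Notation area := (area_measure R).

(** Comparing the extensions by 0 through [ge0_integral_mono] avoids measurability of the sets and
    of [F]. *)
Lemma ge0_subset_mono d (T : measurableType d) (m : {measure set T -> \bar R}) (A B : set T)
    (F : T -> \bar R) : A `<=` B -> (forall x, B x -> 0 <= F x)%E ->
  (\int[m]_(x in A) F x <= \int[m]_(x in B) F x)%E.
Proof.
move=> AB F0; rewrite integral_mkcond [leRHS]integral_mkcond.
apply: ge0_integral_mono => x _; rewrite !patchE; case: ifPn => //.
  by move=> /set_mem /AB /F0.
by move=> /set_mem Ax; rewrite mem_set//; exact: AB.
by move=> _; case: ifPn => // /set_mem /F0.
Qed.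

Lemma area_disc : (area (@disc R) < +oo)%E.
Proof.
apply: (@le_lt_trans _ _ (area (qsquare (0, 0) 1))); last by rewrite area_qsquare// ltry.
apply: le_measure; rewrite ?inE; [exact: measurable_disc|exact: measurable_qsquare|].
move=> w wd; apply/qsquareP; rewrite (_ : cplx (0, 0) = 0 :> C R)// subr0.
by split; apply: ltW; apply: le_lt_trans wd; [exact: Re_le_cabs|exact: Im_le_cabs].
Qed.

Lemma measurable_one_sub_cabs : measurable_fun setT (fun w : R * R => 1 - cabs (cplx w)).
Proof.
have := measurable_funB (measurable_cst (1 : R)) (@measurable_cabs R 0).
by move=> /(_ _ _); under eq_fun do rewrite subr0.
Qed.

Definition near_set (b : (R * R) * (R * R) -> R) : set ((R * R) * (R * R)) :=
  [set z | insquare (b z) (cplx z.2 - cplx z.1)].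

Lemma measurable_near_set b : measurable_fun setT b -> measurable (near_set b).
Proof.
move=> mb.
have m11 : measurable_fun setT (fun z : (R * R) * (R * R) => z.1.1).
  exact: (measurableT_comp (@measurable_fst _ _ _ _) (@measurable_fst _ _ _ _)).
have m12 : measurable_fun setT (fun z : (R * R) * (R * R) => z.1.2).
  exact: (measurableT_comp (@measurable_snd _ _ _ _) (@measurable_fst _ _ _ _)).
have m21 : measurable_fun setT (fun z : (R * R) * (R * R) => z.2.1).
  exact: (measurableT_comp (@measurable_fst _ _ _ _) (@measurable_snd _ _ _ _)).
have m22 : measurable_fun setT (fun z : (R * R) * (R * R) => z.2.2).
  exact: (measurableT_comp (@measurable_snd _ _ _ _) (@measurable_snd _ _ _ _)).
have aux (u v : (R * R) * (R * R) -> R) : measurable_fun setT u -> measurable_fun setT v ->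
    measurable [set z | `|u z - v z| <= b z].
  move=> mu mv.
  have mn : measurable_fun setT (fun z => `|u z - v z|).
    exact: (measurableT_comp (@normr_measurable R setT) (measurable_funB mu mv)).
  have -> : [set z | `|u z - v z| <= b z] = (fun z => b z - `|u z - v z|) @^-1` `[0, +oo[.
    by apply/funext => z; rewrite /preimage /mkset /= in_itv/= andbT subr_ge0.
  by rewrite -[X in measurable X]setTI; exact: (measurable_funB mb mn).
have -> : near_set b = [set z | `|z.2.1 - z.1.1| <= b z] `&` [set z | `|z.2.2 - z.1.2| <= b z].
  by apply/seteqP; split=> z; rewrite /near_set /insquare /mkset cReB cImB.
by apply: measurableI; exact: aux.
Qed.

Lemma powR_compare (r x d : R) : 0 < d -> d / 4 <= x -> x <= 4 * d ->
  x `^ r <= 4 `^ `|r| * d `^ r.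
Proof.
move=> d0 dx xd; have x0 : 0 < x by lra.
have [r0|r0] := leP 0 r.
  by rewrite ger0_norm// -powRM ?(ltW d0)// ge0_ler_powR// nnegrE ?(ltW x0)// mulr_ge0// ltW.
rewrite ltr0_norm//.
have -> : x `^ r = (x `^ (- r))^-1 by rewrite -powRN opprK.
have -> : d `^ r = (d `^ (- r))^-1 by rewrite -powRN opprK.
rewrite ler_pdivlMr ?powR_gt0// mulrC ler_pdivrMr ?powR_gt0//.
rewrite -powRM ?(ltW x0)// ge0_ler_powR ?nnegrE ?oppr_ge0 ?(ltW r0) ?(ltW d0)//; last by lra.
by rewrite mulr_ge0// ltW.
Qed.

Lemma one_sub_sqr_compare (r : R) (w : C R) : cabs w < 1 ->
  (1 - cabs w) `^ r <= 4 `^ `|r| * (1 - cabs w ^+ 2) `^ r /\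
  (1 - cabs w ^+ 2) `^ r <= 4 `^ `|r| * (1 - cabs w) `^ r.
Proof.
move=> w1; have w0 := cabs_ge0 w.
have E : 1 - cabs w ^+ 2 = (1 - cabs w) * (1 + cabs w) by ring.
have h1 : 1 - cabs w <= 1 - cabs w ^+ 2 by rewrite E ler_peMr//; lra.
have h2 : 1 - cabs w ^+ 2 <= 2 * (1 - cabs w) by rewrite E mulrC ler_wpM2r//; lra.
by split; apply: powR_compare; lra.
Qed.

Section finite.
Variables (mu : {measure set (R * R) -> \bar R}) (s K : R).
Hypothesis HK : forall I, (mu (carleson_square I) <= (K * arc_length I `^ s)%:E)%E.

Lemma disc_carleson_square : exists I, @disc R `<=` carleson_square I.
Proof.
have h1 : 0 < (1 : R) <= 1 by rewrite lexx ltr01.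
exists (closed_arc 0 h1) => w wd; apply/closed_arcP.
have [t [tp wE]] := polar (cplx w) pi.
exists (cabs (cplx w)), t; split=> //; first by rewrite subrr cabs_ge0.
by move: tp; rewrite ler_norml; lra.
Qed.

Lemma carleson_disc_lty : (mu (@disc R) < +oo)%E.
Proof.
have [I sub] := disc_carleson_square.
apply: (@le_lt_trans _ _ (mu (carleson_square I))).
  by apply: le_measure; rewrite ?inE//; [exact: measurable_disc|exact: measurable_carleson_square].
by apply: le_lt_trans (HK I) _; exact: ltry.
Qed.
End finite.

End kernels.

(** * Bergman inclusion *)

Section bergman_side.
Context {R : realType} (mu : {measure set (R * R) -> \bar R}) (p q K : R).
Local Notation area := (area_measure R).
Hypothesis K0 : 0 <= K.
Hypothesis HK : forall I, (mu (carleson_square I) <= (K * arc_length I `^ (q + 1))%:E)%E.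
Hypothesis p0 : 0 < p.
Hypothesis q0 : 0 < q.

(** An eighth of the distance to the circle keeps the square inside the disc and 1 - |w| comparable
    to 1 - |z| on it. *)
Definition bergman_radius (z : (R * R) * (R * R)) : R := (1 - cabs (cplx z.1)) / 8.

(** The area mean over the square around z, written as a kernel so that z and w can exchange roles
    under Tonelli. *)
Definition bergman_kernel (K1 : R) (z : (R * R) * (R * R)) : \bar R :=
  (K1 * (1 - cabs (cplx z.1)) `^ (- 2) * \1_(near_set bergman_radius) z)%:E.

Lemma measurable_bergman_radius : measurable_fun setT bergman_radius.
Proof.
apply: measurable_funM; last exact: measurable_cst.
exact: (measurableT_comp measurable_one_sub_cabs (@measurable_fst _ _ _ _)).
Qed.

Lemma measurable_bergman_kernel K1 : measurable_fun setT (bergman_kernel K1).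
Proof.
apply/measurable_EFinP; apply: measurable_funM; last first.
  by apply: measurable_indic; exact: (measurable_near_set measurable_bergman_radius).
apply: measurable_funM; first exact: measurable_cst.
apply: (measurableT_comp (measurable_powR (- 2))).
exact: (measurableT_comp measurable_one_sub_cabs (@measurable_fst _ _ _ _)).
Qed.

Lemma bergman_pointwise f : analytic_disc f -> forall K1 : R, 0 < K1 ->
  (forall (c : R * R) (a : R), 0 < a -> cabs (cplx c) + 2 * a < 1 ->
  ((a ^+ 2 * cabs (f (cplx c)) `^ p)%:E <=
    K1%:E * \int[area]_(w in qsquare c a) (cabs (f (cplx w)) `^ p)%:E)%E) ->
  forall z, @disc R z -> ((cabs (f (cplx z)) `^ p)%:E <=
    \int[area]_(w in @disc R) ((cabs (f (cplx w)) `^ p)%:E * bergman_kernel (64 * K1) (z, w)))%E.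
Proof.
move=> af K1 K10 H z zd; have d0 : 0 < 1 - cabs (cplx z) by rewrite subr_gt0.
set d := 1 - cabs (cplx z) in d0 *.
have a0 : 0 < d / 8 by rewrite divr_gt0.
have za : cabs (cplx z) + 2 * (d / 8) < 1 by rewrite /d in d0 *; lra.
have {H} := H z (d / 8) a0 za.
have cK : 64 * K1 * d `^ (- 2) = K1 / (d / 8) ^+ 2.
  by rewrite powRN powR_mulrn ?(ltW d0)//; field; rewrite gt_eqF.
have sq : qsquare z (d / 8) `<=` @disc R by exact: qsquare_disc.
have mf : measurable_fun (qsquare z (d / 8)) (fun w => (cabs (f (cplx w)) `^ p)%:E).
  apply/measurable_EFinP; apply: (measurableT_comp (measurable_powR p)).
  apply: measurable_funS (ccont_disc_measurable (analytic_ccont af)) => //.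
  exact: measurable_disc.
have mQ := measurable_qsquare z (d / 8).
move=> H; apply: (@le_trans _ _ ((K1 / (d / 8) ^+ 2)%:E *
    \int[area]_(w in qsquare z (d / 8)) (cabs (f (cplx w)) `^ p)%:E)%E).
  have a2 : 0 < ((d / 8) ^+ 2)^-1 by rewrite invr_gt0 exprn_gt0.
  have := lee_wpmul2l (ltac:(by rewrite lee_fin ltW) : (0 <= (((d / 8) ^+ 2)^-1)%:E)%E) H.
  rewrite muleA -!EFinM mulrA mulVf ?mul1r; last by rewrite gt_eqF// exprn_gt0.
  by rewrite (mulrC K1).
rewrite -ge0_integralZl//; last 2 first.
- by move=> w _; rewrite lee_fin powR_ge0.
- by rewrite lee_fin divr_ge0 ?(ltW K10)// exprn_ge0// ltW.
apply: (@le_trans _ _ (\int[area]_(w in qsquare z (d / 8))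
    ((cabs (f (cplx w)) `^ p)%:E * bergman_kernel (64 * K1) (z, w)))%E).
  apply: ge0_integral_mono => w Qw.
    rewrite mule_ge0// lee_fin ?powR_ge0//.
    by rewrite divr_ge0 ?(ltW K10)// exprn_ge0// ltW.
  rewrite muleC /bergman_kernel /= indicE mem_set ?mulr1 -/d ?cK//.
  by rewrite /near_set /bergman_radius /=; apply/qsquareP.
apply: ge0_subset_mono => // w _; rewrite mule_ge0// lee_fin ?powR_ge0//.
by rewrite !mulr_ge0 ?powR_ge0// ltW.
Qed.

(** For fixed w with u = 1 - |w|, the kernel is of order u^(-2) and lives on z in a box of size 2 u
    around w, of mu-measure at most C u^(q+1). The product is u^(q-1), the Bergman weight. *)
Lemma bergman_kernel_carleson K1 : 0 <= K1 -> exists2 C : R, 0 <= C & forall w, @disc R w ->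
  (\int[mu]_(z in @disc R) bergman_kernel K1 (z, w) <=
     (C * (1 - cabs (cplx w) ^+ 2) `^ (q - 1))%:E)%E.
Proof.
have q1 : 0 <= q + 1 by rewrite addr_ge0// ltW.
move=> K10; have [K' K'0 H] := carleson_dbox K0 HK q1.
exists (K1 * 4 `^ 2 * K' * 2 `^ (q + 1) * 4 `^ `|q - 1|).
  by rewrite !mulr_ge0 ?powR_ge0.
move=> w wd; have u0 : 0 < 1 - cabs (cplx w) by rewrite subr_gt0.
set u := 1 - cabs (cplx w) in u0.
have mB := measurable_dbox (cplx w) (2 * u).
have md := @measurable_disc R.
apply: (@le_trans _ _ (\int[mu]_(z in @disc R)
   ((K1 * (4 `^ 2 * u `^ (- 2)))%:E * (\1_(dbox (cplx w) (2 * u)) z)%:E))%E).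
  apply: ge0_integral_mono => z zd.
    by rewrite lee_fin !mulr_ge0 ?powR_ge0.
  rewrite /bergman_kernel /= -EFinM lee_fin !indicE.
  have [/set_mem/insquare_cabs zw|_] := boolP ((z, w) \in near_set _); last first.
    by rewrite mulr0 !mulr_ge0 ?powR_ge0.
  rewrite /bergman_radius /= in zw.
  have zd0 : 0 < 1 - cabs (cplx z) by rewrite subr_gt0.
  have h1 := cabs_tri (cplx z) (cplx w); have h2 := cabs_tri (cplx w) (cplx z).
  rewrite (cabsC (cplx z)) in h1.
  rewrite mem_set ?mulr1; last first.
    by split=> //; rewrite /u in u0 *; [lra|rewrite cabsC; lra].
  apply: ler_wpM2l => //.
  have := @powR_compare R (- 2) (1 - cabs (cplx z)) u u0.
  by rewrite normrN ger0_norm//; apply; rewrite /u; lra.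
rewrite ge0_integralZl//; last 2 first.
- by apply/measurable_EFinP; exact: measurable_indic.
- by rewrite lee_fin !mulr_ge0 ?powR_ge0.
rewrite integral_indic//.
apply: (@le_trans _ _ ((K1 * (4 `^ 2 * u `^ (- 2)))%:E * (K' * (2 * u) `^ (q + 1))%:E)%E).
  apply: lee_wpmul2l; first by rewrite lee_fin !mulr_ge0 ?powR_ge0.
  apply: le_trans (H (cplx w) (2 * u) _); last by rewrite mulr_gt0.
  by apply: le_measure; rewrite ?inE//; exact: measurableI.
rewrite -EFinM lee_fin.
have [h _] := one_sub_sqr_compare (q - 1) wd; rewrite -/u in h.
have uE : u `^ (- 2) * u `^ (q + 1) = u `^ (q - 1).
  by rewrite -powRD ?(gt_eqF u0) ?implybT//; congr (_ `^ _); ring.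
rewrite powRM ?(ltW u0)//.
rewrite [leLHS](_ : _ = K1 * 4 `^ 2 * K' * 2 `^ (q + 1) * (u `^ (- 2) * u `^ (q + 1))); last by ring.
by rewrite uE -[leRHS]mulrA ler_wpM2l// !mulr_ge0 ?powR_ge0.
Qed.

Lemma carleson_bergman : exists2 C : R, 0 <= C & forall f, analytic_disc f ->
  (\int[mu]_(z in @disc R) (cabs (f (cplx z)) `^ p)%:E <=
   C%:E * \int[area]_(w in @disc R) (cabs (f (cplx w)) `^ p * (1 - cabs (cplx w) ^+ 2) `^ (q - 1))%:E)%E.
Proof.
have [K1 K10 mvK] := @area_mv_pow R p p0.
have [C C0 HC] := bergman_kernel_carleson (ltac:(by rewrite mulr_ge0// ltW) : 0 <= 64 * K1).
exists C => // f af.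
have mv := mvK f (analytic_ccont af) (analytic_area_mv af).
have md := @measurable_disc R.
have mfd : measurable_fun (@disc R) (fun w => (cabs (f (cplx w)) `^ p)%:E).
  apply/measurable_EFinP; apply: (measurableT_comp (measurable_powR p)).
  exact: ccont_disc_measurable (analytic_ccont af).
apply: (@le_trans _ _ (\int[mu]_(z in @disc R) \int[area]_(w in @disc R)
   ((cabs (f (cplx w)) `^ p)%:E * bergman_kernel (64 * K1) (z, w)))%E).
  apply: ge0_integral_mono => z zd; first by rewrite lee_fin powR_ge0.
  exact: bergman_pointwise.
apply: (@le_trans _ _ (\int[area]_(w in @disc R) ((cabs (f (cplx w)) `^ p)%:E *
   (C * (1 - cabs (cplx w) ^+ 2) `^ (q - 1))%:E))%E).
  apply: schur_tonelli => //.
  - exact: carleson_disc_lty HK.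
  - exact: area_disc.
  - apply: measurable_funTS; exact: measurable_bergman_kernel.
  - by move=> z; rewrite lee_fin !mulr_ge0 ?powR_ge0// ltW.
  - by move=> y; rewrite lee_fin powR_ge0.
rewrite -ge0_integralZl//.
- apply: ge0_integral_mono => w wd; first by rewrite mule_ge0// lee_fin ?mulr_ge0 ?powR_ge0.
  by rewrite -!EFinM lee_fin mulrCA.
- apply/measurable_EFinP; apply: measurable_funM; first exact/measurable_EFinP.
  apply: (measurableT_comp (measurable_powR (q - 1))).
  apply: measurable_funB; first exact: measurable_cst.
  apply: measurable_funX; exact: ccont_disc_measurable (fun z _ => ccont_id z).
- by move=> w _; rewrite lee_fin mulr_ge0 ?powR_ge0.
Qed.

End bergman_side.

(** * Radial integration and the tent inclusion *)

Section radial.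
Context {R : realType}.

Lemma MVT_monotone (g g' : R -> R) : {in `[0, 1], forall x : R, is_derive x 1 g (g' x)} ->
  {in `[0, 1], forall x, 0 <= g' x} -> g 0 <= g 1.
Proof.
move=> dg g0.
have [||x xin] := @MVT_segment R g g' 0 1 ler01.
- by move=> x /subset_itv_oo_cc; exact: dg.
- apply: continuous_in_subspaceT => x /set_mem /dg dgx.
  by apply/differentiable_continuous/derivable1_diffP; exact: ex_derive.
by rewrite subr0 mulr1 => h; rewrite -subr_ge0 h g0.
Qed.

Lemma MVT_dominated (g g' B B' : R -> R) :
  {in `[0, 1], forall x : R, is_derive x 1 g (g' x)} ->
  {in `[0, 1], forall x : R, is_derive x 1 B (B' x)} ->
  {in `[0, 1], forall x, `|g' x| <= B' x} -> `|g 1 - g 0| <= B 1 - B 0.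
Proof.
move=> dg dB gB.
have h1 : (B - g) 0 <= (B - g) 1.
  apply: (@MVT_monotone _ (fun x => B' x - g' x)) => x xin.
    by apply: is_deriveB; [exact: dB|exact: dg].
  by have := gB x xin; rewrite ler_norml subr_ge0 => /andP[].
have h2 : (B + g) 0 <= (B + g) 1.
  apply: (@MVT_monotone _ (fun x => B' x + g' x)) => x xin.
    by apply: is_deriveD; [exact: dB|exact: dg].
  by have := gB x xin; rewrite ler_norml => /andP[? _]; lra.
move: h1 h2; rewrite !fctE => h1 h2; rewrite ler_norml; lra.
Qed.

Lemma is_derive_power_radius (b m x : R) : 0 < 1 - x * m ->
  is_derive x 1 (fun x : R => (1 - x * m) `^ (- b)) (b * m * (1 - x * m) `^ (- b - 1)).
Proof.
move=> h.
have d1 : is_derive x 1 (fun x : R => 1 - x * m) (- m).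
  apply: is_derive_eps => e e0; exists 1 => // k _.
  rewrite (_ : _ - _ = 0); last by ring.
  by rewrite normr0 mulr_ge0// ltW.
have := @is_derive1_comp R (fun y : R => y `^ (- b)) (fun x : R => 1 - x * m) x _ _
  (@is_derive1_powR R (- b) (1 - x * m) h) d1.
by rewrite (_ : _ * - m = b * m * (1 - x * m) `^ (- b - 1)); last by ring.
Qed.

(** [B] is a primitive of the bound on the derivative along the radius. Real and imaginary parts are
    estimated separately, hence the factor 2. *)
Lemma radial_bound (f : C R -> C R) (z : C R) (G b : R) : analytic_disc f -> cabs z < 1 ->
  0 < b -> 0 <= G ->
  (forall x, 0 <= x <= 1 -> cabs (derive1 f (x%:C * z)) <= G * (1 - x * cabs z) `^ (- b - 1)) ->
  cabs (f z) <= cabs (f 0) + 2 * (G / b * (1 - cabs z) `^ (- b)).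
Proof.
move=> af z1 b0 G0 H; set m := cabs z in z1 H *.
have m0 : 0 <= m by exact: cabs_ge0.
pose B x := G / b * (1 - x * m) `^ (- b).
pose B' x := G / b * (b * m * (1 - x * m) `^ (- b - 1)).
have pos x : x \in `[0, 1] -> 0 < 1 - x * m.
  by rewrite in_itv/= => /andP[x0 x1]; rewrite subr_gt0; apply: le_lt_trans z1; rewrite ler_piMl.
have dB : {in `[0, 1], forall x : R, is_derive x 1 B (B' x)}.
  move=> x /pos xm; have := is_deriveZ (G / b) (@is_derive_power_radius b m x xm).
  by [].
have xz x : x \in `[0, 1] -> cabs (x%:C * z) < 1.
  rewrite in_itv/= => /andP[x0 x1]; rewrite cabsM cabs_real ger0_norm// -/m.
  by apply: le_lt_trans z1; rewrite ler_piMl.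
have bound x : x \in `[0, 1] -> cabs (derive1 f (x%:C * z) * z) <= B' x.
  move=> xi; rewrite cabsM -/m /B' mulrA mulrA divfK ?gt_eqF// mulrAC -mulrA.
  by rewrite mulrA ler_wpM2r// H//; move: xi; rewrite in_itv.
have line x : 0 + x%:C * z = x%:C * z :> C R by rewrite add0r.
have dd x : x \in `[0, 1] -> cdiff f (0 + x%:C * z) (derive1 f (x%:C * z)).
  by move=> xi; rewrite line; apply: analytic_cdiff => //; exact: xz.
have hRe := @MVT_dominated (fun t : R => complex.Re (f (0 + t%:C * z)))
  (fun t : R => complex.Re (derive1 f (t%:C * z) * z)) B B'.
have hIm := @MVT_dominated (fun t : R => complex.Im (f (0 + t%:C * z)))
  (fun t : R => complex.Im (derive1 f (t%:C * z) * z)) B B'.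
have {}hRe : `|complex.Re (f z) - complex.Re (f 0)| <= B 1 - B 0.
  have := hRe; rewrite !line rmorph1 rmorph0 mul1r mul0r; apply => // x xi.
    exact: is_derive_Re_line (dd x xi).
  by apply: (le_trans (Re_le_cabs _)); exact: bound.
have {}hIm : `|complex.Im (f z) - complex.Im (f 0)| <= B 1 - B 0.
  have := hIm; rewrite !line rmorph1 rmorph0 mul1r mul0r; apply => // x xi.
    exact: is_derive_Im_line (dd x xi).
  by apply: (le_trans (Im_le_cabs _)); exact: bound.
have B0 : 0 <= B 0 by rewrite mulr_ge0 ?powR_ge0// divr_ge0// ltW.
apply: (le_trans (cabs_tri _ (f 0))); rewrite lerD2l.
apply: (le_trans (cabs_le_ReIm _)); rewrite cReB cImB.
by move: hRe hIm B0; rewrite /B mul1r; lra.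
Qed.

End radial.

Section tent_side.
Context {R : realType} (mu : {measure set (R * R) -> \bar R}) (p q K e : R).
Local Notation area := (area_measure R).
Hypothesis K0 : 0 <= K.
Hypothesis HK : forall I, (mu (carleson_square I) <= (K * arc_length I `^ (q + 1))%:E)%E.
Hypothesis p0 : 0 < p.
Hypothesis e0 : 0 < e.
Hypothesis eq : e < q.
Hypothesis e1 : e <= 1.

(** Proportional to 1 - |w|, unlike [bergman_radius]: for fixed z the admissible w form a cone that
    contains squares around every point of the radius to z. *)
Definition tent_radius (z : (R * R) * (R * R)) : R := 3 * (1 - cabs (cplx z.2)).

(* The factor ((1 - |w|) / (1 - |z|))^e, with e < q, makes both the radial
   integration and the integration against mu converge. *)
Definition tent_kernel (z : (R * R) * (R * R)) : \bar R :=
  ((1 - cabs (cplx z.2)) `^ (e - 1) * (1 - cabs (cplx z.1)) `^ (- e) *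
    \1_(near_set tent_radius) z)%:E.

Lemma tent_kernel_ge0 z : (0 <= tent_kernel z)%E.
Proof. by rewrite lee_fin !mulr_ge0 ?powR_ge0. Qed.

Lemma measurable_tent_radius : measurable_fun setT tent_radius.
Proof.
apply: measurable_funM; first exact: measurable_cst.
exact: (measurableT_comp measurable_one_sub_cabs (@measurable_snd _ _ _ _)).
Qed.

Lemma measurable_tent_kernel : measurable_fun setT tent_kernel.
Proof.
apply/measurable_EFinP; apply: measurable_funM; last first.
  by apply: measurable_indic; exact: (measurable_near_set measurable_tent_radius).
apply: measurable_funM.
  apply: (measurableT_comp (measurable_powR (e - 1))).
  exact: (measurableT_comp measurable_one_sub_cabs (@measurable_snd _ _ _ _)).
apply: (measurableT_comp (measurable_powR (- e))).
exact: (measurableT_comp measurable_one_sub_cabs (@measurable_fst _ _ _ _)).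
Qed.

(** The z that count lie in a box of size of order rho = min(|I|, u), so the integral of (1 -
    |z|)^(-e) is at most C rho^(q+1-e) <= C |I|^q u^(1-e), where e <= 1 and q >= 0 are used. The
    factor u^(e-1) cancels. *)
Lemma tent_kernel_carleson : exists2 C : R, 0 <= C & forall I w, @disc R w ->
  (\int[mu]_(z in carleson_square I) tent_kernel (z, w) <= (C * arc_length I `^ q)%:E)%E.
Proof.
have es : e < q + 1 - 1 by rewrite addrK.
have [K' K'0 H] := carleson_dbox_integral K0 HK e0 es.
exists (K' * 9 `^ (q + 1 - e)); first by rewrite mulr_ge0 ?powR_ge0.
move=> I w wd; have u0 : 0 < 1 - cabs (cplx w) by rewrite subr_gt0.
set u := 1 - cabs (cplx w) in u0.
have h0 := arc_length_gt0 I; set h := arc_length I in h0 *.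
(* If u <= |I| the cone condition puts z within 6 u of w; otherwise all of S(I) lies within 9 |I| of
   the endpoint. *)
pose rho := Num.min h u; have rho0 : 0 < rho by rewrite lt_min h0.
pose c : C R := if u <= h then cplx w else eit (arc_start I).
have mS := measurable_carleson_square I.
have mB := measurable_dbox c (9 * rho).
have sub z : carleson_square I z -> near_set tent_radius (z, w) -> dbox c (9 * rho) z.
  move=> Sz /insquare_cabs; rewrite /tent_radius /= -/u => zw.
  have /andP[z1 z2] := carleson_square_disc Sz; have zs := carleson_square_near Sz.
  rewrite -/h in z1 zs; have z3 := cabs_tri (cplx w) (cplx z).
  rewrite /c /rho; have [uh|hu] := leP u h; split=> //.
  - by rewrite /u in zw *; lra.
  - by rewrite cabsC; lra.
  - by lra.
apply: (@le_trans _ _ (\int[mu]_(z in dbox c (9 * rho))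
    ((u `^ (e - 1))%:E * ((1 - cabs (cplx z)) `^ (- e))%:E))%E).
  rewrite integral_mkcond [leRHS]integral_mkcond; apply: ge0_integral_mono => z _.
    by rewrite patchE; case: ifP => // _; exact: tent_kernel_ge0.
  rewrite !patchE; have [/set_mem Sz|_] := boolP (z \in carleson_square I); last first.
    by case: ifP => // _; rewrite mule_ge0// lee_fin powR_ge0.
  rewrite /tent_kernel /= -/u indicE.
  have [/set_mem nz|_] := boolP ((z, w) \in near_set _); last first.
    by rewrite mulr0; case: ifP => // _; rewrite mule_ge0// lee_fin powR_ge0.
  by rewrite mem_set ?mulr1 ?EFinM//; exact: sub.
rewrite ge0_integralZl//; last 3 first.
- apply/measurable_EFinP; apply: measurable_funTS.
  exact: (measurableT_comp (measurable_powR (- e)) measurable_one_sub_cabs).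
- by move=> z _; rewrite lee_fin powR_ge0.
- by rewrite lee_fin powR_ge0.
have rho9 : 0 < 9 * rho by rewrite mulr_gt0.
apply: (le_trans (lee_wpmul2l (ltac:(by rewrite lee_fin powR_ge0) : (0 <= (u `^ (e - 1))%:E)%E) (H c (9 * rho) rho9))).
rewrite -EFinM lee_fin.
rewrite powRM ?(ltW rho0)//.
have r1 : rho `^ (q + 1 - e) <= h `^ q * u `^ (1 - e).
  rewrite (_ : q + 1 - e = q + (1 - e)); last by ring.
  rewrite powRD ?(gt_eqF rho0) ?implybT//.
  have q0 : 0 <= q by rewrite ltW// (lt_trans e0).
  apply: ler_pM; rewrite ?powR_ge0//.
    by apply: ge0_ler_powR => //; rewrite ?nnegrE ?(ltW rho0) ?(ltW h0)// ge_min lexx.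
  apply: ge0_ler_powR; rewrite ?subr_ge0 ?nnegrE ?(ltW rho0) ?(ltW u0)//.
  by rewrite ge_min lexx orbT.
have uu : u `^ (e - 1) * u `^ (1 - e) = 1.
  by rewrite -powRD ?(gt_eqF u0) ?implybT// (_ : _ + _ = 0) ?powRr0//; ring.
apply: (@le_trans _ _ (u `^ (e - 1) * (K' * (9 `^ (q + 1 - e) * (h `^ q * u `^ (1 - e)))))).
  by apply: ler_wpM2l; [exact: powR_ge0|apply: ler_wpM2l => //; apply: ler_wpM2l; rewrite ?powR_ge0].
apply: le_of_eq.
by rewrite -[RHS]mulr1 -[X in _ = _ * X]uu; ring.
Qed.

Definition dirichlet_density (f : C R -> C R) (w : R * R) : R :=
  cabs (derive1 f (cplx w)) `^ p * (1 - cabs (cplx w) ^+ 2) `^ (p - 1).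

Lemma dirichlet_density_ge0 f (w : R * R) : 0 <= dirichlet_density f w.
Proof. by rewrite mulr_ge0 ?powR_ge0. Qed.

Lemma measurable_dirichlet_density f : analytic_disc f ->
  measurable_fun (@disc R) (fun w : R * R => dirichlet_density f w).
Proof.
move=> af; have md := @measurable_disc R; apply: measurable_funM.
  apply: (measurableT_comp (measurable_powR p)).
  exact: ccont_disc_measurable (derive_ccont af).
apply: (measurableT_comp (measurable_powR (p - 1))).
apply: measurable_funB; first exact: measurable_cst.
by apply: measurable_funX; exact: ccont_disc_measurable (fun z _ => ccont_id z).
Qed.

Definition tent_mean (f : C R -> C R) (z : R * R) : \bar R :=
  (\int[area]_(w in @disc R) ((dirichlet_density f w)%:E * tent_kernel (z, w)))%E.

(** The area mean value inequality at xz on a square of half-side d/8, d = 1 - x|z|, which lies in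
    the cone at z. Restoring density and kernel costs d^(1-p) d^(1-e) (1 - |z|)^e, and the area
    normalisation d^(-2). *)
Lemma derivative_tent_mean : exists2 C : R, 0 < C & forall f, analytic_disc f ->
  forall (z : R * R) (x : R), @disc R z -> 0 <= x <= 1 ->
  ((cabs (derive1 f (x%:C * cplx z)) `^ p)%:E <=
    (C * (1 - x * cabs (cplx z)) `^ (- p - e) * (1 - cabs (cplx z)) `^ e)%:E * tent_mean f z)%E.
Proof.
have [K1 K10 mvK] := @area_mv_pow R p p0.
exists (64 * K1 * 4 `^ `|1 - p| * 4 `^ `|1 - e|).
  by rewrite !mulr_gt0// powR_gt0.
move=> f af z x zd /andP[x0 x1].
have mv := mvK _ (derive_ccont af) (derive_area_mv af).
pose xi : R * R := (x * z.1, x * z.2).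
have xiE : cplx xi = x%:C * cplx z.
  by rewrite /xi /cplx; apply/eqP; rewrite eq_complex /=; apply/andP; split; apply/eqP; ring.
have mz : 0 <= cabs (cplx z) by exact: cabs_ge0.
have cxi : cabs (cplx xi) = x * cabs (cplx z) by rewrite xiE cabsM cabs_real ger0_norm.
rewrite -xiE -cxi; set d := 1 - cabs (cplx xi).
have xz : x * cabs (cplx z) <= cabs (cplx z) by rewrite ler_piMl.
have d0 : 0 < d by rewrite /d cxi subr_gt0; exact: le_lt_trans zd.
have zd0 : 0 < 1 - cabs (cplx z) by rewrite subr_gt0.
have a0 : 0 < d / 8 by rewrite divr_gt0.
have za : cabs (cplx xi) + 2 * (d / 8) < 1 by rewrite /d in d0 *; lra.
have sq : qsquare xi (d / 8) `<=` @disc R by exact: qsquare_disc.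
have := mv xi (d / 8) a0 za.
(* [M] bounds the reciprocal of the density weight times the kernel on the square, where 1 - |w| and
   1 - |w|^2 lie between d/4 and 4 d. *)
pose M := 4 `^ `|1 - p| * 4 `^ `|1 - e| * (d `^ (1 - p) * d `^ (1 - e)) * (1 - cabs (cplx z)) `^ e.
have M0 : 0 <= M by rewrite !mulr_ge0 ?powR_ge0.
have dens0 w : 0 <= dirichlet_density f w by exact: dirichlet_density_ge0.
have md := @measurable_disc R.
have mdens : measurable_fun (@disc R) (fun w => (dirichlet_density f w)%:E).
  by apply/measurable_EFinP; exact: measurable_dirichlet_density.
have key : (\int[area]_(w in qsquare xi (d / 8)) (cabs (derive1 f (cplx w)) `^ p)%:E <=
    M%:E * tent_mean f z)%E.
  rewrite /tent_mean -ge0_integralZl//; last 2 first.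
  - apply: emeasurable_funM => //; apply: measurable_funTS.
    exact: (measurable_fun_pair2 z measurable_tent_kernel).
  - by move=> w _; apply: mule_ge0; [rewrite lee_fin; exact: dens0|exact: tent_kernel_ge0].
  apply: (@le_trans _ _ (\int[area]_(w in qsquare xi (d / 8))
     (M%:E * ((dirichlet_density f w)%:E * tent_kernel (z, w))))%E); last first.
    apply: ge0_subset_mono => // w _; apply: mule_ge0; first by rewrite lee_fin.
    by apply: mule_ge0; [rewrite lee_fin; exact: dens0|exact: tent_kernel_ge0].
  apply: ge0_integral_mono => w Qw; first by rewrite lee_fin powR_ge0.
  have wd : cabs (cplx w) < 1 by exact: sq.
  have /qsquareP/insquare_cabs wxi := Qw.
  have t1 := cabs_tri (cplx w) (cplx xi); have t2 := cabs_tri (cplx xi) (cplx w).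
  rewrite cabsC in t2.
  have t3 : cabs (cplx w - cplx z) <= 2 * (d / 8) + (1 - x) * cabs (cplx z).
    rewrite (_ : cplx w - cplx z = (cplx w - cplx xi) + (cplx xi - cplx z)); last by ring.
    apply: (le_trans (cabsD _ _)); apply: lerD => //.
    rewrite xiE (_ : _ - _ = (x - 1)%:C * cplx z); last by rewrite rmorphB rmorph1; ring.
    by rewrite cabsM cabs_real ler0_norm ?opprB//; lra.
  have ud : (1 - cabs (cplx w)) <= 4 * d by rewrite /d in wxi *; lra.
  have du : d * (3 / 4) <= (1 - cabs (cplx w)) by rewrite /d in wxi *; lra.
  (* |w - z| <= d/4 + (1 - x)|z| <= 5 d/4, whereas 3 (1 - |w|) >= 9 d/4. *)
  have nw : near_set tent_radius (z, w).
    have : cabs (cplx w - cplx z) <= 3 * (1 - cabs (cplx w)).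
      by apply: (le_trans t3); rewrite /d cxi in du wxi d0 *; lra.
    rewrite /near_set /tent_radius /=; split.
      by apply: le_trans (Re_le_cabs _) _.
    by apply: le_trans (Im_le_cabs _) _.
  rewrite /tent_kernel /= indicE mem_set// mulr1 -!EFinM lee_fin.
  have u0 : 0 < 1 - cabs (cplx w) by rewrite subr_gt0.
  have w2 : 0 < 1 - cabs (cplx w) ^+ 2.
    by rewrite subr_gt0 exprn_ilt1// cabs_ge0.
  have w2d : 1 - cabs (cplx w) ^+ 2 <= 4 * d /\ d / 4 <= 1 - cabs (cplx w) ^+ 2.
    have w0 := cabs_ge0 (cplx w).
    have E : 1 - cabs (cplx w) ^+ 2 = (1 - cabs (cplx w)) * (1 + cabs (cplx w)) by ring.
    have ? : 1 - cabs (cplx w) <= 1 - cabs (cplx w) ^+ 2 by rewrite E ler_peMr//; lra.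
    have ? : 1 - cabs (cplx w) ^+ 2 <= 2 * (1 - cabs (cplx w)) by rewrite E mulrC ler_wpM2r//; lra.
    have ud' : (1 - cabs (cplx w)) <= 2 * d by rewrite /d in wxi *; lra.
    by split; lra.
  have c1 := @powR_compare R (1 - p) (1 - cabs (cplx w) ^+ 2) d d0 w2d.2 w2d.1.
  have c2 := @powR_compare R (1 - e) (1 - cabs (cplx w)) d d0 ltac:(lra) ltac:(lra).
  rewrite /dirichlet_density; set F := cabs (derive1 f _) `^ p.
  have F0 : 0 <= F by exact: powR_ge0.
  (* Each weight is paired with its reciprocal power, which reduces the comparison to [c1] and
     [c2]. *)
  have i1 : (1 - cabs (cplx w) ^+ 2) `^ (1 - p) * (1 - cabs (cplx w) ^+ 2) `^ (p - 1) = 1.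
    by rewrite -powRD ?(gt_eqF w2) ?implybT// (_ : 1 - p + (p - 1) = 0) ?powRr0//; ring.
  have i2 : (1 - cabs (cplx w)) `^ (1 - e) * (1 - cabs (cplx w)) `^ (e - 1) = 1.
    by rewrite -powRD ?(gt_eqF u0) ?implybT// (_ : 1 - e + (e - 1) = 0) ?powRr0//; ring.
  have i3 : (1 - cabs (cplx z)) `^ e * (1 - cabs (cplx z)) `^ (- e) = 1.
    by rewrite -powRD ?(gt_eqF zd0) ?implybT// subrr powRr0.
  rewrite /M; move: i1 i2 i3 c1 c2.
  have T0 := powR_ge0 (1 - cabs (cplx w) ^+ 2) (p - 1).
  have T1 := powR_ge0 (1 - cabs (cplx w)) (e - 1).
  have T2 := powR_ge0 (1 - cabs (cplx z)) e.
  have T3 := powR_ge0 (1 - cabs (cplx z)) (- e).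
  have T4 := powR_ge0 (1 - cabs (cplx w) ^+ 2) (1 - p).
  have T5 := powR_ge0 (1 - cabs (cplx w)) (1 - e).
  move: F0 T0 T1 T2 T3 T4 T5; move: (_ `^ (1 - p)) (_ `^ (p - 1)) (_ `^ (1 - e)) (_ `^ (e - 1)).
  move: ((1 - cabs (cplx z)) `^ e) ((1 - cabs (cplx z)) `^ (- e)).
  move: (d `^ (1 - p)) (d `^ (1 - e)) (4 `^ `|1 - p|) (4 `^ `|1 - e|).
  clearbody F; clear; move=> dp de Mp Me Z Z' A A' B B' F0 A'0 B'0 Z0 Z'0 A0 B0 i1 i2 i3 c1 c2.
  rewrite [leLHS](_ : _ = A * B * (F * A' * B' * Z * Z')); last first.
    transitivity (F * (A * A') * (B * B') * (Z * Z')); last by ring.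
    by rewrite i1 i2 i3 !mulr1.
  rewrite [leRHS](_ : _ = Mp * dp * (Me * de) * (F * A' * B' * Z * Z')); last by ring.
  by apply: ler_wpM2r; [rewrite !mulr_ge0|apply: ler_pM].
move=> /le_trans /(_ (lee_wpmul2l (ltac:(by rewrite lee_fin ltW) : (0 <= K1%:E)%E) key)) {}key.
have a2 : 0 < ((d / 8) ^+ 2)^-1 by rewrite invr_gt0 exprn_gt0.
have := lee_wpmul2l (ltac:(by rewrite lee_fin ltW) : (0 <= (((d / 8) ^+ 2)^-1)%:E)%E) key.
rewrite -EFinM mulrA mulVf ?mul1r; last by rewrite gt_eqF// exprn_gt0.
move=> /le_trans; apply; rewrite !muleA -!EFinM.
apply: le_of_eq; congr (_%:E * _)%E.
have -> : d `^ (- p - e) = d `^ (1 - p) * d `^ (1 - e) * (d ^+ 2)^-1.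
  rewrite -powR_mulrn ?(ltW d0)// -powRN -!powRD ?(gt_eqF d0) ?implybT//.
  by congr (_ `^ _); ring.
by rewrite /M; field; rewrite gt_eqF.
Qed.

End tent_side.

Section tent_inclusion.
Context {R : realType} (p e : R).
Local Notation area := (area_measure R).
Hypothesis p0 : 0 < p.
Hypothesis e0 : 0 < e.

Lemma powRD_le (a b : R) : 0 <= a -> 0 <= b -> (a + b) `^ p <= 2 `^ p * (a `^ p + b `^ p).
Proof.
move=> a0 b0; have pp := ltW p0.
wlog ab : a b a0 b0 / a <= b.
  by move=> H; have [/H|/ltW /H] := leP a b; [exact|rewrite addrC [X in _ * X]addrC; exact].
apply: (@le_trans _ _ ((2 * b) `^ p)).
  by apply: ge0_ler_powR => //; rewrite ?nnegrE ?addr_ge0 ?mulr_ge0//; lra.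
by rewrite powRM// ler_wpM2l ?powR_ge0// lerDr powR_ge0.
Qed.

Lemma tent_mean_ge0 f (z : R * R) : (0 <= tent_mean p e f z)%E.
Proof.
apply: integral_ge0 => w _; apply: mule_ge0; last exact: tent_kernel_ge0.
by rewrite lee_fin dirichlet_density_ge0.
Qed.

(** The p-th root of the derivative bound is integrated along the radius by [radial_bound], and the
    result is raised to the power p again. *)
Lemma tent_pointwise : exists2 C : R, 1 <= C & forall f, analytic_disc f ->
  forall z : R * R, @disc R z ->
  ((cabs (f (cplx z)) `^ p)%:E <= C%:E * ((cabs (f 0) `^ p)%:E + tent_mean p e f z))%E.
Proof.
have [C1 C10 H] := @derivative_tent_mean R p e p0.
(* (-p - e)/p = -b - 1, the exponent expected by [radial_bound]. *)
pose b := e / p; have b0 : 0 < b by rewrite divr_gt0.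
pose C := (1 + 2 `^ p) * (1 + (2 / b) `^ p * C1).
have C2 : 1 <= C.
  have h1 : 0 <= (2 / b) `^ p * C1 by rewrite mulr_ge0 ?powR_ge0// ltW.
  have h2 : 0 <= 2 `^ p by exact: powR_ge0.
  rewrite /C mulrDl mul1r mulrDr mulr1; have := mulr_ge0 h2 h1; lra.
exists C => // f af z zd.
have [TE|[r rE]] : tent_mean p e f z = +oo%E \/ exists r, tent_mean p e f z = r%:E.
  by have := tent_mean_ge0 f z; case: (tent_mean p e f z) => [r|_|//]; [right; exists r|left].
  by rewrite TE addey// gt0_muley ?leey// lte_fin (lt_le_trans ltr01).
have r0 : 0 <= r by have := tent_mean_ge0 f z; rewrite rE lee_fin.
rewrite rE -EFinD -EFinM lee_fin.
have t0 : 0 < 1 - cabs (cplx z) by rewrite subr_gt0.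
set t := 1 - cabs (cplx z) in t0.
have pV0 : 0 <= p^-1 by rewrite invr_ge0 ltW.
have pVp : p * p^-1 = 1 by rewrite divff ?gt_eqF.
pose G := (C1 * t `^ e * r) `^ p^-1.
have B x : 0 <= x <= 1 -> cabs (derive1 f (x%:C * cplx z)) <= G * (1 - x * cabs (cplx z)) `^ (- b - 1).
  move=> x01; have := H f af z x zd x01; rewrite rE -EFinM lee_fin -/t => h.
  have s0 : 0 < 1 - x * cabs (cplx z).
    rewrite subr_gt0; apply: le_lt_trans zd; move: x01 => /andP[? ?].
    by rewrite ler_piMl// cabs_ge0.
  rewrite -[leLHS](powRr1 (cabs_ge0 _)) -[X in _ `^ X <= _]pVp powRrM.
  have E : - b - 1 = (- p - e) * p^-1 by rewrite mulrDl !mulNr pVp /b addrC.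
  rewrite E powRrM -powRM ?powR_ge0//; last by rewrite !mulr_ge0 ?powR_ge0// ltW.
  apply: ge0_ler_powR; rewrite ?nnegrE ?mulr_ge0 ?powR_ge0 ?(ltW C10)//.
  by apply: le_trans h _; apply: le_of_eq; ring.
have G0 : 0 <= G by exact: powR_ge0.
have := radial_bound af zd b0 G0 B; rewrite -/t => fz.
(* The factor (1 - |z|)^e of the kernel bound, after the root, cancels exactly the growth (1 -
   |z|)^(-b) of the radial integral. *)
have GE : G * t `^ (- b) = (C1 * r) `^ p^-1.
  have C1r0 : 0 <= C1 * r by rewrite mulr_ge0// ltW.
  rewrite /G (mulrAC C1) (powRM _ C1r0 (powR_ge0 _ _)) -powRrM -mulrA.
  by rewrite -powRD ?(gt_eqF t0) ?implybT// subrr powRr0 mulr1.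
have {}fz : cabs (f (cplx z)) <= cabs (f 0) + 2 / b * (C1 * r) `^ p^-1.
  by apply: (le_trans fz); rewrite -GE lerD2l; apply: le_of_eq; ring.
have C1r : 0 <= C1 * r by rewrite mulr_ge0// ltW.
have b2 : 0 <= 2 / b by rewrite divr_ge0// ltW.
have ag0 : 0 <= 2 / b * (C1 * r) `^ p^-1 by rewrite mulr_ge0 ?powR_ge0.
apply: (@le_trans _ _ ((cabs (f 0) + 2 / b * (C1 * r) `^ p^-1) `^ p)).
  by apply: ge0_ler_powR; rewrite ?(ltW p0) ?nnegrE ?cabs_ge0// addr_ge0 ?cabs_ge0.
apply: (le_trans (powRD_le (cabs_ge0 _) ag0)).
rewrite (powRM _ b2 (powR_ge0 _ _)) -powRrM (mulrC p^-1) pVp powRr1//.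
have := powR_ge0 (cabs (f 0)) p; have := powR_ge0 2 p; have := powR_ge0 (2 / b) p.
move: r0 C10; rewrite /C; move: ((2 / b) `^ p) (2 `^ p) (cabs (f 0) `^ p) => x2 x3 x4; clear.
move=> r0 C10 x20 x30 x40.
have m1 := mulr_ge0 x20 (ltW C10); have m2 := mulr_ge0 m1 x40; have m3 := mulr_ge0 x30 m2.
have m4 := mulr_ge0 x30 r0.
rewrite -subr_ge0 (_ : _ - _ = x4 + r + x2 * C1 * x4 + x2 * C1 * r + x3 * (x2 * C1 * x4) + x3 * r).
  by rewrite !addr_ge0// !mulr_ge0// ltW.
by ring.
Qed.

End tent_inclusion.

Section carleson_tent.
Context {R : realType} (mu : {measure set (R * R) -> \bar R}) (p q K : R).
Local Notation area := (area_measure R).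
Hypothesis K0 : 0 <= K.
Hypothesis HK : forall I, (mu (carleson_square I) <= (K * arc_length I `^ (q + 1))%:E)%E.
Hypothesis p0 : 0 < p.
Hypothesis q0 : 0 < q.

Lemma carleson_tent : exists2 C : R, 0 <= C & forall f, analytic_disc f -> forall I,
  (\int[mu]_(z in carleson_square I) (cabs (f (cplx z)) `^ p)%:E <=
   (C * arc_length I `^ q)%:E * ((cabs (f 0) `^ p)%:E +
     \int[area]_(w in @disc R) (dirichlet_density p f w)%:E))%E.
Proof.
(* Halving makes e < q strict while keeping e <= 1. *)
pose e : R := Num.min q 1 / 2.
have m0 : 0 < Num.min q 1 by rewrite lt_min q0 ltr01.
have [mq m1] : Num.min q 1 <= q /\ Num.min q 1 <= 1 by rewrite !ge_min !lexx orbT.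
have e0 : 0 < e by rewrite divr_gt0.
have eq : e < q by rewrite /e; lra.
have e1 : e <= 1 by rewrite /e; lra.
have [C C1 HC] := tent_pointwise p0 e0.
have C0 : 0 <= C by apply: le_trans C1.
have [C' C'0 HC'] := tent_kernel_carleson K0 HK e0 eq e1.
exists (C * (K + C')); first by rewrite mulr_ge0// addr_ge0.
move=> f af I; have md := @measurable_disc R; have mS := measurable_carleson_square I.
have Sd z : carleson_square I z -> @disc R z by move=> /carleson_square_disc /andP[].
have mdens := measurable_dirichlet_density p af.
have D0 w : (0 <= (dirichlet_density p f w)%:E)%E by rewrite lee_fin dirichlet_density_ge0.
have h0 := arc_length_gt0 I; have h1 := arc_length_le1 I.
(* The constant |f(0)|^p meets only mu(S(I)), and |I| <= 1 allows giving away one power. *)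
have muS : (mu (carleson_square I) <= (K * arc_length I `^ q)%:E)%E.
  apply: (le_trans (HK I)); rewrite lee_fin ler_wpM2l//.
  by apply: ger_powR; rewrite ?h0 ?h1// lerDl.
have mk := measurable_tent_kernel e.
have mT : measurable_fun (carleson_square I) (tent_mean p e f).
  rewrite (_ : tent_mean p e f = fun z : R * R => (\int[area]_(w in @disc R)
    ((dirichlet_density p f (z, w).2)%:E * tent_kernel e (z, w)))%E)//.
  pose k z := ((dirichlet_density p f z.2)%:E * tent_kernel e z)%E.
  apply: (@measurable_section_integral _ _ _ _ R area (carleson_square I) (@disc R) k) => //.
  - exact: area_disc.
  - apply: emeasurable_funM; last exact: measurable_funTS.
    apply: (measurable_comp (F := @disc R) (f := fun w => (dirichlet_density p f w)%:E) (g := snd)) => //.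
    + by move=> _ [[x y] [_ /= Dy] <-].
    + exact/measurable_EFinP.
    + exact: measurable_funTS.
  - by move=> z; rewrite /k; apply: mule_ge0 => //; exact: tent_kernel_ge0.
apply: (@le_trans _ _ (\int[mu]_(z in carleson_square I)
    (C%:E * (cst (cabs (f 0) `^ p)%:E z + tent_mean p e f z)))%E).
  by apply: ge0_integral_mono => z /Sd zd; [rewrite lee_fin powR_ge0|exact: HC].
have f0 : (0 <= (cabs (f 0) `^ p)%:E)%E by rewrite lee_fin powR_ge0.
rewrite ge0_integralZl//; last 2 first.
- by apply: emeasurable_funD => //; exact: measurable_cst.
- by move=> z _; rewrite adde_ge0//= tent_mean_ge0.
rewrite ge0_integralD//; last by move=> z _; exact: tent_mean_ge0.
rewrite integral_cst//.
have T : (\int[mu]_(z in carleson_square I) tent_mean p e f z <=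
   \int[area]_(w in @disc R) ((dirichlet_density p f w)%:E * (C' * arc_length I `^ q)%:E))%E.
  apply: schur_tonelli => //.
  - by apply: le_lt_trans (HK I) _; exact: ltry.
  - exact: area_disc.
  - exact: measurable_funTS.
  - by move=> z; exact: tent_kernel_ge0.
  - exact/measurable_EFinP.
  - by move=> w wd; exact: HC'.
rewrite ge0_integralZr// in T; last 2 first.
- exact/measurable_EFinP.
- by rewrite lee_fin mulr_ge0 ?powR_ge0.
set J := (\int[area]_(w in _) _)%E in T *.
have J0 : (0 <= J)%E by exact: integral_ge0.
rewrite -mulrA EFinM -muleA; apply: lee_wpmul2l; first by rewrite lee_fin.
rewrite ge0_muleDr//.
have K'0 : (0 <= (K * arc_length I `^ q)%:E)%E by rewrite lee_fin mulr_ge0 ?powR_ge0.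
have hq : 0 <= arc_length I `^ q by exact: powR_ge0.
apply: leeD.
  rewrite muleC; apply: lee_wpmul2r => //; apply: (le_trans muS).
  by rewrite lee_fin ler_wpM2r// lerDl.
apply: (le_trans T); rewrite muleC; apply: lee_wpmul2r => //.
by rewrite lee_fin ler_wpM2r// lerDr.
Qed.

End carleson_tent.

(** * Test functions *)

Section area_weights.
Context {R : realType}.
Local Notation area := (area_measure R).

Lemma measurable_plane_id : measurable_fun [set: measurableTypeR R * measurableTypeR R]
  (@idfun (R * R)%type : measurableTypeR R * measurableTypeR R -> R * R).
Proof. by move=> _ A mA; rewrite setTI. Qed.

(* The planar Lebesgue measure as a measure on the same instance of measurable
   space as mu: the sigma-algebras coincide but their displays differ. *)
Definition plane_area : {measure set (R * R) -> \bar R} :=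
  measure_function_pushforward__canonical__measure_function_Measure area measurable_plane_id.

Lemma integral_plane_area D f : measurable D -> measurable_fun D f ->
  (forall w, 0 <= f w)%E -> (\int[plane_area]_(w in D) f w = \int[area]_(w in D) f w)%E.
Proof. by move=> mD mf f0; rewrite (ge0_integral_pushforward measurable_plane_id). Qed.

(** S(I) fits in a square of half-side 9 |I|, of area 4 * 81 |I|^2. This makes the estimates for
    Carleson measures available for area itself. *)
Lemma area_carleson I : (plane_area (carleson_square I) <= (324 * arc_length I `^ 2)%:E :> \bar R)%E.
Proof.
have h0 := arc_length_gt0 I.
pose c : R * R := (cos (arc_start I), sin (arc_start I)).
apply: (@le_trans _ _ (plane_area (qsquare c (9 * arc_length I)))).
  apply: le_measure; rewrite ?inE; [exact: measurable_carleson_square|exact: measurable_qsquare|].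
  move=> w /carleson_square_near wI; apply/qsquareP.
  by split; apply: le_trans wI; [exact: Re_le_cabs|exact: Im_le_cabs].
rewrite [leLHS](area_qsquare c (ltac:(by rewrite mulr_gt0) : 0 < 9 * arc_length I)).
rewrite lee_fin powR_mulrn ?(ltW h0)//.
by apply: le_of_eq; ring.
Qed.

Lemma measurable_one_sub_powR (s : R) D :
  measurable_fun D (fun w : R * R => ((1 - cabs (cplx w)) `^ s)%:E).
Proof.
apply: measurable_funTS; apply/measurable_EFinP.
exact: (measurableT_comp (measurable_powR s) measurable_one_sub_cabs).
Qed.

(** For s < 0 this is [carleson_dbox_integral] for area with e = -s < 1; for s >= 0 the weight is at
    most rho^s on the box. *)
Lemma area_dbox_weight (s : R) : -1 < s -> exists2 K : R, 0 <= K & forall c rho, 0 < rho ->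
  (\int[area]_(w in dbox c rho) ((1 - cabs (cplx w)) `^ s)%:E <= (K * rho `^ (s + 2))%:E)%E.
Proof.
move=> s1; have K0 : 0 <= 324 :> R by [].
have w0 (w : R * R) : (0 <= ((1 - cabs (cplx w)) `^ s)%:E)%E by rewrite lee_fin powR_ge0.
suff [K K1 HK] : exists2 K : R, 0 <= K & forall c rho, 0 < rho ->
    (\int[plane_area]_(w in dbox c rho) ((1 - cabs (cplx w)) `^ s)%:E <= (K * rho `^ (s + 2))%:E)%E.
  exists K => // c rho rho0; rewrite -integral_plane_area ?HK//.
    exact: measurable_dbox.
  exact: measurable_one_sub_powR.
have [s0|s0] := ltP s 0.
  have e0 : 0 < - s by rewrite oppr_gt0.
  have es : - s < 2 - 1 by lra.
  have [K HK0 HK] := carleson_dbox_integral (mu := plane_area) K0 area_carleson e0 es.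
  exists K => // c rho rho0; have := HK c rho rho0.
  by rewrite opprK (addrC 2).
have [K HK0 HK] := carleson_dbox (mu := plane_area) K0 area_carleson (ltac:(by []) : 0 <= 2 :> R).
exists K => // c rho rho0.
have mB := measurable_dbox c rho.
apply: (@le_trans _ _ (\int[plane_area]_(w in dbox c rho) (cst (rho `^ s)%:E w))%E).
  apply: ge0_integral_mono => w [w1 wr _]; rewrite lee_fin ?powR_ge0//.
  by apply: ge0_ler_powR; rewrite ?nnegrE ?subr_ge0 ?(ltW rho0) ?(ltW w1).
rewrite integral_cst//.
have := lee_wpmul2l (ltac:(by rewrite lee_fin powR_ge0) : (0 <= (rho `^ s)%:E)%E) (HK c rho rho0).
move=> /le_trans; apply; rewrite -EFinM lee_fin mulrCA -powRD//.
by rewrite (gt_eqF rho0) implybT.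
Qed.

(** Denominator of the test function, comparable on the disc to h + |z - e^(it)|; for h < 1 it
    vanishes at e^(it)/(1 - h), outside the disc. *)
Definition pole_dist (h t : R) (z : C R) : C R := 1 - (1 - h)%:C * eit (- t) * z.

Section pole.
Variables (h t : R).
Hypothesis h01 : 0 < h <= 1.

Lemma pole_dist_le (z : C R) : cabs z < 1 -> cabs (pole_dist h t z) <= cabs (z - eit t) + h.
Proof.
move=> z1; have /andP[h0 h1] := h01.
have ee : eit (- t) * eit t = 1 :> C R by rewrite -eitD addNr /eit cos0 sin0.
have E : pole_dist h t z = - (eit (- t) * (z - eit t)) + h%:C * (eit (- t) * z).
  by rewrite mulrBr ee /pole_dist rmorphB rmorph1; ring.
rewrite E; apply: (le_trans (cabsD _ _)); rewrite cabsN !cabsM !cabs_eit !mul1r lerD2l.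
by rewrite cabs_real ger0_norm ?(ltW h0)// ler_piMr// ltW.
Qed.

Lemma pole_dist_ge (z : C R) : cabs z < 1 ->
  h <= cabs (pole_dist h t z) /\ cabs (z - eit t) <= 2 * cabs (pole_dist h t z).
Proof.
move=> z1; have /andP[h0 h1] := h01.
have ee : eit (- t) * eit t = 1 :> C R by rewrite -eitD addNr /eit cos0 sin0.
have a : h <= cabs (pole_dist h t z).
  have := cabs_tri 1 ((1 - h)%:C * eit (- t) * z); rewrite -/(pole_dist h t z).
  rewrite !cabsM cabs_eit mulr1 cabs_real ger0_norm ?subr_ge0// cabs_real normr1.
  have : (1 - h) * cabs z <= 1 - h by rewrite ler_piMr ?subr_ge0// ltW.
  lra.
split=> //.
have E : eit (- t) * (z - eit t) = h%:C * (eit (- t) * z) - pole_dist h t z.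
  by rewrite mulrBr ee /pole_dist rmorphB rmorph1; ring.
rewrite -[leLHS]mul1r -(cabs_eit (- t)) -cabsM E.
apply: (le_trans (cabsB _ _)); rewrite !cabsM cabs_eit mul1r cabs_real ger0_norm ?(ltW h0)//.
have : h * cabs z <= h by rewrite ler_piMr// ltW.
lra.
Qed.
End pole.

(** At distance about 2^k h from e^(it) the integrand is of order 2^(-kb) times the weight, whose
    integral there is of order (2^k h)^(s+2); the series converges because s + 2 < b. *)
Lemma pole_area_integral (s b : R) : -1 < s -> s + 2 < b -> exists2 K : R, 0 <= K &
  forall h t, 0 < h <= 1 ->
  (\int[area]_(w in @disc R) ((h / cabs (pole_dist h t (cplx w))) `^ b *
     (1 - cabs (cplx w)) `^ s)%:E <= (K * h `^ (s + 2))%:E)%E.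
Proof.
move=> s1 sb; have [K K0 HK] := area_dbox_weight s1.
have b0 : 0 <= b by lra.
pose th : R := 2 `^ (s + 2 - b).
have th0 : 0 < th by rewrite powR_gt0.
have th1 : th < 1.
  rewrite /th -(opprB b) powRN invf_lt1 ?powR_gt0//.
  have := @gt0_ltr_powR R (b - (s + 2)) ltac:(lra) 1 2 ltac:(by rewrite nnegrE) ltac:(by rewrite nnegrE).
  by rewrite powR1; apply; rewrite ltr1n.
exists (2 `^ b * K * 2 `^ (s + 2) / (1 - th)).
  by rewrite divr_ge0 ?subr_ge0 ?(ltW th1)// !mulr_ge0// powR_ge0.
move=> h t h01; have /andP[h0 h1] := h01.
rewrite (_ : _ / (1 - th) * h `^ (s + 2) = (2 `^ b * K * 2 `^ (s + 2) * h `^ (s + 2)) / (1 - th)); last by ring.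
have md := @measurable_disc R.
(* Closed discs instead of annuli: [integral_le_geometric] tolerates overlap. *)
pose A k : set (R * R) := (fun w => cabs (cplx w - eit t)) @^-1` `]-oo, 2 ^+ k.+1 * h].
have mA k : measurable (A k).
  by rewrite -[X in measurable X]setTI; exact: (measurable_cabs (eit t)).
apply: (@integral_le_geometric _ _ _ area (@disc R) _
  (fun w => ((1 - cabs (cplx w)) `^ s)%:E) A (fun k => (2 / 2 ^+ k) `^ b)) => //.
- exact: measurable_one_sub_powR.
- by move=> w _; rewrite lee_fin mulr_ge0 ?powR_ge0.
- by move=> w; rewrite lee_fin powR_ge0.
- by rewrite th0.
- move=> w wd; have [D1 D2] := pole_dist_ge t h01 wd.
  (* [m] is at most twice |pole_dist|, and the dyadic size of h/m selects the disc. *)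
  set m := Num.max h (cabs (cplx w - eit t)).
  have mh : h <= m by rewrite le_max lexx.
  have mw : cabs (cplx w - eit t) <= m by rewrite le_max lexx orbT.
  have mD : m <= 2 * cabs (pole_dist h t (cplx w)) by rewrite ge_max D2 andbT; lra.
  have m0 : 0 < m by exact: lt_le_trans mh.
  have D0 : 0 < cabs (pole_dist h t (cplx w)) by exact: lt_le_trans D1.
  have [k /andP[k1 k2]] := @dyadic_bracket R 1 (h / m) (divr_gt0 h0 m0) ltac:(by rewrite ler_pdivrMr// mul1r).
  have q0 : 0 < 2 ^+ k :> R by rewrite exprn_gt0.
  have q1 : 0 < 2 ^+ k.+1 :> R by rewrite exprn_gt0.
  exists k.
    rewrite /A /preimage /= in_itv/=; apply: (le_trans mw).
    by move: k1; rewrite ltr_pdivrMr// mulrAC ltr_pdivlMr// mul1r mulrC => /ltW.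
  rewrite -EFinM lee_fin ler_wpM2r ?powR_ge0//.
  apply: ge0_ler_powR; rewrite ?nnegrE ?divr_ge0 ?(ltW h0) ?(ltW D0) ?(ltW q0)//.
  apply: (@le_trans _ _ (2 * (h / m))); last by apply: ler_wpM2l => //; rewrite -[leRHS]mul1r.
  by rewrite mulrCA ler_pM2l// ler_pdivlMr// mulrC ler_pdivrMr.
move=> k; apply: (@le_trans _ _ (((2 / 2 ^+ k) `^ b)%:E * (K * (2 ^+ k.+1 * h) `^ (s + 2))%:E)%E).
  apply: lee_wpmul2l; first by rewrite lee_fin powR_ge0.
  apply: le_trans (HK (eit t) (2 ^+ k.+1 * h) _); last by rewrite mulr_gt0 ?exprn_gt0.
  apply: ge0_subset_mono; last by move=> w _; rewrite lee_fin powR_ge0.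
  move=> w [+ wd]; rewrite /A /preimage /= in_itv/= => wk; split=> //.
  (* 1 - |w| <= |e^(it) - w|, so the distance bound implies the height condition of [dbox]. *)
  apply: le_trans wk; have := cabs_tri (eit t) (cplx w); rewrite cabs_eit cabsC; lra.
rewrite -EFinM lee_fin; apply: le_of_eq.
have q0 : 0 <= 2 ^+ k :> R by rewrite exprn_ge0.
have q1 : 0 < 2 ^+ k :> R by rewrite exprn_gt0.
have -> : th ^+ k = (2 ^+ k) `^ (s + 2) * (2 ^+ k) `^ (- b).
  rewrite -powRD ?(gt_eqF q1) ?implybT// /th -powR_mulrn ?powR_ge0// -powRrM mulrC powRrM.
  by rewrite powR_mulrn.
rewrite exprS !powRM ?mulr_ge0 ?invr_ge0 ?(ltW h0)//.
rewrite -(powR_inv1 q0) -powRrM mulN1r; ring.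
Qed.

End area_weights.

Section test_functions.
Context {R : realType} (p q : R).
Local Notation area := (area_measure R).
Hypothesis p0 : 0 < p.
Hypothesis q0 : 0 < q.

Definition test_function (N : nat) (h t : R) (z : C R) : C R := (h%:C / pole_dist h t z) ^+ N.+1.

Section properties.
Variables (N : nat) (h t : R).
Hypothesis h01 : 0 < h <= 1.

Lemma cabs_test_function z : cabs (test_function N h t z) = (h / cabs (pole_dist h t z)) ^+ N.+1.
Proof.
have /andP[h0 h1] := h01.
by rewrite /test_function cabsX cabsM cabsV cabs_real ger0_norm// ltW.
Qed.

Lemma cdiff_test_function z : cabs z < 1 -> cdiff (test_function N h t) z
  (N.+1%:R * (h%:C / pole_dist h t z) ^+ N *
    (h%:C * ((1 - h)%:C * eit (- t)) / pole_dist h t z ^+ 2)).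
Proof.
move=> z1; have /andP[h0 h1] := h01.
have D0 : pole_dist h t z != 0.
  by rewrite -cabs_eq0 gt_eqF//; apply: lt_le_trans h0 _; have [] := pole_dist_ge t h01 z1.
pose k : C R := (1 - h)%:C * eit (- t).
have d1 : cdiff (pole_dist h t) z (- k).
  have := cdiffD (cdiff_cst 1 z) (cdiffM (cdiff_cst (- k) z) (cdiff_id z)).
  rewrite mul0r !add0r mulr1; congr (cdiff _ _ _).
  by apply/funext => x; rewrite /pole_dist -/k mulNr.
have := cdiffX N (cdiffM (cdiff_cst h%:C z) (cdiffV D0 d1)).
by rewrite -/k opprK mul0r add0r (mulrA h%:C k).
Qed.

Lemma analytic_test_function : analytic_disc (test_function N h t).
Proof. by move=> z /cdiff_test_function /cdiff_derivable[]. Qed.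

(** Differentiating costs 1/h and gains one power of h/|pole_dist|; the factor 1 - h is dropped. *)
Lemma derive_test_function z : cabs z < 1 -> cabs (derive1 (test_function N h t) z) <=
  N.+1%:R / h * (h / cabs (pole_dist h t z)) ^+ N.+2.
Proof.
move=> z1; have /andP[h0 h1] := h01.
have [_ ->] := cdiff_derivable (cdiff_test_function z1).
have [D1 _] := pole_dist_ge t h01 z1; have D0 := lt_le_trans h0 D1.
rewrite !cabsM cabsV !cabsX cabsM cabsV cabs_eit mulr1 !cabs_real.
rewrite (ger0_norm (ltW h0)) ger0_norm ?subr_ge0//.
have -> : cabs (N.+1%:R : C R) = N.+1%:R.
  by rewrite (_ : N.+1%:R = (N.+1%:R : R)%:C) ?cabs_real ?ger0_norm// rmorph_nat.
set D := cabs _ in D0 *; rewrite !exprS.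
have E : 0 <= N.+1%:R * (h / D) ^+ N * (h / (D * D)) :> R.
  have hD := divr_gt0 h0 D0; have DD := mulr_gt0 D0 D0; have hDD := divr_gt0 h0 DD.
  by apply: mulr_ge0; [apply: mulr_ge0; [exact: ler0n|exact/exprn_ge0/ltW]|exact: ltW].
rewrite expr0 mulr1 [leLHS](_ : _ = N.+1%:R * (h / D) ^+ N * (h / (D * D)) * (1 - h)); last by ring.
rewrite [leRHS](_ : _ = N.+1%:R * (h / D) ^+ N * (h / (D * D))); last first.
  by field; rewrite !gt_eqF.
by rewrite ler_piMr//; lra.
Qed.

End properties.

Lemma measurable_pole_weight (h t b s : R) : 0 < h <= 1 -> measurable_fun (@disc R) (fun w : R * R =>
  ((h / cabs (pole_dist h t (cplx w))) `^ b * (1 - cabs (cplx w)) `^ s)%:E).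
Proof.
move=> h01; have at0 := @analytic_test_function 0 h t h01.
rewrite (_ : (fun w => _) = fun w : R * R => ((cabs (test_function 0 h t (cplx w))) `^ b *
    (1 - cabs (cplx w)) `^ s)%:E); last first.
  by apply/funext => w; rewrite cabs_test_function ?expr1.
apply/measurable_EFinP; apply: measurable_funM.
  apply: (measurableT_comp (measurable_powR b)).
  exact: (ccont_disc_measurable (analytic_ccont at0)).
by apply/measurable_EFinP; exact: measurable_one_sub_powR.
Qed.

Lemma test_functions : exists c : R, exists2 K : R, 0 < c & 0 <= K /\ forall I,
  exists f, [/\ analytic_disc f,
    forall w : R * R, carleson_square I w -> c <= cabs (f (cplx w)) `^ p,
    ((cabs (f 0) `^ p)%:E + \int[area]_(w in @disc R) (dirichlet_density p f w)%:E <=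
       (K * arc_length I)%:E)%E &
    (\int[area]_(w in @disc R) (cabs (f (cplx w)) `^ p *
       (1 - cabs (cplx w) ^+ 2) `^ (q - 1))%:E <= (K * arc_length I `^ (q + 1))%:E)%E].
Proof.
have qs : -1 < q - 1 by rewrite ltrDr.
have ps : -1 < p - 1 by rewrite ltrDr.
have qp : 0 <= (q + 1) / p by rewrite divr_ge0 ?addr_ge0// ltW.
(* One exponent serves both integrals: (N + 1) p > q + 1 = (q - 1) + 2, and (N + 2) p > q + 1 + p >
   (p - 1) + 2. *)
pose N := Num.truncn ((q + 1) / p).
have Np : q + 1 < N.+1%:R * p.
  by rewrite -ltr_pdivrMr//; have /andP[] := truncn_itv qp.
have qb : q - 1 + 2 < N.+1%:R * p by rewrite (_ : q - 1 + 2 = q + 1)//; ring.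
have pb : p - 1 + 2 < N.+2%:R * p.
  rewrite -[N.+2]addn1 natrD mulrDl mul1r; move: Np q0; clear.
  by move: (N.+1%:R * p) => x; lra.
have [Kq Kq0 HKq] := pole_area_integral qs qb.
have [Kp Kp0 HKp] := pole_area_integral ps pb.
(* On S(I), |w - e^(it)| <= 9 h and [pole_dist_le] adds h, so h/|pole_dist| >= 1/10. *)
exists ((10^-1 ^+ N.+1) `^ p).
exists (1 + (N.+1%:R `^ p * 4 `^ `|p - 1| * Kp) + 4 `^ `|q - 1| * Kq).
  by rewrite powR_gt0// exprn_gt0// invr_gt0.
split; first by rewrite !addr_ge0 ?mulr_ge0 ?powR_ge0.
move=> I; set h := arc_length I; have h0 : 0 < h by exact: arc_length_gt0.
have h1 : h <= 1 by exact: arc_length_le1.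
have h01 : 0 < h <= 1 by rewrite h0.
set t := arc_start I; exists (test_function N h t).
have md := @measurable_disc R.
have pw x n : 0 <= x -> (x ^+ n) `^ p = x `^ (n%:R * p) by move=> x0; rewrite -powR_mulrn// -powRrM.
have quo0 w : 0 <= h / cabs (pole_dist h t w) by rewrite divr_ge0 ?cabs_ge0// ltW.
split.
- exact: analytic_test_function.
- move=> w wI; rewrite cabs_test_function//.
  have wd : cabs (cplx w) < 1 by have /andP[] := carleson_square_disc wI.
  have D1 := pole_dist_le t h01 wd; have [D2 _] := pole_dist_ge t h01 wd.
  have wt := carleson_square_near wI; rewrite -/h -/t in wt.
  have D0 := lt_le_trans h0 D2.
  apply: ge0_ler_powR; rewrite ?(ltW p0) ?nnegrE ?exprn_ge0 ?invr_ge0//.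
  apply: lerXn2r; rewrite ?nnegrE ?invr_ge0//.
  rewrite ler_pdivlMr// mulrC ler_pdivrMr//; lra.
- rewrite -/h; clearbody h t; rewrite -addrA mulrDl mul1r EFinD; apply: leeD.
    (* The value at 0 is h^(N+1); as (N + 1) p > 1 and h <= 1, its p-th power is at most h. *)
    rewrite lee_fin cabs_test_function// pw// /pole_dist mulr0 subr0 cabs_real normr1 divr1.
    rewrite -[leRHS](powRr1 (ltW h0)); apply: ger_powR; first by rewrite h0.
    by lra.
  apply: (@le_trans _ _ (\int[area]_(w in @disc R) (((N.+1%:R / h) `^ p * 4 `^ `|p - 1|)%:E *
     ((h / cabs (pole_dist h t (cplx w))) `^ (N.+2%:R * p) * (1 - cabs (cplx w)) `^ (p - 1))%:E))%E).
    apply: ge0_integral_mono => w wd; first by rewrite lee_fin dirichlet_density_ge0.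
    rewrite -EFinM lee_fin /dirichlet_density mulrACA; apply: ler_pM; rewrite ?powR_ge0//.
      have Nh : 0 <= N.+1%:R / h by apply: divr_ge0; [exact: ler0n|exact: ltW].
      have Q0 : 0 <= (h / cabs (pole_dist h t (cplx w))) ^+ N.+2 by apply: exprn_ge0.
      rewrite -pw// -(powRM p Nh Q0).
      apply: ge0_ler_powR; [exact: ltW|exact: cabs_ge0|exact: mulr_ge0|].
      exact: derive_test_function.
    by have [_] := one_sub_sqr_compare (p - 1) wd.
  rewrite ge0_integralZl//; last 3 first.
  + exact: measurable_pole_weight.
  + by move=> w _; rewrite lee_fin mulr_ge0 ?powR_ge0.
  + by rewrite lee_fin mulr_ge0 ?powR_ge0.
  have c0 : 0 <= (N.+1%:R / h) `^ p * 4 `^ `|p - 1| by rewrite mulr_ge0 ?powR_ge0.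
  apply: (le_trans (lee_wpmul2l (ltac:(by rewrite lee_fin) : (0 <= ((N.+1%:R / h) `^ p * 4 `^ `|p - 1|)%:E)%E) (HKp h t h01))).
  rewrite -EFinM lee_fin.
  (* h^(-p) comes from differentiating and h^(p+1) from the weighted area. *)
  have hp : h = h `^ (- p) * h `^ (p - 1 + 2).
    by rewrite -powRD ?(gt_eqF h0) ?implybT// (_ : - p + _ = 1) ?powRr1 ?(ltW h0)//; ring.
  rewrite [leLHS](_ : _ = N.+1%:R `^ p * 4 `^ `|p - 1| * Kp * h); last first.
    rewrite [in RHS]hp powRM ?invr_ge0 ?(ltW h0)// -[h^-1](powR_inv1 (ltW h0)) -powRrM mulN1r.
    by ring.
  by rewrite ler_wpM2r ?(ltW h0)// lerDl mulr_ge0 ?powR_ge0.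
- rewrite -/h; clearbody h t.
  apply: (@le_trans _ _ (\int[area]_(w in @disc R) ((4 `^ `|q - 1|)%:E *
     ((h / cabs (pole_dist h t (cplx w))) `^ (N.+1%:R * p) * (1 - cabs (cplx w)) `^ (q - 1))%:E))%E).
    apply: ge0_integral_mono => w wd; first by rewrite lee_fin mulr_ge0 ?powR_ge0.
    rewrite -EFinM lee_fin mulrCA cabs_test_function// pw//; apply: ler_wpM2l; first exact: powR_ge0.
    by have [_] := one_sub_sqr_compare (q - 1) wd.
  rewrite ge0_integralZl//; last 2 first.
  + exact: measurable_pole_weight.
  + by move=> w _; rewrite lee_fin mulr_ge0 ?powR_ge0.
  apply: (le_trans (lee_wpmul2l (ltac:(by rewrite lee_fin powR_ge0) : (0 <= (4 `^ `|q - 1|)%:E)%E) (HKq h t h01))).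
  rewrite -EFinM lee_fin (_ : q - 1 + 2 = q + 1); last by ring.
  by rewrite mulrA ler_wpM2r ?powR_ge0// lerDr !addr_ge0 ?mulr_ge0 ?powR_ge0.
Qed.

End test_functions.

(** * Equivalence *)

Section norm_powers.
Context {R : realType} (p : R).
Hypothesis p0 : 0 < p.

(** [bounded_inclusion] puts no sign on its constant, hence [Num.max K 0] before taking powers. *)
Lemma le_of_poweR_le (S D : \bar R) (K : R) : (0 <= S)%E -> (0 <= D)%E ->
  (S `^ p^-1 <= K%:E * D `^ p^-1)%E -> (S <= (Num.max K 0 `^ p)%:E * D)%E.
Proof.
move=> S0 D0 H; have pV : p^-1 * p = 1 by rewrite mulVf ?gt_eqF.
have m0 : (0 <= (Num.max K 0)%:E)%E by rewrite lee_fin le_max lexx orbT.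
have {}H : (S `^ p^-1 <= (Num.max K 0)%:E * D `^ p^-1)%E.
  apply: (le_trans H); apply: lee_wpmul2r; first exact: poweR_ge0.
  by rewrite lee_fin le_max lexx.
have := gt0_ler_poweR (ltW p0) _ _ H; rewrite poweRM ?poweR_ge0// poweR_EFin.
rewrite -!poweRrM pV !poweRe1//; apply.
  by rewrite in_itv/= poweR_ge0 leey.
by rewrite in_itv/= leey mule_ge0// poweR_ge0.
Qed.

Lemma poweR_le_of_le (S D : \bar R) (K : R) : 0 <= K -> (0 <= S)%E -> (0 <= D)%E ->
  (S <= K%:E * D)%E -> (S `^ p^-1 <= (K `^ p^-1)%:E * D `^ p^-1)%E.
Proof.
move=> K0 S0 D0 H; rewrite -poweR_EFin -poweRM//.
apply: gt0_ler_poweR => //; first by rewrite invr_ge0 ltW.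
  by rewrite in_itv/= S0 leey.
by rewrite in_itv/= leey mule_ge0.
Qed.

Lemma Lp_normE (mu : {measure set (R * R) -> \bar R}) (f : C R -> C R) :
  Lp_norm p mu f = ((\int[mu]_(w in @disc R) (cabs (f (cplx w)) `^ p)%:E) `^ p^-1)%E.
Proof.
rewrite /Lp_norm unlock /=; congr (_ `^ _)%E.
rewrite [RHS]integral_mkcond; apply: eq_integral => w _; rewrite !patchE.
case: ifP => _; first by rewrite abse_EFin poweR_EFin ger0_norm ?cabs_ge0.
by rewrite abse0 poweR0r// gt_eqF.
Qed.

End norm_powers.

Section equivalence.
Context {R : realType} (p q : R) (mu : {measure set (R * R) -> \bar R}).
Local Notation area := (area_measure R).
Hypothesis p0 : 0 < p.
Hypothesis q0 : 0 < q.

Lemma pi_ge1 : 1 <= pi :> R.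
Proof. by have := @pi_ge2 R; lra. Qed.

Lemma le_pi_scale (x : \bar R) : (0 <= x)%E -> ((pi^-1)%:E * x <= x)%E.
Proof.
move=> x0; rewrite -[leRHS]mul1e; apply: lee_wpmul2r => //.
by rewrite lee_fin invf_le1 ?pi_ge1// pi_gt0.
Qed.

Lemma pi_scaleK (x : \bar R) : (pi%:E * ((pi^-1)%:E * x) = x)%E.
Proof. by rewrite muleA -EFinM mulfV ?mul1e// gt_eqF// pi_gt0. Qed.

Lemma area_integral_ge0 (g : R * R -> \bar R) : (forall w, 0 <= g w)%E -> (0 <= area_integral g)%E.
Proof.
move=> g0; rewrite mule_ge0// ?lee_fin ?invr_ge0 ?pi_ge0//.
by apply: integral_ge0 => w _; exact: g0.
Qed.

(** [area_integral] carries 1/pi and the estimates do not; the factor pi in the constant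
    compensates, and 1 <= pi covers the term at 0. *)
Lemma carleson_dirichlet_tent : carleson_measure (q + 1) mu ->
  bounded_inclusion (@dirichlet R p) (dirichlet_norm p) (tent_norm p q mu).
Proof.
move=> /carleson_measure_bound[K K0 HK]; have [K1 K10 H] := carleson_tent K0 HK p0 q0.
exists ((K1 * pi) `^ p^-1) => f [af _].
have D0 w : (0 <= (dirichlet_density p f w)%:E)%E by rewrite lee_fin dirichlet_density_ge0.
have f0 : (0 <= (cabs (f 0) `^ p)%:E)%E by rewrite lee_fin powR_ge0.
have A0 : (0 <= area_integral (fun w => (dirichlet_density p f w)%:E))%E by exact: area_integral_ge0.
have pi0 : 0 <= pi :> R by exact: pi_ge0.
apply: poweR_le_of_le => //.
- by rewrite mulr_ge0.
- have [I _] := @disc_carleson_square R.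
  apply: (@le_trans _ _ (((arc_length I `^ q)^-1)%:E *
    \int[mu]_(w in carleson_square I) (cabs (f (cplx w)) `^ p)%:E)%E); last first.
    by apply: ereal_sup_ubound; exists I.
  rewrite mule_ge0//; first by rewrite lee_fin invr_ge0 powR_ge0.
  by apply: integral_ge0 => w _; rewrite lee_fin powR_ge0.
- exact: adde_ge0.
apply: ge_ereal_sup => _ [I _ <-].
rewrite lee_pdivrMl ?powR_gt0 ?arc_length_gt0//.
apply: (le_trans (H f af I)).
rewrite [in leRHS]EFinM -muleA [leRHS]muleA -EFinM (mulrC _ K1).
apply: lee_wpmul2l; first by rewrite lee_fin mulr_ge0 ?powR_ge0.
rewrite ge0_muleDr// pi_scaleK; apply: leeD2r.
by rewrite -[leLHS]mul1e; apply: lee_wpmul2r => //; rewrite lee_fin pi_ge1.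
Qed.

Lemma carleson_bergman_Lp : carleson_measure (q + 1) mu ->
  bounded_inclusion (@bergman R p (q - 1)) (bergman_norm p (q - 1)) (Lp_norm p mu).
Proof.
move=> /carleson_measure_bound[K K0 HK]; have [K1 K10 H] := carleson_bergman K0 HK p0 q0.
exists ((K1 * pi) `^ p^-1) => f [af _]; rewrite Lp_normE//.
apply: poweR_le_of_le => //.
- by rewrite mulr_ge0// pi_ge0.
- by apply: integral_ge0 => w _; rewrite lee_fin powR_ge0.
- by apply: area_integral_ge0 => w; rewrite lee_fin mulr_ge0 ?powR_ge0.
by rewrite EFinM -muleA /area_integral pi_scaleK; exact: H.
Qed.

(** The tent norm supplies |I|^q, and the Dirichlet norm of the test function, whose p-th power is
    of order |I|, supplies the missing power in |I|^(q+1). *)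
Lemma dirichlet_tent_carleson :
  bounded_inclusion (@dirichlet R p) (dirichlet_norm p) (tent_norm p q mu) ->
  carleson_measure (q + 1) mu.
Proof.
move=> [K HK]; have [c [K1 c0 [K10 H]]] := test_functions p0 q0.
apply: (@bound_carleson_measure _ _ _ (c^-1 * (Num.max K 0 `^ p * K1))) => I.
have [f [af fS fD _]] := H I.
have mS := measurable_carleson_square I.
have h0 := arc_length_gt0 I.
have f0 : (0 <= (cabs (f 0) `^ p)%:E)%E by rewrite lee_fin powR_ge0.
have D0 w : (0 <= (dirichlet_density p f w)%:E)%E by rewrite lee_fin dirichlet_density_ge0.
pose D : \bar R := ((cabs (f 0) `^ p)%:E + area_integral (fun w => (dirichlet_density p f w)%:E))%E.
have D0' : (0 <= D)%E by rewrite adde_ge0// area_integral_ge0.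
have DE : (D <= (K1 * arc_length I)%:E)%E.
  apply: le_trans fD; rewrite leeD2l//; apply: le_pi_scale.
  by apply: integral_ge0 => w _; exact: D0.
have fX : dirichlet p f.
  split=> //; rewrite /dirichlet_norm; apply: poweR_lty.
  by apply: le_lt_trans DE _; exact: ltry.
have := HK f fX.
pose S := ereal_sup (range (fun I : circle_arc R => ((arc_length I `^ q)^-1)%:E *
   \int[mu]_(w in carleson_square I) (cabs (f (cplx w)) `^ p)%:E)%E).
have SI : (((arc_length I `^ q)^-1)%:E *
   \int[mu]_(w in carleson_square I) (cabs (f (cplx w)) `^ p)%:E <= S)%E.
  by apply: ereal_sup_ubound; exists I.
have i0 : (0 <= \int[mu]_(w in carleson_square I) (cabs (f (cplx w)) `^ p)%:E)%E.
  by apply: integral_ge0 => w _; rewrite lee_fin powR_ge0.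
have S0 : (0 <= S)%E.
  by apply: le_trans SI; rewrite mule_ge0// lee_fin invr_ge0 powR_ge0.
move=> /(le_of_poweR_le p0 S0 D0') /(le_trans SI).
rewrite lee_pdivrMl ?powR_gt0// => H1.
have cmu : (c%:E * mu (carleson_square I) <= \int[mu]_(w in carleson_square I) (cabs (f (cplx w)) `^ p)%:E)%E.
  rewrite -integral_cst//; apply: ge0_integral_mono => w wI; first by rewrite lee_fin ltW.
  by rewrite lee_fin fS.
have M0 : (0 <= (Num.max K 0 `^ p)%:E)%E by rewrite lee_fin powR_ge0.
have h1 : (0 <= (arc_length I `^ q)%:E)%E by rewrite lee_fin powR_ge0.
have := le_trans (le_trans cmu H1) (lee_wpmul2l h1 (lee_wpmul2l M0 DE)).
rewrite -lee_pdivlMl// -!EFinM => /le_trans; apply; rewrite lee_fin.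
rewrite powRD ?(gt_eqF h0) ?implybT// powRr1 ?(ltW h0)//; apply: le_of_eq.
by ring.
Qed.

Lemma bergman_Lp_carleson :
  bounded_inclusion (@bergman R p (q - 1)) (bergman_norm p (q - 1)) (Lp_norm p mu) ->
  carleson_measure (q + 1) mu.
Proof.
move=> [K HK]; have [c [K1 c0 [K10 H]]] := test_functions p0 q0.
apply: (@bound_carleson_measure _ _ _ (c^-1 * (Num.max K 0 `^ p * K1))) => I.
have [f [af fS _ fB]] := H I.
have mS := measurable_carleson_square I.
pose D : \bar R := area_integral (fun w => (cabs (f (cplx w)) `^ p *
                    (1 - cabs (cplx w) ^+ 2) `^ (q - 1))%:E).
have D0 : (0 <= D)%E by apply: area_integral_ge0 => w; rewrite lee_fin mulr_ge0 ?powR_ge0.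
have DE : (D <= (K1 * arc_length I `^ (q + 1))%:E)%E.
  apply: le_trans fB; apply: le_pi_scale.
  by apply: integral_ge0 => w _; rewrite lee_fin mulr_ge0 ?powR_ge0.
have fX : bergman p (q - 1) f.
  split=> //; rewrite /bergman_norm; apply: poweR_lty.
  by apply: le_lt_trans DE _; exact: ltry.
have := HK f fX; rewrite Lp_normE//.
have S0 : (0 <= \int[mu]_(w in @disc R) (cabs (f (cplx w)) `^ p)%:E)%E.
  by apply: integral_ge0 => w _; rewrite lee_fin powR_ge0.
move=> /(le_of_poweR_le p0 S0 D0) H1.
have cmu : (c%:E * mu (carleson_square I) <= \int[mu]_(w in @disc R) (cabs (f (cplx w)) `^ p)%:E)%E.
  apply: (@le_trans _ _ (\int[mu]_(w in carleson_square I) (cabs (f (cplx w)) `^ p)%:E)%E).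
    rewrite -integral_cst//; apply: ge0_integral_mono => w wI; first by rewrite lee_fin ltW.
    by rewrite lee_fin fS.
  apply: ge0_subset_mono; last by move=> w _; rewrite lee_fin powR_ge0.
  by move=> w /carleson_square_disc /andP[].
have M0 : (0 <= (Num.max K 0 `^ p)%:E)%E by rewrite lee_fin powR_ge0.
have := le_trans (le_trans cmu H1) (lee_wpmul2l M0 DE).
by rewrite -lee_pdivlMl// -!EFinM !mulrA.
Qed.

End equivalence.

Theorem theorem1 (R : realType) (p q : R) (p_gt0 : 0 < p) (q_gt0 : 0 < q)
    (mu : {measure set (R * R) -> \bar R}) (mu_disc : mu (~` @disc R) = 0%E) :
  (bounded_inclusion (@dirichlet R p) (dirichlet_norm p) (tent_norm p q mu)
     <-> carleson_measure (q + 1) mu)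
  /\
  (carleson_measure (q + 1) mu
     <-> bounded_inclusion (@bergman R p (q - 1)) (bergman_norm p (q - 1))
           (Lp_norm p mu)).
Proof.
split; split.
- exact: dirichlet_tent_carleson.
- exact: carleson_dirichlet_tent.
- exact: carleson_bergman_Lp.
- exact: bergman_Lp_carleson.
Qed.
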